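(* Let $(q_n),(r_n)$ be complex sequences vanishing faster than any negative power of $|n|$ as $n\to\pm\infty$ with $1-q_nr_n\neq0$ and $1+q_nr_{n+1}\ne0$ for all $n$. With the notation of the context, for all integers $m>n$, $$\begin{bmatrix}\bar M_{nm}&M_{nm}\end{bmatrix}+\begin{bmatrix}0&\bar\Omega_{n+m}\\ \Omega_{n+m}&0\end{bmatrix}+\sum_{l=n+1}^\infty\begin{bmatrix}\bar M_{nl}&M_{nl}\end{bmatrix}\begin{bmatrix}0&\bar\Omega_{l+m}\\ \Omega_{l+m}&0\end{bmatrix}=\begin{bmatrix}0&0\\0&0\end{bmatrix}.$$
   Context: System (Q): $\begin{bmatrix}\alpha_n\\ \beta_n\end{bmatrix}=\begin{bmatrix} z & (z-z^{-1})q_n\\ z r_n & z^{-1}+(z-z^{-1})q_nr_n\end{bmatrix}\begin{bmatrix}\alpha_{n+1}\\ \beta_{n+1}\end{bmatrix}$, $n\in\mathbb Z$. For $|z|=1$ its Jost solutions (overbars never complex conjugation) are $\psi_n=\begin{bmatrix}o(1)\\ z^n[1+o(1)]\end{bmatrix}$, $\bar\psi_n=\begin{bmatrix}z^{-n}[1+o(1)]\\ o(1)\end{bmatrix}$ as $n\to+\infty$ and $\phi_n=\begin{bmatrix}z^{-n}[1+o(1)]\\ o(1)\end{bmatrix}$, $\bar\phi_n=\begin{bmatrix}o(1)\\ z^{n}[1+o(1)]\end{bmatrix}$ as $n\to-\infty$; the transmission coefficients $T,\bar T$ and reflection coefficients $R,\bar R$ are defined by $\phi_n=\begin{bmatrix}(1/T)z^{-n}[1+o(1)]\\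 (R/T)z^{n}[1+o(1)]\end{bmatrix}$ and $\bar\phi_n=\begin{bmatrix}(\bar R/\bar T)z^{-n}[1+o(1)]\\ (1/\bar T)z^{n}[1+o(1)]\end{bmatrix}$ as $n\to+\infty$; $T$ is meromorphic in $|z|<1$, $\bar T$ in $|z|>1$. Coefficients: $K_{nm}:=\frac1{2\pi i}\oint\psi_n z^{-m-1}dz$ and $\bar K_{nm}:=\frac1{2\pi i}\oint\bar\psi_n z^{m-1}dz$ (column vectors; $\oint$ is over the unit circle counterclockwise), so that $\psi_n=\sum_{l\ge n}K_{nl}z^l$ and $\bar\psi_n=\sum_{l\ge n}\bar K_{nl}z^{-l}$. The $2\times2$ matrix $\begin{bmatrix}\bar K_{nn}&K_{nn}\end{bmatrix}$ is invertible, and $\begin{bmatrix}\bar M_{nm}&M_{nm}\end{bmatrix}:=\begin{bmatrix}\bar K_{nn}&K_{nn}\end{bmatrix}^{-1}\begin{bmatrix}\bar K_{nm}&K_{nm}\end{bmatrix}$. Bound-state data: the poles of $T$ in $0<|z|<1$ are $\pm z_j$ ($1\le j\le N$) of multiplicity $m_j$, those of $\bar T$ in $|z|>1$ are $\pm\bar z_j$ ($1\le j\le\bar N$) of multiplicity $\bar m_j$. Residues $t_{jk}$, $\bar t_{jk}$: $T=\sum_{k=1}^{m_j}t_{jk}(z-z_j)^{-k}+O(1)$ as $z\to z_j$, $\bar T=\sum_{k=1}^{\bar m_j}\bar t_{jk}(z-\bar z_j)^{-k}+O(1)$ as $z\to\bar z_j$. Dependency constants: $\frac{d^k\phi_n(z_j)}{dz^k}=\sum_{l=0}^k\binom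 kl\gamma_{j(k-l)}\frac{d^l\psi_n(z_j)}{dz^l}$ ($0\le k\le m_j-1$, all $n$), and $\bar\gamma_{jk}$ analogously with barred quantities. Norming constants: $c_{jk}=-2\sum_{l=0}^{m_j-1-k}t_{j(k+1+l)}\gamma_{jl}/l!$, $\bar c_{jk}=2\sum_{l=0}^{\bar m_j-1-k}\bar t_{j(k+1+l)}\bar\gamma_{jl}/l!$. Triplets: $A_j$ is the $m_j\times m_j$ Jordan block with eigenvalue $z_j$ (ones on the superdiagonal), $B_j=\begin{bmatrix}0&\cdots&0&1\end{bmatrix}^T$ ($m_j\times1$), $C_j=\begin{bmatrix}c_{j(m_j-1)}&\cdots&c_{j1}&c_{j0}\end{bmatrix}$; $A=\mathrm{diag}(A_1,\dots,A_N)$, $B=\begin{bmatrix}B_1^T&\cdots&B_N^T\end{bmatrix}^T$, $C=\begin{bmatrix}C_1&\cdots&C_N\end{bmatrix}$; $(\bar A,\bar B,\bar C)$ analogously from $\bar z_j,\bar m_j,\bar c_{jk}$. Kernels: $\hat R_k:=\frac1{2\pi i}\oint R z^{k-1}dz$, $\hat{\bar R}_k:=\frac1{2\pi i}\oint\bar R z^{-k-1}dz$; for $k$ even $\Omega_k:=\hat R_k+CA^{k-1}B$, $\bar\Omega_k:=\hat{\bar R}_k+\bar C(\bar A)^{-k-1}\bar B$, and for $k$ odd $\Omega_k:=\bar\Omega_k:=0$. *)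

(* Defs.v *)
From HB Require Import structures.
From mathcomp Require Import all_boot all_order all_algebra.
From mathcomp Require Import complex.
From mathcomp Require Import all_classical all_reals all_analysis.
Set Implicit Arguments.
Unset Strict Implicit.
Unset Printing Implicit Defensive.
Import Order.TTheory GRing.Theory Num.Theory numFieldNormedType.Exports.
Local Open Scope ring_scope.
Local Open Scope classical_set_scope.

Definition CC (R : realType) : numClosedFieldType := R[i].

Section Defs.
Variable R : realType.
Local Notation C := (CC R).

Definition expi (t : R) : C := (cos t +i* sin t)%C.

(* (1/(2 pi i)) \oint_{|z|=1} f(z) dz, counterclockwise; with z = e^{it},
   dz = i e^{it} dt, this is (1/(2 pi)) \int_0^{2pi} f(e^{it}) e^{it} dt *)
Definition circ_int (f : C -> C) : C :=
  let g := fun t : R => f (expi t) * expi t in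
  let re := (2 * pi)^-1 * Rintegral lebesgue_measure `[0, 2 * pi]%classic
                    (fun t => complex.Re (g t)) in
  let im := (2 * pi)^-1 * Rintegral lebesgue_measure `[0, 2 * pi]%classic
                    (fun t => complex.Im (g t)) in
  (re +i* im)%C.

Definition holo (D : set C) (f : C -> C) : Prop :=
  forall z, D z -> derivable f z 1.

Definition lim_pinfty (f : int -> C) (l : C) : Prop :=
  (fun k : nat => f (k%:Z)) @ \oo --> l.
Definition lim_minfty (f : int -> C) (l : C) : Prop :=
  (fun k : nat => f (- (k%:Z))) @ \oo --> l.

Definition rapid_decay (q : int -> C) : Prop :=
  forall p : nat,
    lim_pinfty (fun n => (`|n|%N%:R : C) ^+ p * q n) 0 /\
    lim_minfty (fun n => (`|n|%N%:R : C) ^+ p * q n) 0.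

Definition pole_of_order (f : C -> C) (a : C) (m : nat) : Prop :=
  exists L : C, L != 0 /\ (fun z => (z - a) ^+ m * f z) @ a^' --> L.

Definition principal_part (f : C -> C) (a : C) (m : nat) (t : nat -> C) : Prop :=
  exists delta M : C, 0 < delta /\
    forall z, 0 < `|z - a| < delta ->
      `|f z - \sum_(1 <= k < m.+1) t k / (z - a) ^+ k| <= M.

Definition unit_circle : set C := [set z | `|z| = 1].
Definition Din : set C := [set z | 0 < `|z| < 1].
Definition Dinc : set C := [set z | 0 < `|z| <= 1].
Definition Dout : set C := [set z | 1 < `|z|].
Definition Doutc : set C := [set z | 1 <= `|z|].

Definition solQ (q r : int -> C) (z : C) (a b : int -> C) : Prop :=
  forall n : int,
    a n = z * a (n + 1) + (z - z^-1) * q n * b (n + 1) /\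
    b n = z * r n * a (n + 1) + (z^-1 + (z - z^-1) * q n * r n) * b (n + 1).

(* a vector function (f1,f2) of (n,z) solving (Q) on Dc, holomorphic on D and
   continuous on Dc (the closure of D in the punctured plane) *)
Definition sol_on (q r : int -> C) (D Dc : set C) (f1 f2 : int -> C -> C) : Prop :=
  (forall z, Dc z -> solQ q r z (fun n => f1 n z) (fun n => f2 n z)) /\
  (forall n, holo D (f1 n) /\ holo D (f2 n) /\
             {within Dc, continuous (f1 n)} /\ {within Dc, continuous (f2 n)}).

Definition jost_psi q r (f1 f2 : int -> C -> C) : Prop :=
  sol_on q r Din Dinc f1 f2 /\
  forall z, unit_circle z ->
    lim_pinfty (fun n => f1 n z) 0 /\ lim_pinfty (fun n => z ^ (- n) * f2 n z) 1.
Definition jost_psib q r (f1 f2 : int -> C -> C) : Prop :=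
  sol_on q r Dout Doutc f1 f2 /\
  forall z, unit_circle z ->
    lim_pinfty (fun n => z ^ n * f1 n z) 1 /\ lim_pinfty (fun n => f2 n z) 0.
Definition jost_phi q r (f1 f2 : int -> C -> C) : Prop :=
  sol_on q r Din Dinc f1 f2 /\
  forall z, unit_circle z ->
    lim_minfty (fun n => z ^ n * f1 n z) 1 /\ lim_minfty (fun n => f2 n z) 0.
Definition jost_phib q r (f1 f2 : int -> C -> C) : Prop :=
  sol_on q r Dout Doutc f1 f2 /\
  forall z, unit_circle z ->
    lim_minfty (fun n => f1 n z) 0 /\ lim_minfty (fun n => z ^ (- n) * f2 n z) 1.

Definition coefs_T (phi1 phi2 : int -> C -> C) (T Rf : C -> C) : Prop :=
  forall z, unit_circle z ->
    T z != 0 /\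
    lim_pinfty (fun n => z ^ n * phi1 n z) (T z)^-1 /\
    lim_pinfty (fun n => z ^ (- n) * phi2 n z) (Rf z / T z).
Definition coefs_Tb (phib1 phib2 : int -> C -> C) (Tb Rbf : C -> C) : Prop :=
  forall z, unit_circle z ->
    Tb z != 0 /\
    lim_pinfty (fun n => z ^ n * phib1 n z) (Rbf z / Tb z) /\
    lim_pinfty (fun n => z ^ (- n) * phib2 n z) (Tb z)^-1.

Definition pole_set N (zs : 'I_N -> C) : set C :=
  [set z | exists j, z = zs j \/ z = - zs j].
Definition mero_poles (D Dc : set C) (T : C -> C) N (zs : 'I_N -> C)
    (ms : 'I_N -> nat) : Prop :=
  (forall j, D (zs j)) /\
  (forall i j, i != j -> zs i != zs j /\ zs i != - zs j) /\
  (forall j, (0 < ms j)%N) /\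
  holo (D `\` pole_set zs) T /\
  {within Dc `\` pole_set zs, continuous T} /\
  (forall j, pole_of_order T (zs j) (ms j) /\ pole_of_order T (- zs j) (ms j)).

Definition dependency (phi1 phi2 psi1 psi2 : int -> C -> C) N (zs : 'I_N -> C)
    (ms : 'I_N -> nat) (gam : 'I_N -> nat -> C) : Prop :=
  forall j k n, (k < ms j)%N ->
    derive1n k (phi1 n) (zs j) =
      \sum_(l < k.+1) 'C(k, l)%:R * gam j (k - l)%N * derive1n l (psi1 n) (zs j) /\
    derive1n k (phi2 n) (zs j) =
      \sum_(l < k.+1) 'C(k, l)%:R * gam j (k - l)%N * derive1n l (psi2 n) (zs j).

(* norming constants; sgn = -2 for c, +2 for cbar *)
Definition norming (sgn : C) N (ms : 'I_N -> nat) (t gam : 'I_N -> nat -> C)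
    (j : 'I_N) (k : nat) : C :=
  sgn * \sum_(l < (ms j - k)%N) t j (k + 1 + l)%N * gam j l / (l`!)%:R.

Definition jordan (a : C) (m : nat) : 'M[C]_m :=
  \matrix_(i < m, l < m)
    (if (l == i :> nat) then a else if (l == i.+1 :> nat) then 1 else 0).
Definition Bblock (m : nat) : 'cV[C]_m :=
  \col_(i < m) (if (i.+1 == m)%N then 1 else 0).
Definition Cblock (m : nat) (c : nat -> C) : 'rV[C]_m :=
  \row_(i < m) c (m.-1 - i)%N.

Definition Amat N (zs : 'I_N -> C) (ms : 'I_N -> nat) : 'M[C]_(\sum_(j < N) ms j) :=
  \mxdiag_(j < N) jordan (zs j) (ms j).
Definition Bmat N (ms : 'I_N -> nat) : 'M[C]_(\sum_(j < N) ms j, 1) :=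
  \mxcol_(j < N) Bblock (ms j).
Definition Cmat N (ms : 'I_N -> nat) (c : 'I_N -> nat -> C)
  : 'M[C]_(1, \sum_(j < N) ms j) :=
  \mxrow_(j < N) Cblock (ms j) (c j).

Definition mxpowz s (A : 'M[C]_s) (k : int) : 'M[C]_s :=
  match k with
  | Posz n => A ^+ n
  | Negz n => (invmx A) ^+ n.+1
  end.

Definition Rhat (Rf : C -> C) (k : int) : C := circ_int (fun z => Rf z * z ^ (k - 1)).
Definition Rbhat (Rbf : C -> C) (k : int) : C := circ_int (fun z => Rbf z * z ^ (- k - 1)).

Definition Omega (Rf : C -> C) N (zs : 'I_N -> C) (ms : 'I_N -> nat)
    (c : 'I_N -> nat -> C) (k : int) : C :=
  if odd `|k|%N then 0
  else Rhat Rf k + (Cmat ms c *m mxpowz (Amat zs ms) (k - 1) *m Bmat ms) 0 0.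
Definition Omegab (Rbf : C -> C) N (zs : 'I_N -> C) (ms : 'I_N -> nat)
    (c : 'I_N -> nat -> C) (k : int) : C :=
  if odd `|k|%N then 0
  else Rbhat Rbf k + (Cmat ms c *m mxpowz (Amat zs ms) (- k - 1) *m Bmat ms) 0 0.

Definition Kc (f : int -> C -> C) (n m : int) : C :=
  circ_int (fun z => f n z * z ^ (- m - 1)).
Definition Kbc (f : int -> C -> C) (n m : int) : C :=
  circ_int (fun z => f n z * z ^ (m - 1)).

Definition Kmat (psi1 psi2 psib1 psib2 : int -> C -> C) (n m : int) : 'M[C]_2 :=
  \matrix_(i < 2, l < 2)
    (if l == 0 then (if i == 0 then Kbc psib1 n m else Kbc psib2 n m)
     else (if i == 0 then Kc psi1 n m else Kc psi2 n m)).

Definition Mmat (psi1 psi2 psib1 psib2 : int -> C -> C) (n m : int) : 'M[C]_2 :=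
  invmx (Kmat psi1 psi2 psib1 psib2 n n) *m Kmat psi1 psi2 psib1 psib2 n m.

Definition Omat (om omb : int -> C) (k : int) : 'M[C]_2 :=
  \matrix_(i < 2, l < 2)
    (if i == 0 then (if l == 0 then 0 else omb k)
     else (if l == 0 then om k else 0)).

End Defs.

(* Main.v *)
Require Import Defs.
From HB Require Import structures.
From mathcomp Require Import all_boot all_order all_algebra.
From mathcomp Require Import complex ring lra.
From mathcomp Require Import all_classical all_reals all_analysis.
Set Implicit Arguments.
Unset Strict Implicit.
Unset Printing Implicit Defensive.
Import Order.TTheory GRing.Theory Num.Theory numFieldNormedType.Exports.
Local Open Scope ring_scope.
Local Open Scope classical_set_scope.
From mathcomp Require Import zify.

(** Fix [n].  Conjugating (Q) by powers of [z] turns each Jost solution into a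
    one-sided recursion with absolutely summable perturbation, so it is a power
    of [z] times an even power series in [z] (resp. [1/z]) with summable
    coefficients.  On the circle [T phi_n = psibar_n + R psi_n], where [1/T] is
    the Wronskian of [phi] and [psi]; its extension to the disc does not vanish at
    the origin, by the two nonvanishing hypotheses.  Multiply this relation by [z^(m-1)], integrate
    over the circle and expand [psi_n]: the term with [R] gives the sum of the
    [Rhat] part of the kernel, [psibar_n] gives [Kbar_nm], and since [T] minus its
    principal parts (at [z_j], and by parity at [-z_j]) extends to the closed disc,
    the left-hand side reduces to the integral of the principal parts.  That one
    is a sum of residues, which the dependency constants rewrite as derivatives of
    [psi_n], i.e. as the [C A^(k-1) B] part of the kernel.  The barred equations
    are the same computation in the variable [1/z]. *)

(** * Modulus and polar form *)

(** The solutions are only continuous up to the circle, so the analysis lives in the algebra of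
    power series with absolutely summable coefficients, presented by polynomials that are Cauchy in
    the l^1 norm of coefficients. It is stable under products and under division by [z - a] at a
    zero inside the disc, and parity and coefficients pass to the limit. The obstacle is [T]: its
    link with the Wronskian is known on the circle only. Uniqueness from boundary values carries it
    into the disc; there the Wronskian is the polynomial of the poles times a series without zeros,
    and this factorization shows that [T] minus its principal parts extends. The inequality [n < m]
    leaves a nonnegative power of the disc variable in the holomorphic part, so that its integral
    vanishes. The poles at [z_j] and [- z_j] contribute equally against odd powers, whence the
    factor 2 in the norming constants. The flag [b] treats the plain and the barred problem at once.
    Each gives one column of an equation for the coefficients [K]; the factor [K_nn^-1] comes last
    and turns the term [l = n] into the isolated kernel. *)

Section Norm.
Variable R : realType.
Local Notation C := (CC R).
Implicit Types x y z : C.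

(* The norm of [R[i]] takes its values in [R[i]]; [nm] is its real version. *)
Definition nm (z : C) : R := complex.Re `|z|.

Definition rc (x : R) : C := (x%:C)%C.

Lemma nmE z : `|z| = rc (nm z).
Proof. by rewrite /nm normc_def. Qed.

Lemma rc_inj : injective rc. Proof. exact: complexI. Qed.
Lemma rcD a b : rc (a + b) = rc a + rc b. Proof. exact: rmorphD. Qed.
Lemma rcB a b : rc (a - b) = rc a - rc b. Proof. exact: rmorphB. Qed.
Lemma rcM a b : rc (a * b) = rc a * rc b. Proof. exact: rmorphM. Qed.
Lemma rcV a : rc (a^-1) = (rc a)^-1. Proof. exact: fmorphV. Qed.
Lemma rc0 : rc 0 = 0. Proof. by []. Qed.
Lemma rc1 : rc 1 = 1. Proof. by []. Qed.
Lemma rc_le a b : (rc a <= rc b) = (a <= b). Proof. exact: lecR. Qed.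
Lemma rc_lt a b : (rc a < rc b) = (a < b). Proof. exact: ltcR. Qed.
Lemma rcn n : rc n%:R = n%:R. Proof. exact: rmorph_nat. Qed.
Lemma rc_eq0 a : (rc a == 0) = (a == 0).
Proof. by rewrite -rc0 (inj_eq rc_inj). Qed.

Lemma nm_ge0 z : 0 <= nm z.
Proof. by rewrite -rc_le -nmE normr_ge0. Qed.
Lemma nm0 : nm 0 = 0. Proof. by apply: rc_inj; rewrite -nmE normr0. Qed.
Lemma nm1 : nm 1 = 1. Proof. by apply: rc_inj; rewrite -nmE normr1. Qed.
Lemma nmM x y : nm (x * y) = nm x * nm y.
Proof. by apply: rc_inj; rewrite rcM -!nmE normrM. Qed.
Lemma nmN x : nm (- x) = nm x.
Proof. by apply: rc_inj; rewrite -!nmE normrN. Qed.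
Lemma nmV x : nm (x^-1) = (nm x)^-1.
Proof. by apply: rc_inj; rewrite rcV -!nmE normfV. Qed.
Lemma nmX x n : nm (x ^+ n) = nm x ^+ n.
Proof. by elim: n => [|n IH]; rewrite ?expr0 ?nm1// !exprS nmM IH. Qed.
Lemma nmD x y : nm (x + y) <= nm x + nm y.
Proof. by rewrite -rc_le rcD -!nmE ler_normD. Qed.
Lemma nmB x y : nm (x - y) <= nm x + nm y.
Proof. by rewrite -(nmN y); exact: nmD. Qed.
Lemma nmC x y : nm (x - y) = nm (y - x).
Proof. by rewrite -nmN opprB. Qed.
Lemma nm_eq0 x : (nm x == 0) = (x == 0).
Proof. by rewrite -rc_eq0 -nmE normr_eq0. Qed.
Lemma nm_gt0 x : (0 < nm x) = (x != 0).
Proof. by rewrite lt0r nm_ge0 andbT nm_eq0. Qed.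
Lemma nm_rc a : nm (rc a) = `|a|.
Proof. by rewrite /nm normc_def /= expr0n /= addr0 sqrtr_sqr. Qed.
Lemma nm_nat n : nm n%:R = n%:R.
Proof. by rewrite -rcn nm_rc ger0_norm. Qed.
Lemma nm_sum I (r : seq I) (P : pred I) (F : I -> C) :
  nm (\sum_(i <- r | P i) F i) <= \sum_(i <- r | P i) nm (F i).
Proof.
elim/big_rec2: _ => [|i y x _ h]; first by rewrite nm0.
by apply: le_trans (nmD _ _) _; rewrite lerD2l.
Qed.
Lemma nm_subr x y : nm x - nm y <= nm (x - y).
Proof. by rewrite lerBlDr; have := nmD (x - y) y; rewrite subrK. Qed.
Lemma nm_tri x y z : nm (x - z) <= nm (x - y) + nm (y - z).
Proof. by have := nmD (x - y) (y - z); rewrite addrA subrK. Qed.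
Lemma nm_le_eq0 x : (forall e, 0 < e -> nm x <= e) -> x = 0.
Proof.
move=> h; apply/eqP; rewrite -nm_eq0 eq_le nm_ge0 andbT.
by apply/ler_addgt0Pr => e e0; rewrite add0r; exact: h.
Qed.
Lemma nm_sqr x : nm x ^+ 2 = complex.Re x ^+ 2 + complex.Im x ^+ 2.
Proof.
rewrite /nm normc_def /= sqr_sqrtr //; apply: addr_ge0; exact: sqr_ge0.
Qed.
Lemma Re_nm x : `|complex.Re x| <= nm x.
Proof.
rewrite -(ler_pXn2r (n := 2)) ?nnegrE ?nm_ge0// nm_sqr real_normK ?num_real//.
by rewrite lerDl sqr_ge0.
Qed.
Lemma Im_nm x : `|complex.Im x| <= nm x.
Proof.
rewrite -(ler_pXn2r (n := 2)) ?nnegrE ?nm_ge0// nm_sqr real_normK ?num_real//.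
by rewrite lerDr sqr_ge0.
Qed.
Lemma nm_ReIm x : nm x <= `|complex.Re x| + `|complex.Im x|.
Proof.
rewrite -(ler_pXn2r (n := 2)) ?nnegrE ?nm_ge0 ?addr_ge0// nm_sqr.
rewrite sqrrD !real_normK ?num_real// -addrA lerD2l addrC lerDl.
by rewrite mulrn_wge0// mulr_ge0.
Qed.
Lemma ReIm_eq x y : complex.Re x = complex.Re y -> complex.Im x = complex.Im y -> x = y.
Proof. by case: x => a b; case: y => c d /= -> ->. Qed.
Lemma creD x y : complex.Re (x + y : C) = complex.Re x + complex.Re y.
Proof. by case: x; case: y. Qed.
Lemma cimD x y : complex.Im (x + y : C) = complex.Im x + complex.Im y.
Proof. by case: x; case: y. Qed.
Lemma creN x : complex.Re (- x : C) = - complex.Re x.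
Proof. by case: x. Qed.
Lemma cimN x : complex.Im (- x : C) = - complex.Im x.
Proof. by case: x. Qed.
Lemma creB x y : complex.Re (x - y : C) = complex.Re x - complex.Re y.
Proof. by rewrite creD creN. Qed.
Lemma cimB x y : complex.Im (x - y : C) = complex.Im x - complex.Im y.
Proof. by rewrite cimD cimN. Qed.
Lemma creM x y : complex.Re (x * y : C) =
  complex.Re x * complex.Re y - complex.Im x * complex.Im y.
Proof. by case: x; case: y. Qed.
Lemma cimM x y : complex.Im (x * y : C) =
  complex.Re x * complex.Im y + complex.Im x * complex.Re y.
Proof. by case: x => a b; case: y => c d. Qed.

Lemma expi_nm t : nm (expi t) = 1.
Proof.
apply/eqP; rewrite -(eqrXn2 (n := 2)) ?nm_ge0// nm_sqr expr1n /=.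
by rewrite cos2Dsin2.
Qed.
Lemma expi_neq0 t : expi t != 0 :> C.
Proof. by rewrite -nm_gt0 expi_nm. Qed.
Lemma expiD s t : expi (s + t) = expi s * expi t :> C.
Proof.
apply: ReIm_eq; rewrite /= ?cosD ?sinD //; ring.
Qed.
Lemma expi0 : expi 0 = 1 :> C.
Proof. by rewrite /expi cos0 sin0. Qed.
Lemma expi2pi : expi (2 * pi) = 1 :> C.
Proof. by rewrite /expi mulr_natl cos2pi sin2pi. Qed.
Lemma expiN t : expi (- t) = (expi t)^-1 :> C.
Proof.
apply: (mulIf (expi_neq0 t)); rewrite -expiD addNr expi0 mulVf//.
exact: expi_neq0.
Qed.
Lemma abs_sin (x : R) : `|sin x| <= `|x|.
Proof.
have h (y : R) : 0 <= y -> `|sin y| <= y.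
  rewrite le_eqVlt => /predU1P[<-|y0]; first by rewrite sin0 normr0.
  have dsin (x' : R) : x' \in `]0, y[%R -> is_derive x' 1 (sin : R -> R) (cos x').
    by move=> _; exact: is_derive_sin.
  have csin : {within `[0, y], continuous (sin : R -> R)}.
    by apply/continuous_subspaceT => u; exact: continuous_sin.
  have [c _] := MVT_segment (ltW y0) dsin csin. rewrite sin0 !subr0 => ->; rewrite normrM (gtr0_norm y0) ger_pMl//.
  by rewrite ler_norml cos_geN1 cos_le1.
have [x0|x0] := leP 0 x; first by rewrite (ger0_norm x0) h.
rewrite -normrN -sinN (ltr0_norm x0); apply: h; lra.
Qed.
(** Real and imaginary parts are bounded separately, which costs the factor 2: [1 - cos h] is
    [2 sin(h/2)^2], and both it and [|sin h|] are at most [|h|]. *)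
Lemma expi_lip s t : nm (expi s - expi t : C) <= 2 * `|s - t|.
Proof.
have -> : expi s = expi (t + (s - t)) :> C by congr expi; ring.
rewrite expiD -[X in _ - X]mulr1 -mulrBr nmM expi_nm mul1r.
set h := s - t.
apply: (le_trans (nm_ReIm _)); rewrite mulr_natl mulr2n /= oppr0 addr0.
apply: lerD; last exact: abs_sin.
have -> : cos h - 1 = - (2 * sin (h / 2) ^+ 2).
  have -> : cos h = cos (h / 2 + h / 2) by congr cos; field.
  by rewrite cosD -!expr2 cos2sin2; ring.
rewrite normrN normrM normrX expr2 ger0_norm//.
have s1 : `|sin (h / 2)| <= 1 by rewrite ler_norml sin_geN1 sin_le1.
apply: (@le_trans _ _ (2 * `|h / 2|)).
  rewrite ler_pM2l//; apply: (le_trans _ (abs_sin _)).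
  by have := normr_ge0 (sin (h / 2)); move: s1; set u := `|_|; nra.
rewrite normrM; have : `|2^-1 : R| = 2^-1 by rewrite ger0_norm.
by move=> ->; lra.
Qed.

(* [acos] only reaches the upper half circle. *)
Lemma polar_unit z : nm z = 1 -> exists2 t, 0 <= t <= 2 * pi & z = expi t.
Proof.
move=> z1; have := nm_sqr z; rewrite z1 expr1n.
case: z z1 => x y /= _ h.
have x1 : -1 <= x <= 1.
  by have := sqr_ge0 y; rewrite -ler_norml => ?; rewrite -(@ler_pXn2r _ 2)// ?nnegrE// expr1n real_normK ?num_real//; lra.
have sy : sin (acos x) = `|y|.
  rewrite sin_acos//; apply/eqP; rewrite -(@eqrXn2 _ 2)// ?sqrtr_ge0//.
  rewrite sqr_sqrtr ?real_normK ?num_real//; last first.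
    by have := sqr_ge0 y; lra.
  by apply/eqP; lra.
have a0 := acos_ge0 x1; have api := acos_lepi x1; have pi0 := pi_ge0 R.
have [y0|y0] := leP 0 y.
  exists (acos x); first by apply/andP; split; lra.
  by rewrite /expi acosK ?sy ?ger0_norm.
exists (2 * pi - acos x); first by apply/andP; split; lra.
have -> : 2 * pi - acos x = - acos x + pi *+ 2 by rewrite -mulr_natl; ring.
by rewrite /expi cosD2pi sinD2pi cosN sinN acosK// sy ltr0_norm// opprK.
Qed.

Lemma polar z : exists2 t, 0 <= t <= 2 * pi & z = rc (nm z) * expi t.
Proof.
have [->|z0] := eqVneq z 0.
  exists 0; last by rewrite nm0 rc0 mul0r.
  by have := pi_ge0 R => ?; apply/andP; split; lra.
have [|t t0 e] := @polar_unit (rc (nm z)^-1 * z).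
  by rewrite nmM nm_rc ger0_norm ?invr_ge0 ?nm_ge0// mulVf// nm_eq0.
exists t => //; rewrite -e mulrA rcV mulfV ?mul1r// rc_eq0 nm_eq0//.
Qed.

End Norm.

(** * Complex integrals over an interval *)

Section Integral.
Variable R : realType.
Local Notation C := (CC R).
Local Notation mu := (@lebesgue_measure R).

Definition rint (a b : R) (f : R -> R) : R := Rintegral mu `[a, b]%classic f.

(** Only points of the segment are compared, so nothing is asked of the integrand outside the
    interval of integration. *)
Definition rcont (a b : R) (f : R -> R) : Prop :=
  forall x, a <= x <= b -> forall e, 0 < e ->
  exists2 d, 0 < d & forall y, a <= y <= b -> `|y - x| < d -> `|f y - f x| <= e.

Definition ccont (a b : R) (f : R -> C) : Prop :=
  forall x, a <= x <= b -> forall e, 0 < e ->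
  exists2 d, 0 < d & forall y, a <= y <= b -> `|y - x| < d -> nm (f y - f x) <= e.

Definition cint (a b : R) (f : R -> C) : C :=
  (rint a b (fun t => complex.Re (f t)) +i* rint a b (fun t => complex.Im (f t)))%C.

Lemma rcont_within a b f : rcont a b f -> {within `[a, b], continuous f}.
Proof.
move=> h; apply/subspace_continuousP => x; rewrite /= in_itv /= => xab.
apply/cvgrPdist_le => e e0; have [d d0 hd] := h x xab e e0.
near=> y; rewrite distrC; apply: hd.
  by near: y; apply: filterS (withinT _ _) => y /=; rewrite in_itv.
rewrite distrC; near: y; apply: cvg_within; exact: nbhsx_ballx.
Unshelve. all: by end_near. Qed.

Lemma rcont_int a b f : rcont a b f -> mu.-integrable `[a, b] (EFin \o f).
Proof.
move=> h; apply: continuous_compact_integrable; first exact: segment_compact.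
exact: rcont_within.
Qed.

Lemma ccont_Re a b f : ccont a b f -> rcont a b (fun t => complex.Re (f t)).
Proof.
move=> h x xab e e0; have [d d0 hd] := h x xab e e0; exists d => // y yab yx.
by rewrite -creB; apply: le_trans (Re_nm _) _; exact: hd.
Qed.

Lemma ccont_Im a b f : ccont a b f -> rcont a b (fun t => complex.Im (f t)).
Proof.
move=> h x xab e e0; have [d d0 hd] := h x xab e e0; exists d => // y yab yx.
by rewrite -cimB; apply: le_trans (Im_nm _) _; exact: hd.
Qed.

Lemma ccont_cst a b c : ccont a b (fun=> c).
Proof. by move=> x _ e e0; exists 1 => // y _ _; rewrite subrr nm0 ltW. Qed.

Lemma ccontD a b f g : ccont a b f -> ccont a b g -> ccont a b (fun t => f t + g t).
Proof.
move=> hf hg x xab e e0; have e2 : 0 < e / 2 by rewrite divr_gt0.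
have [d d0 hd] := hf x xab _ e2; have [d' d0' hd'] := hg x xab _ e2.
exists (Num.min d d'); first by rewrite lt_min d0.
move=> y yab; rewrite lt_min => /andP[y1 y2].
have -> : f y + g y - (f x + g x) = (f y - f x) + (g y - g x) by ring.
apply: le_trans (nmD _ _) _; have := hd y yab y1; have := hd' y yab y2; lra.
Qed.

Lemma ccont_bounded_at a b f : ccont a b f -> forall x, a <= x <= b ->
  exists M d, [/\ 0 < M, 0 < d & forall y, a <= y <= b -> `|y - x| < d -> nm (f y) <= M].
Proof.
move=> h x xab; have [d d0 hd] := h x xab 1 ltr01.
exists (nm (f x) + 1), d; split => //; first by have := nm_ge0 (f x); lra.
move=> y yab yx; have := hd y yab yx; have := nm_subr (f y) (f x); lra.
Qed.

Lemma ccontM a b f g : ccont a b f -> ccont a b g -> ccont a b (fun t => f t * g t).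
Proof.
move=> hf hg x xab e e0.
have [M [d1 [M0 d10 hM]]] := ccont_bounded_at hf xab.
pose N := nm (g x) + 1; have N0 : 0 < N by rewrite /N; have := nm_ge0 (g x); lra.
have [d2 d20 h2] := hf x xab (e / 2 / N) ltac:(by rewrite !divr_gt0).
have [d3 d30 h3] := hg x xab (e / 2 / M) ltac:(by rewrite !divr_gt0).
exists (Num.min d1 (Num.min d2 d3)); first by rewrite !lt_min d10 d20 d30.
move=> y yab; rewrite !lt_min => /and3P[y1 y2 y3].
have -> : f y * g y - f x * g x = f y * (g y - g x) + (f y - f x) * g x by ring.
apply: le_trans (nmD _ _) _; rewrite !nmM.
have -> : e = M * (e / 2 / M) + (e / 2 / N) * N.
  by field; rewrite !gt_eqF.
apply: lerD; apply: ler_pM => //; try exact: nm_ge0.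
- exact: hM.
- exact: h3.
- exact: h2.
- by rewrite /N; lra.
Qed.

Lemma ccontZ a b c f : ccont a b f -> ccont a b (fun t => c * f t).
Proof. by move=> h; apply: ccontM => //; exact: ccont_cst. Qed.

Lemma ccontN a b f : ccont a b f -> ccont a b (fun t => - f t).
Proof.
move=> h; have -> : (fun t => - f t) = (fun t => -1 * f t).
  by apply/funext => t; rewrite mulN1r.
exact: ccontZ.
Qed.

Lemma ccontB a b f g : ccont a b f -> ccont a b g -> ccont a b (fun t => f t - g t).
Proof. by move=> hf hg; apply: ccontD => //; exact: ccontN. Qed.

Lemma ccontV a b f : (forall t, a <= t <= b -> f t != 0) -> ccont a b f ->
  ccont a b (fun t => (f t)^-1).
Proof.
move=> f0 hf x xab e e0.
pose m := nm (f x); have m0 : 0 < m by rewrite nm_gt0 f0.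
have [d1 d10 h1] := hf x xab (m / 2) ltac:(by rewrite !divr_gt0).
have [d2 d20 h2] := hf x xab (e * (m / 2) * m) ltac:(by rewrite !(mulr_gt0, divr_gt0)).
exists (Num.min d1 d2); first by rewrite lt_min d10.
move=> y yab; rewrite lt_min => /andP[y1 y2].
have fy : m / 2 <= nm (f y).
  have := h1 y yab y1; rewrite nmC; have := nm_subr (f x) (f y); rewrite /m; lra.
have -> : (f y)^-1 - (f x)^-1 = (f x - f y) / (f y * f x).
  by field; rewrite !f0.
rewrite nmM nmV nmM nmC ler_pdivrMr; last by rewrite mulr_gt0// (lt_le_trans _ fy)// divr_gt0.
apply: le_trans (h2 y yab y2) _; rewrite -mulrA ler_pM2l// ler_pM2r//.
Qed.

Lemma ccont_expi a b : ccont a b (@expi R).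
Proof.
move=> x _ e e0; exists (e / 2); first by rewrite divr_gt0.
by move=> y _ yx; apply: le_trans (expi_lip _ _) _; lra.
Qed.

Lemma ccont_rc a b : ccont a b (@rc R).
Proof. by move=> x _ e e0; exists e => // y _ yx; rewrite -rcB nm_rc ltW. Qed.

Lemma eq_ccont a b f g : (forall t, a <= t <= b -> f t = g t) ->
  ccont a b f -> ccont a b g.
Proof.
move=> fg h x xab e e0; have [d d0 hd] := h x xab e e0; exists d => // y yab yx.
by rewrite -!fg//; exact: hd.
Qed.

Lemma eq_cint a b f g : (forall t, a <= t <= b -> f t = g t) -> cint a b f = cint a b g.
Proof.
move=> h; congr (_ +i* _)%C; apply: eq_Rintegral => t; rewrite inE /= in_itv /= => tab;
  by rewrite h.
Qed.

Lemma cintD a b f g : ccont a b f -> ccont a b g ->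
  cint a b (fun t => f t + g t) = cint a b f + cint a b g.
Proof.
move=> hf hg; apply: ReIm_eq; rewrite ?creD ?cimD /= /rint -RintegralD //;
  try (by apply: rcont_int; (exact: ccont_Re || exact: ccont_Im));
  by apply: eq_Rintegral => t _; rewrite ?creD ?cimD.
Qed.

Lemma rintZ a b c f : rcont a b f -> rint a b (fun t => c * f t) = c * rint a b f.
Proof. by move=> h; rewrite /rint RintegralZl//; exact: rcont_int. Qed.

Lemma rintB a b f g : rcont a b f -> rcont a b g ->
  rint a b (fun t => f t - g t) = rint a b f - rint a b g.
Proof. by move=> hf hg; rewrite /rint RintegralB//; exact: rcont_int. Qed.

Lemma rintD a b f g : rcont a b f -> rcont a b g ->
  rint a b (fun t => f t + g t) = rint a b f + rint a b g.
Proof. by move=> hf hg; rewrite /rint RintegralD//; exact: rcont_int. Qed.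

Lemma rcontZ a b c f : rcont a b f -> rcont a b (fun t => c * f t).
Proof.
move=> h x xab e e0; have [|d d0 hd] := h x xab (e / (`|c| + 1)).
  by rewrite divr_gt0// ltr_wpDl.
exists d => // y yab yx; rewrite -mulrBr normrM.
have := hd y yab yx; rewrite ler_pdivlMr ?ltr_wpDl// => hh.
by have := normr_ge0 c; have := normr_ge0 (f y - f x); nra.
Qed.

Lemma cintZ a b c f : ccont a b f -> cint a b (fun t => c * f t) = c * cint a b f.
Proof.
move=> hf; have hr := ccont_Re hf; have hi := ccont_Im hf.
apply: ReIm_eq.
- rewrite [RHS]creM /cint /= -!rintZ// -rintB; try exact: rcontZ.
  by apply: eq_Rintegral => t _; rewrite creM.
- rewrite [RHS]cimM /cint /= -!rintZ// -rintD; try exact: rcontZ.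
  by apply: eq_Rintegral => t _; rewrite cimM.
Qed.

Lemma cintN a b f : ccont a b f -> cint a b (fun t => - f t) = - cint a b f.
Proof.
move=> h; rewrite -mulN1r -cintZ//; apply: eq_cint => t _; by rewrite mulN1r.
Qed.

Lemma cintB a b f g : ccont a b f -> ccont a b g ->
  cint a b (fun t => f t - g t) = cint a b f - cint a b g.
Proof. by move=> hf hg; rewrite cintD ?cintN//; exact: ccontN. Qed.

Lemma rint_cst a b c : a <= b -> rint a b (fun=> c) = c * (b - a).
Proof.
move=> ab; rewrite /rint Rintegral_cst//= lebesgue_measure_itv /= lte_fin.
case: ltP => [|h] /=; first by [].
have -> : b = a by apply/eqP; rewrite eq_le h ab.
by rewrite subrr.
Qed.

Lemma cint_cst a b c : a <= b -> cint a b (fun=> c) = c * rc (b - a).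
Proof.
move=> ab; apply: ReIm_eq; rewrite ?creM ?cimM /cint /= rint_cst//; ring.
Qed.

Lemma rint_le a b f g : rcont a b f -> rcont a b g ->
  (forall t, a <= t <= b -> f t <= g t) -> rint a b f <= rint a b g.
Proof.
move=> hf hg h; apply: le_Rintegral => //; try exact: rcont_int.
Qed.

Lemma rcont_cst a b c : rcont a b (fun=> c).
Proof. by move=> x _ e e0; exists 1 => // y _ _; rewrite subrr normr0 ltW. Qed.

Lemma rint_bound a b f M : a <= b -> rcont a b f ->
  (forall t, a <= t <= b -> `|f t| <= M) -> `|rint a b f| <= M * (b - a).
Proof.
move=> ab hf h; rewrite ler_norml; apply/andP; split.
  rewrite -mulNr -rint_cst//; apply: rint_le => //; first exact: rcont_cst.
  by move=> t /h; rewrite ler_norml => /andP[].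
rewrite -rint_cst//; apply: rint_le => //; first exact: rcont_cst.
by move=> t /h; rewrite ler_norml => /andP[].
Qed.

(** The factor 2 comes from bounding the integrals of the real and imaginary parts separately. The
    sharp constant is irrelevant, since the bound only feeds estimates with an arbitrary [e]. *)
Lemma cint_bound a b f M : a <= b -> ccont a b f ->
  (forall t, a <= t <= b -> nm (f t) <= M) -> nm (cint a b f) <= 2 * M * (b - a).
Proof.
move=> ab hf h; apply: le_trans (nm_ReIm _) _; rewrite -mulrA mulr_natl mulr2n.
apply: lerD; (apply: rint_bound => //; [(exact: ccont_Re || exact: ccont_Im)|]);
  move=> t /h; apply: le_trans; [exact: Re_nm|exact: Im_nm].
Qed.

Lemma rint_split a c b f : a <= c -> c <= b -> rcont a b f ->
  rint a b f = rint a c f + rint c b f.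
Proof.
move=> ac cb hf; rewrite /rint -[X in _ = _ + X]Rintegral_itv_obnd_cbnd; last first.
  apply: integrableS (rcont_int hf) => //.
  by move=> x /=; rewrite !in_itv /= => /andP[x1 ->]; rewrite (le_trans ac)// ltW.
rewrite -(@Rintegral_itvB _ f (BLeft a) (BRight b) c) ?bnd_simp//; last exact: rcont_int.
by rewrite addrC subrK.
Qed.

Lemma cint_split a c b f : a <= c -> c <= b -> ccont a b f ->
  cint a b f = cint a c f + cint c b f.
Proof.
move=> ac cb hf; apply: ReIm_eq; rewrite ?creD ?cimD /= -rint_split//.
  exact: ccont_Re.
exact: ccont_Im.
Qed.

Lemma cint_expi a b : a <= b -> cint a b (@expi R) = (expi b - expi a) * (- 'i%C).
Proof.
move=> ab.
have dS (x : R) : is_derive x 1 (sin : R -> R) (cos x) by exact: is_derive_sin.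
have dC (x : R) : is_derive x 1 (cos : R -> R) (- sin x) by exact: is_derive_cos.
have S : rint a b cos = sin b - sin a.
  move: ab; rewrite le_eqVlt => /predU1P[->|ab].
    by rewrite /rint set_itv1 Rintegral_set1 subrr.
  rewrite /rint /Rintegral (@continuous_FTC2 _ cos sin) //.
  - by apply/continuous_subspaceT => u; exact: continuous_cos.
  - split => [x _||]; first by apply/derivable1_diffP/derivable1_diffP; have [] := dS x.
    + by apply: cvg_at_right_filter; exact: continuous_sin.
    + by apply: cvg_at_left_filter; exact: continuous_sin.
  - by move=> x _; rewrite derive1E; apply: derive_val.
have Co : rint a b sin = - (cos b - cos a).
  move: ab; rewrite le_eqVlt => /predU1P[->|ab].
    by rewrite /rint set_itv1 Rintegral_set1 subrr oppr0.
  rewrite /rint /Rintegral (@continuous_FTC2 _ sin (fun x => - cos x)) //=.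
  - by ring.
  - by apply/continuous_subspaceT => u; exact: continuous_sin.
  - split => [x _||].
    + by have [] : is_derive x 1 (- (cos : R -> R)) (- - sin x) by apply: is_deriveN.
    + by apply: cvgN; apply: cvg_at_right_filter; exact: continuous_cos.
    + by apply: cvgN; apply: cvg_at_left_filter; exact: continuous_cos.
  - move=> x _; rewrite derive1E -[RHS]opprK; apply: derive_val; apply: is_deriveN.
apply: ReIm_eq; rewrite ?creM ?cimM /= ?S ?Co; ring.
Qed.

Lemma circ_intE (f : C -> C) :
  circ_int f = rc (2 * pi)^-1 * cint 0 (2 * pi) (fun t => f (expi t) * expi t).
Proof. by apply: ReIm_eq; rewrite ?creM ?cimM /= mul0r ?subr0 ?addr0. Qed.

End Integral.

(** * Cauchy's theorem in polar cells *)

Section Dyadic.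
Variable R : realType.

(* Cousin's lemma for a dyadically subdivided rectangle. *)
Lemma dyadic_ind (P : nat -> R -> R -> Prop) (a c H K : R) : 0 <= H -> 0 <= K ->
  (forall n x y, a <= x -> x + H / 2 ^+ n <= a + H -> c <= y -> y + K / 2 ^+ n <= c + K ->
     P n.+1 x y -> P n.+1 (x + H / 2 ^+ n.+1) y ->
     P n.+1 x (y + K / 2 ^+ n.+1) -> P n.+1 (x + H / 2 ^+ n.+1) (y + K / 2 ^+ n.+1) ->
     P n x y) ->
  (forall x y, a <= x <= a + H -> c <= y <= c + K -> exists2 d, 0 < d &
     forall n u v, a <= u -> u <= x -> x <= u + H / 2 ^+ n -> u + H / 2 ^+ n <= a + H ->
       c <= v -> v <= y -> y <= v + K / 2 ^+ n -> v + K / 2 ^+ n <= c + K ->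
       H / 2 ^+ n < d -> K / 2 ^+ n < d -> P n u v) ->
  P 0%N a c.
Proof.
move=> H0 K0 hsplit hloc; apply: contrapT => nP0.
pose inb n x y := [/\ a <= x, x + H / 2 ^+ n <= a + H, c <= y & y + K / 2 ^+ n <= c + K].
(* [T] collects the subrectangles on which [P] fails. One quarter of such a rectangle fails again;
   iterating this choice gives nested rectangles shrinking to a point, where [hloc] is
   contradicted. *)
pose T := {p : nat * R * R | inb p.1.1 p.1.2 p.2 /\ ~ P p.1.1 p.1.2 p.2}.
have half (L : R) n : L / 2 ^+ n = L / 2 ^+ n.+1 + L / 2 ^+ n.+1.
  by rewrite exprS; field; rewrite expf_neq0.
have pos (L : R) n : 0 <= L -> 0 <= L / 2 ^+ n by move=> ?; rewrite divr_ge0// exprn_ge0.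
have nextP (p : T) : exists q : T, [/\ (sval q).1.1 = (sval p).1.1.+1,
   (sval p).1.2 <= (sval q).1.2, (sval q).1.2 <= (sval p).1.2 + H / 2 ^+ (sval p).1.1.+1,
   (sval p).2 <= (sval q).2 & (sval q).2 <= (sval p).2 + K / 2 ^+ (sval p).1.1.+1].
  case: p => -[[n x] y] /= [[i1 i2 i3 i4] nP].
  have hH := half H n; have hK := half K n.
  have pH := pos H n.+1 H0; have pK := pos K n.+1 K0.
  have : exists x' y', [/\ x <= x', x' <= x + H / 2 ^+ n.+1,
      y <= y', y' <= y + K / 2 ^+ n.+1 & ~ P n.+1 x' y'].
    apply: contrapT => no; apply: nP; apply: hsplit => //; apply: contrapT => nP';
      apply: no; do 2 eexists; split; try exact: nP'; lra.
  case=> x' [y' [h1 h2 h3 h4 h5]].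
  have hb : inb n.+1 x' y' by split; lra.
  by exists (exist _ (n.+1, x', y') (conj hb h5)).
have [next nextE] := choice nextP.
have b0 : inb 0%N a c by rewrite /inb !expr0 !divr1.
pose s n := iter n next (exist _ (0%N, a, c) (conj b0 nP0) : T).
pose X n := (sval (s n)).1.2; pose Y n := (sval (s n)).2.
have lev n : (sval (s n)).1.1 = n.
  elim: n => //= n IH; by have [-> _ _ _ _] := nextE (s n); rewrite IH.
have bn n : inb n (X n) (Y n) /\ ~ P n (X n) (Y n).
  by have := proj2_sig (s n); rewrite lev.
have stepn n : [/\ X n <= X n.+1, X n.+1 <= X n + H / 2 ^+ n.+1,
   Y n <= Y n.+1 & Y n.+1 <= Y n + K / 2 ^+ n.+1].
  by have := nextE (s n); rewrite lev => -[].
(* The lower ends increase and never exceed the upper end of an earlier interval, so their supremum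
   lies in all the nested intervals. *)
have lim (Z : nat -> R) (L m : R) : 0 <= L -> (forall n, Z n <= Z n.+1) ->
   (forall n, Z n.+1 <= Z n + L / 2 ^+ n.+1) ->
   exists z, forall n, Z n <= z <= Z n + L / 2 ^+ n.
  move=> L0 h1 h2.
  have inc n k : Z n <= Z (n + k)%N.
    by elim: k => [|k IH]; rewrite ?addn0// addnS; apply: le_trans IH _.
  have ub n k : Z (n + k)%N <= Z n + (L / 2 ^+ n - L / 2 ^+ (n + k)).
    elim: k => [|k IH]; first by rewrite addn0 subrr addr0.
    rewrite addnS; have := h2 (n + k)%N; have := half L (n + k)%N; lra.
  have hs : has_sup (range Z).
    split; first by exists (Z 0%N), 0%N.
    exists (Z 0%N + L / 2 ^+ 0) => _ [n _ <-].
    by have := ub 0%N n; have := pos L (0 + n)%N L0; lra.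
  exists (sup (range Z)) => n; apply/andP; split.
    by apply: ub_le_sup; [exact: hs.2|exists n].
  apply: ge_sup; first exact: hs.1.
  move=> _ [k _ <-]; have [kn|nk] := leqP k n.
    have := inc k (n - k)%N; rewrite subnKC// => h.
    by have := pos L n L0; lra.
  have := ub n (k - n)%N; rewrite subnKC; last exact: ltnW.
  by have := pos L k L0; lra.
have [x hx] : exists x, forall n, X n <= x <= X n + H / 2 ^+ n.
  by apply: lim => // n; have [] := stepn n.
have [y hy] : exists y, forall n, Y n <= y <= Y n + K / 2 ^+ n.
  by apply: lim => // n; have [] := stepn n.
have hx0 : a <= x <= a + H by have := hx 0%N; rewrite expr0 divr1.
have hy0 : c <= y <= c + K by have := hy 0%N; rewrite expr0 divr1.
have [d d0 hd] := hloc x y hx0 hy0.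
have small (L : R) : 0 <= L -> exists N, forall n, (N <= n)%N -> L / 2 ^+ n < d.
  move=> L0; have [N] : exists N : nat, L / d < N%:R.
    exists (Num.trunc (L / d)).+1; exact: truncnS_gt.
  move=> hN; exists N => n Nn; rewrite ltr_pdivrMr ?exprn_gt0//.
  rewrite -ltr_pdivrMl// mulrC; apply: (lt_trans hN).
  rewrite -natrX ltr_nat; apply: leq_ltn_trans Nn _; exact: ltn_expl.
have [N1 hN1] := small H H0; have [N2 hN2] := small K K0.
pose n := maxn N1 N2.
have [[i1 i2 i3 i4] nP] := bn n; apply: nP.
have /andP[x1 x2] := hx n; have /andP[y1 y2] := hy n.
by apply: hd => //; [apply: hN1; exact: leq_maxl|apply: hN2; exact: leq_maxr].
Qed.

End Dyadic.

Section Goursat.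
Variable R : realType.
Local Notation C := (CC R).

Definition cdiff (f : C -> C) (z l : C) : Prop := forall e, 0 < e ->
  exists2 d, 0 < d & forall y, nm (y - z) < d -> nm (f y - f z - l * (y - z)) <= e * nm (y - z).

Definition ccont_at (f : C -> C) (z : C) : Prop := forall e, 0 < e ->
  exists2 d, 0 < d & forall y, nm (y - z) < d -> nm (f y - f z) <= e.

Lemma cdiff_cont f z l : cdiff f z l -> ccont_at f z.
Proof.
move=> h e e0; have [d d0 hd] := h 1 ltr01.
pose L := nm l + 1; have L0 : 0 < L by rewrite /L; have := nm_ge0 l; lra.
exists (Num.min d (e / L)); first by rewrite lt_min d0 divr_gt0.
move=> y; rewrite lt_min => /andP[y1 y2]; have := hd y y1.
rewrite mul1r => hh; have := nm_subr (f y - f z) (l * (y - z)); rewrite nmM => h2.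
move: y2; rewrite ltr_pdivlMr// /L; lra.
Qed.

Definition polpt (c : C) (s t : R) : C := c + rc s * expi t.

Lemma polpt_dist c s s' t t' :
  nm (polpt c s t - polpt c s' t') <= `|s - s'| + 2 * `|s'| * `|t - t'|.
Proof.
have -> : polpt c s t - polpt c s' t' =
  rc (s - s') * expi t + rc s' * (expi t - expi t') by rewrite rcB /polpt; ring.
apply: le_trans (nmD _ _) _; rewrite !nmM expi_nm !nm_rc mulr1 lerD2l.
by have := expi_lip t t'; have := normr_ge0 s'; nra.
Qed.

Lemma polpt_nm c s t : nm (polpt c s t - c) = `|s|.
Proof. by rewrite /polpt addrC addKr nmM nm_rc expi_nm mulr1. Qed.

Lemma polpt_ccont_t (F : C -> C) c s a b :
  (forall t, a <= t <= b -> ccont_at F (polpt c s t)) ->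
  ccont a b (fun t => F (polpt c s t)).
Proof.
move=> h x xab e e0; have [d d0 hd] := h x xab e e0.
exists (d / (2 * `|s| + 1)); first by rewrite divr_gt0// ltr_wpDl// mulr_ge0.
move=> y _ yx; apply: hd; apply: le_lt_trans (polpt_dist _ _ _ _ _) _.
rewrite subrr normr0 add0r; move: yx; rewrite ltr_pdivlMr ?ltr_wpDl// ?mulr_ge0// => yx.
by have := normr_ge0 (y - x); nra.
Qed.

Lemma polpt_ccont_s (F : C -> C) c t a b :
  (forall s, a <= s <= b -> ccont_at F (polpt c s t)) ->
  ccont a b (fun s => F (polpt c s t)).
Proof.
move=> h x xab e e0; have [d d0 hd] := h x xab e e0.
exists d => // y _ yx; apply: hd; apply: le_lt_trans (polpt_dist _ _ _ _ _) _.
by rewrite subrr normr0 mulr0 addr0.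
Qed.

Lemma nm_four (x y z w : C) q : nm x <= q -> nm y <= q -> nm z <= q -> nm w <= q ->
  nm (x + y + (z + w)) <= 4 * q.
Proof.
by move=> *; apply: le_trans (le_trans (nmD _ _) (lerD (nmD _ _) (nmD _ _))) _; lra.
Qed.

Variables (F : C -> C) (c : C) (rho0 : R).
Hypothesis Fd : forall z, 0 < nm (z - c) < rho0 -> exists l, cdiff F z l.

Let pt := polpt c.

(* The contour integral of [G z / (z - c)] along the boundary of the polar cell
   [s, s'] x [t, t'], divided by [i]. *)
Definition cell (G : C -> C) (s s' t t' : R) : C :=
  cint t t' (fun x => G (pt s' x) - G (pt s x)) +
  'i%C * cint s s' (fun x => (G (pt x t') - G (pt x t)) * rc x^-1).

Definition cell_ok (G : C -> C) := forall z, 0 < nm (z - c) < rho0 -> ccont_at G z.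

Lemma F_cell_ok : cell_ok F.
Proof. by move=> z /Fd [l]; exact: cdiff_cont. Qed.

Lemma pt_in s t : 0 < s < rho0 -> 0 < nm (pt s t - c) < rho0.
Proof. by case/andP=> s0 s1; rewrite polpt_nm gtr0_norm// s0. Qed.

Lemma cc_t G a b s : cell_ok G -> 0 < s < rho0 -> ccont a b (fun x => G (pt s x)).
Proof. by move=> hG hs; apply: polpt_ccont_t => t _; apply/hG/pt_in. Qed.

Lemma cc_inv (a b : R) : 0 < a -> ccont a b (fun x : R => rc x^-1).
Proof.
move=> a0; apply: (@eq_ccont _ _ _ (fun x => (rc x)^-1)).
  by move=> t _; rewrite rcV.
apply: ccontV; last exact: ccont_rc.
by move=> t /andP[h _]; rewrite rc_eq0 gt_eqF// (lt_le_trans a0).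
Qed.

Lemma cc_s G a b t : cell_ok G -> 0 < a -> b < rho0 -> ccont a b (fun x => G (pt x t)).
Proof.
move=> hG a0 b0; apply: polpt_ccont_s => s /andP[s1 s2]; apply/hG/pt_in.
by rewrite (lt_le_trans a0)//= (le_lt_trans s2).
Qed.

Lemma cc_s2 G a b t t' : cell_ok G -> 0 < a -> b < rho0 ->
  ccont a b (fun x => (G (pt x t') - G (pt x t)) * rc x^-1).
Proof.
by move=> hG a0 b0; apply: ccontM; [apply: ccontB; exact: cc_s|exact: cc_inv].
Qed.

Lemma cellD G1 G2 s s' t t' : cell_ok G1 -> cell_ok G2 -> 0 < s -> s <= s' -> s' < rho0 ->
  cell (fun z => G1 z + G2 z) s s' t t' = cell G1 s s' t t' + cell G2 s s' t t'.
Proof.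
move=> h1 h2 s0 ss s1.
have hs : 0 < s < rho0 by rewrite s0 (le_lt_trans ss).
have hs' : 0 < s' < rho0 by rewrite s1 (lt_le_trans s0).
rewrite /cell addrACA -mulrDr -!cintD; do ?[by apply: cc_s2 | by apply: ccontB; apply: cc_t].
congr (_ + _ * _); apply: eq_cint => x _; ring.
Qed.

Lemma cell_split_s G s m s' t t' : cell_ok G -> 0 < s -> s <= m -> m <= s' -> s' < rho0 ->
  t <= t' -> cell G s s' t t' = cell G s m t t' + cell G m s' t t'.
Proof.
move=> hG s0 sm ms s1 tt.
have hs : 0 < s < rho0 by rewrite s0; lra.
have hs' : 0 < s' < rho0 by rewrite s1; lra.
have hm : 0 < m < rho0 by lra.
rewrite /cell (cint_split sm ms); last exact: cc_s2.
rewrite addrACA mulrDr -cintD; do ?by apply: ccontB; apply: cc_t.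
congr (_ + _); apply: eq_cint => x _; ring.
Qed.

Lemma cell_split_t G s s' t m t' : cell_ok G -> 0 < s -> s <= s' -> s' < rho0 ->
  t <= m -> m <= t' -> cell G s s' t t' = cell G s s' t m + cell G s s' m t'.
Proof.
move=> hG s0 ss s1 tm mt.
have hs : 0 < s < rho0 by rewrite s0; lra.
have hs' : 0 < s' < rho0 by rewrite s1; lra.
rewrite /cell (cint_split tm mt); last by apply: ccontB; apply: cc_t.
rewrite addrACA -mulrDr -cintD; do ?by apply: cc_s2.
congr (_ + _ * _); apply: eq_cint => x _; ring.
Qed.

Lemma affine_cont (a b z : C) : ccont_at (fun y => a + b * (y - c)) z.
Proof.
move=> e e0; exists (e / (nm b + 1)).
  by rewrite divr_gt0// ltr_wpDl// nm_ge0.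
move=> y; rewrite ltr_pdivlMr ?ltr_wpDl ?nm_ge0// => h.
have -> : a + b * (y - c) - (a + b * (z - c)) = b * (y - z) by ring.
by rewrite nmM; have := nm_ge0 b; have := nm_ge0 (y - z); nra.
Qed.

(** The base case of Goursat's argument, by explicit integration: the arcs give
    [b (s' - s) (expi t' - expi t) / i], and the radial sides give the opposite. *)
Lemma cell_affine a b s s' t t' : 0 < s -> s <= s' -> t <= t' ->
  cell (fun y => a + b * (y - c)) s s' t t' = 0.
Proof.
move=> s0 ss tt.
have E x y : a + b * (pt x y - c) = a + b * rc x * expi y by rewrite /pt /polpt; ring.
rewrite /cell (@eq_cint _ t t' _ (fun x => b * (rc s' - rc s) * expi x)); last first.
  by move=> x _; rewrite !E; ring.
rewrite (@eq_cint _ s s' _ (fun x => b * (expi t' - expi t))); last first.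
  move=> x /andP[x0 _]; rewrite !E rcV.
  have : rc x != 0 by rewrite rc_eq0 gt_eqF// (lt_le_trans s0).
  by move=> ?; field.
rewrite cintZ; last exact: ccont_expi.
rewrite cint_expi// cint_cst// rcB; ring.
Qed.

(** The 4 is a difference of two values, each at most [M], times the factor 2 of [cint_bound]. On
    the radial sides the weight [1/x] is at most [1/s]. *)
Lemma cell_bound G s s' t t' M : cell_ok G -> 0 < s -> s <= s' -> s' < rho0 -> t <= t' ->
  (forall x y, s <= x <= s' -> t <= y <= t' -> nm (G (pt x y)) <= M) ->
  nm (cell G s s' t t') <= 4 * M * ((t' - t) + (s' - s) / s).
Proof.
move=> hG s0 ss s1 tt hM.
have hs : 0 < s < rho0 by rewrite s0; lra.
have hs' : 0 < s' < rho0 by rewrite s1; lra.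
have M0 : 0 <= M by apply: le_trans (nm_ge0 _) (hM s t _ _); rewrite ?lexx.
rewrite mulrDr; apply: le_trans (nmD _ _) _; apply: lerD.
  have -> : 4 * M * (t' - t) = 2 * (2 * M) * (t' - t) by ring.
  apply: cint_bound => //; first by apply: ccontB; apply: cc_t.
  move=> x xt; apply: le_trans (nmB _ _) _.
  have := hM s x; have := hM s' x; rewrite !lexx ss xt => /(_ isT isT) ? /(_ isT isT) ?; lra.
have -> : 4 * M * ((s' - s) / s) = 2 * (2 * M / s) * (s' - s) by field; lra.
rewrite nmM.
have -> : nm ('i%C : C) = 1.
  by apply/eqP; rewrite -(eqrXn2 (n := 2)) ?nm_ge0// nm_sqr /= expr0n expr1n /= add0r.
rewrite mul1r; apply: cint_bound => //; first exact: cc_s2.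
move=> x /andP[x1 x2]; rewrite nmM nm_rc ger0_norm; last by rewrite invr_ge0; lra.
apply: ler_pM; rewrite ?nm_ge0 ?invr_ge0//; try lra.
  apply: le_trans (nmB _ _) _.
  have := hM x t; have := hM x t'; rewrite !lexx x1 x2 tt => /(_ isT isT) ? /(_ isT isT) ?; lra.
by rewrite lef_pV2 ?posrE//; lra.
Qed.

(** Goursat's subdivision for the form [F z / (z - c) dz]: near a point, [F] is affine up to a small
    multiple of the distance, and the affine part integrates to 0. Polar cells make circles around
    [c] appear directly as sides. *)
Lemma goursat s s' t t' : 0 < s -> s <= s' -> s' < rho0 -> t <= t' -> cell F s s' t t' = 0.
Proof.
move=> s0 ss s1 tt; apply: nm_le_eq0 => e e0.
pose H := s' - s; pose K := t' - t.
have H0 : 0 <= H by rewrite /H; lra. have K0 : 0 <= K by rewrite /K; lra.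
(* [Q] is the bound of [cell_bound] for a remainder of size (diameter of the cell). Diameter and
   boundary length both halve at each subdivision, hence the decay [Q / 4 ^+ n]. *)
pose Q := 4 * (H + 2 * s' * K) * (K + H / s).
have Q0 : 0 <= Q.
  rewrite /Q; apply: mulr_ge0; first by rewrite mulr_ge0// addr_ge0// !mulr_ge0//; lra.
  by rewrite addr_ge0// divr_ge0//; lra.
pose e' := e / (Q + 1); have e'0 : 0 < e' by rewrite divr_gt0// ltr_wpDl.
have pos (L : R) n : 0 <= L -> 0 <= L / 2 ^+ n by move=> ?; rewrite divr_ge0// exprn_ge0.
have half (L : R) n : L / 2 ^+ n = L / 2 ^+ n.+1 + L / 2 ^+ n.+1.
  by rewrite exprS; field; rewrite expf_neq0.
have quart (L : R) n : L / 4 ^+ n = 4 * (L / 4 ^+ n.+1).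
  by rewrite exprS; field; rewrite expf_neq0.
pose P n x y := nm (cell F x (x + H / 2 ^+ n) y (y + K / 2 ^+ n)) <= e' * (Q / 4 ^+ n).
suff : P 0%N s t.
  rewrite /P !expr0 !divr1 /H /K !(addrC _ (_ - _)) !subrK => h; apply: le_trans h _.
  rewrite /e' -mulrA ger_pMr// mulrC ler_pdivrMr ?ltr_wpDl//; lra.
apply: (@dyadic_ind _ P s t H K) => //.
- move=> n x y x0 x1 y0 y1.
  have pH := pos H n.+1 H0; have pK := pos K n.+1 K0.
  have sH : s + H = s' by rewrite /H; ring.
  have eH := half H n; have eK := half K n; have eQ := quart Q n.
  rewrite /P; rewrite eH sH in x1; rewrite eK in y1; rewrite eH eK eQ.
  have Fok := F_cell_ok; clear P eH eK eQ.
  move: (H / 2 ^+ n.+1) (K / 2 ^+ n.+1) pH pK x1 y1 => hh kk pH pK x1 y1.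
  rewrite !addrA.
  have a1 : x <= x + hh by lra. have a2 : x + hh <= x + hh + hh by lra.
  have a3 : y <= y + kk by lra. have a4 : y + kk <= y + kk + kk by lra.
  have a5 : 0 < x by lra. have a6 : x + hh + hh < rho0 by lra.
  have a7 : y <= y + kk + kk by lra. have a8 : x + hh < rho0 by lra.
  have a9 : 0 < x + hh by lra.
  rewrite (cell_split_s Fok a5 a1 a2 a6 a7).
  rewrite (cell_split_t Fok a5 a1 a8 a3 a4) (cell_split_t Fok a9 a2 a6 a3 a4).
  by move=> h1 h2 h3 h4; rewrite mulrCA; exact: (nm_four h1 h3 h2 h4).
- move=> x y /andP[x1 x2] /andP[y1 y2].
  have sH : s + H = s' by rewrite /H; ring.
  have xin : 0 < x < rho0 by lra.
  have [l hl] := Fd (pt_in y xin).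
  have [d d0 hd] := hl e' e'0.
  exists (d / (1 + 2 * s')); first by rewrite divr_gt0//; lra.
  move=> n u v u1 u2 u3 u4 v1 v2 v3 v4; rewrite !ltr_pdivlMr; do ?lra.
  move=> dH dK; rewrite /P.
  set h := H / 2 ^+ n in u3 u4 dH *; set k := K / 2 ^+ n in v3 v4 dK *.
  have h0 : 0 <= h by exact: pos. have k0 : 0 <= k by exact: pos.
  (* With this [a] the function [A] is the tangent map [F p + l (z - p)] at [p = pt x y], rewritten
     around the centre [c] as [cell_affine] requires. *)
  pose a := F (pt x y) + l * (c - pt x y).
  pose A z := a + l * (z - c); pose r z := F z - A z.
  have rok : cell_ok r.
    move=> z zin e1 e10; have e2 : 0 < e1 / 2 by rewrite divr_gt0.
    have [d1 d10 hd1] := F_cell_ok zin e2.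
    have [d2 d20 hd2] := @affine_cont a l z _ e2.
    exists (Num.min d1 d2); first by rewrite lt_min d10.
    move=> w; rewrite lt_min => /andP[w1 w2].
    have -> : r w - r z = (F w - F z) - (A w - A z) by rewrite /r; ring.
    apply: le_trans (nmB _ _) _; have := hd1 w w1; have := hd2 w w2; rewrite /A; lra.
  have -> : F = (fun z => A z + r z) by apply/funext => z; rewrite /r; ring.
  have Aok : cell_ok A by move=> z _; exact: affine_cont.
  have b1 : 0 < u by lra. have b2 : u <= u + h by lra.
  have b3 : u + h < rho0 by lra. have b4 : v <= v + k by lra.
  rewrite (cellD _ _ Aok rok b1 b2 b3) (cell_affine _ _ b1 b2 b4).
  rewrite add0r.
  have dist x' y' : u <= x' <= u + h -> v <= y' <= v + k ->
      nm (pt x' y' - pt x y) <= h + 2 * s' * k.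
    move=> /andP[? ?] /andP[? ?]; apply: le_trans (polpt_dist _ _ _ _ _) _.
    have c1 : `|x' - x| <= h by rewrite ler_norml; apply/andP; split; lra.
    have c2 : `|y' - y| <= k by rewrite ler_norml; apply/andP; split; lra.
    apply: lerD => //; apply: ler_pM => //; rewrite ler_pM2l// ger0_norm; lra.
  have bd : nm (cell r u (u + h) v (v + k)) <=
      4 * (e' * (h + 2 * s' * k)) * ((v + k - v) + (u + h - u) / u).
    apply: cell_bound => //; do ?lra.
    move=> x' y' hx' hy'; have D := dist x' y' hx' hy'.
    have -> : r (pt x' y') = F (pt x' y') - F (pt x y) - l * (pt x' y' - pt x y).
      by rewrite /r /A /a; ring.
    apply: le_trans (hd _ _) _; last by rewrite ler_pM2l.
    apply: le_lt_trans D _; have : (1 + 2 * s') * (h + 2 * s' * k) < (1 + 2 * s') * d by nra.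
    by nra.
  apply: le_trans bd _.
  have -> : e' * (Q / 4 ^+ n) = 4 * (e' * (h + 2 * s' * k)) * (k + h / s).
    rewrite /Q /h /k (_ : 4 = 2 * 2 :> R); last by ring.
    by rewrite exprMn; field; rewrite expf_neq0//; lra.
  have hh : h / u <= h / s by rewrite ler_wpM2l// lef_pV2 ?posrE//; lra.
  apply: ler_wpM2l; last by lra.
  have ? : 0 <= h + 2 * s' * k by rewrite addr_ge0// !mulr_ge0//; lra.
  by apply: mulr_ge0 => //; apply: mulr_ge0 => //; exact: ltW.
Qed.

(** For a cell that makes a full turn the two radial sides coincide and cancel, so only the two
    circles remain. *)
Lemma circle_const s s' : 0 < s -> s <= s' -> s' < rho0 ->
  cint 0 (2 * pi) (fun x => F (pt s x)) = cint 0 (2 * pi) (fun x => F (pt s' x)).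
Proof.
move=> s0 ss s1; have p0 := pi_ge0 R; have p2 : 0 <= 2 * pi :> R by lra.
have := goursat s0 ss s1 p2; rewrite /cell.
have hs : 0 < s < rho0 by rewrite s0; lra.
have hs' : 0 < s' < rho0 by rewrite s1; lra.
rewrite cintB; do ?by apply: cc_t => //; exact: F_cell_ok.
rewrite [X in 'i%C * X](@eq_cint _ s s' _ (fun=> 0)); last first.
  by move=> x _; rewrite /pt /polpt expi2pi expi0 subrr mul0r.
by rewrite cint_cst// mul0r mulr0 addr0 => /eqP; rewrite subr_eq0 => /eqP ->.
Qed.

(** At the centre only continuity is required: the circle is shrunk until [F] is within [e'] of
    [F c] on it, and [circle_const] transports the integral back. *)
Lemma mean_value s : ccont_at F c -> 0 < s -> s < rho0 ->
  cint 0 (2 * pi) (fun x => F (pt s x)) = rc (2 * pi) * F c.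
Proof.
move=> Fc s0 s1; have p0 := pi_ge0 R; have p2 : 0 <= 2 * pi :> R by lra.
have E : rc (2 * pi) * F c = cint 0 (2 * pi) (fun=> F c) by rewrite cint_cst// subr0 mulrC.
rewrite E; apply/eqP; rewrite -subr_eq0; apply/eqP; apply: nm_le_eq0 => e e0.
(* [cint_bound] over an interval of length [2 pi] returns [4 pi e']. *)
pose e' := e / (4 * pi + 1); have e'0 : 0 < e' by rewrite divr_gt0//; lra.
have [d d0 hd] := Fc e' e'0.
pose s' := Num.min s (d / 2).
have s'0 : 0 < s' by rewrite lt_min s0 divr_gt0.
have s's : s' <= s by rewrite ge_min lexx.
have s'd : s' < d by rewrite gt_min [X in _ || X](_ : _ = true) ?orbT//; lra.
rewrite -(circle_const s'0 s's s1) -cintB; first last.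
- exact: ccont_cst.
- by apply: cc_t; [exact: F_cell_ok|lra].
apply: (le_trans (cint_bound (M := e') p2 _ _)).
- apply: ccontB; last exact: ccont_cst.
  by apply: cc_t; [exact: F_cell_ok|lra].
- by move=> t _; apply: hd; rewrite polpt_nm gtr0_norm.
have -> : e = e' * (4 * pi + 1) by rewrite /e'; field; lra.
nra.
Qed.

End Goursat.

(** * Complex derivatives and continuity *)

Section Conversions.
Variable R : realType.
Local Notation C := (CC R).

(** Positivity in the order of [R[i]] forces a zero imaginary part, so every radius given by a
    filter on [C] is in fact real. *)
Lemma posC (e : C) : 0 < e -> 0 < complex.Re e /\ e = rc (complex.Re e).
Proof.
move=> e0; have er : e = rc (complex.Re e).
  by move: e0; rewrite ltcE /= => /andP[/eqP h _]; case: e h => a b /= ->.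
by split => //; rewrite -rc_lt -er.
Qed.

Lemma nm_ltE (x : C) (e : R) : (`|x| < rc e) = (nm x < e).
Proof. by rewrite nmE rc_lt. Qed.

Lemma nm_leE (x : C) (e : R) : (`|x| <= rc e) = (nm x <= e).
Proof. by rewrite nmE rc_le. Qed.

Definition cont_on (D : set C) (f : C -> C) : Prop :=
  forall z, D z -> forall e, 0 < e ->
  exists2 d, 0 < d & forall y, D y -> nm (y - z) < d -> nm (f y - f z) <= e.

Lemma within_cont_on (D : set C) (f : C -> C) :
  {within D, continuous f} -> cont_on D f.
Proof.
move=> /subspace_continuousP h z Dz e e0.
have /cvgrPdist_le /(_ (rc e)) := h z Dz.
rewrite -rc0 rc_lt => /(_ e0); rewrite near_withinE => /nbhs_ballP [d /= d0 hd].
have [d0' dE] := posC d0; exists (complex.Re d) => // y Dy yz.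
rewrite nmC -nm_leE; apply: hd => //.
by rewrite -ball_normE /= dE nm_ltE nmC.
Qed.

Lemma cdiffP (f : C -> C) (z l : C) : is_derive z 1 f l <-> cdiff f z l.
Proof.
split.
- case=> dv dl e e0.
  have : h^-1 *: (f (h *: 1 + z) - f z) @[h --> 0^'] --> l by rewrite -dl; exact: dv.
  move/cvgrPdist_le => /(_ (rc e)); rewrite -rc0 rc_lt => /(_ e0).
  rewrite near_withinE => /nbhs_ballP [d /= d0 hd].
  have [d0' dE] := posC d0; exists (complex.Re d) => // y yz.
  have [->|yz0] := eqVneq y z; first by rewrite !subrr mulr0 subr0 nm0 mulr0.
  have h0 : y - z != 0 by rewrite subr_eq0.
  have /= := hd (y - z) _ h0; rewrite -ball_normE /= sub0r dE nm_ltE nmN => /(_ yz).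
  rewrite nm_leE /GRing.scale /= mulr1 subrK => hh.
  have -> : f y - f z - l * (y - z) = (y - z) * - (l - (y - z)^-1 * (f y - f z)).
    by field.
  by rewrite nmM nmN mulrC ler_wpM2r// nm_ge0.
- move=> h.
  have cv : h^-1 *: (f (h *: 1 + z) - f z) @[h --> 0^'] --> l.
    apply/cvgrPdist_le => e /posC[e0 ->].
    have [d d0 hd] := h _ e0; have d0' : 0 < rc d by rewrite -rc0 rc_lt.
    near=> u.
    have u0 : u != 0 by near: u; exact: nbhs_dnbhs_neq.
    have ud : nm u < d by rewrite -nm_ltE; near: u; exact: dnbhs0_lt.
    rewrite nm_leE; have := hd (u + z); rewrite addrK => /(_ ud).
    rewrite /GRing.scale /= mulr1 => hh.
    have -> : l - u^-1 * (f (u + z) - f z) = - u^-1 * (f (u + z) - f z - l * u).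
      by field.
    by rewrite nmM nmN nmV mulrC ler_pdivrMr ?nm_gt0.
  by apply: DeriveDef; [apply/cvg_ex; exists l | apply: cvg_lim].
Unshelve. all: by end_near. Qed.

Lemma holo_cdiff (D : set C) (f : C -> C) : holo D f ->
  forall z, D z -> exists l, cdiff f z l.
Proof. by move=> h z /h dz; exists ('D_1 f z); apply/cdiffP; apply: derivableP. Qed.

Lemma cdiff_derive1 (f : C -> C) z l : cdiff f z l -> f^`() z = l.
Proof. by move=> /cdiffP h; rewrite derive1E; apply: derive_val. Qed.

Implicit Types (f g : C -> C) (z c l : C).

Lemma cdiffM f g z (a b : C) : cdiff f z a -> cdiff g z b ->
  cdiff (fun y => f y * g y) z (f z * b + g z * a).
Proof. by move=> /cdiffP hf /cdiffP hg; apply/cdiffP; apply: is_deriveM. Qed.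

Lemma cdiffD f g z (a b : C) : cdiff f z a -> cdiff g z b ->
  cdiff (fun y => f y + g y) z (a + b).
Proof. by move=> /cdiffP hf /cdiffP hg; apply/cdiffP; apply: is_deriveD. Qed.

Lemma cdiffB f g z (a b : C) : cdiff f z a -> cdiff g z b ->
  cdiff (fun y => f y - g y) z (a - b).
Proof. by move=> /cdiffP hf /cdiffP hg; apply/cdiffP; apply: is_deriveB. Qed.

Lemma cdiffV f z (a : C) : f z != 0 -> cdiff f z a ->
  cdiff (fun y => (f y)^-1) z (- (f z) ^- 2 * a).
Proof.
move=> fz /cdiffP hf; apply/cdiffP; have df : derivable f z 1 by case: hf.
apply: DeriveDef; first exact: derivableV.
by rewrite deriveV// derive_val.
Qed.

Lemma cdiff_cst c z : cdiff (fun=> c) z 0.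
Proof. by apply/cdiffP; exact: is_derive_cst. Qed.

Lemma cdiff_id z : cdiff id z 1.
Proof. by apply/cdiffP; exact: is_derive_id. Qed.

Lemma cdiff_eq f z (a b : C) : cdiff f z a -> a = b -> cdiff f z b.
Proof. by move=> ? <-. Qed.

Lemma cdiff_near f g z l (d : R) : 0 < d -> (forall y, nm (y - z) < d -> f y = g y) ->
  cdiff f z l -> cdiff g z l.
Proof.
move=> d0 fg h e e0; have [d1 d10 hd] := h e e0; exists (Num.min d d1).
  by rewrite lt_min d0.
move=> y; rewrite lt_min => /andP[y1 y2]; rewrite -!fg ?subrr ?nm0//; exact: hd.
Qed.

Lemma cdiff_comp f g z (a b : C) : cdiff g z a -> cdiff f (g z) b ->
  cdiff (fun y => f (g y)) z (b * a).
Proof.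
move=> hg hf e e0.
pose A := nm a + 1; have A0 : 0 < A by rewrite /A; have := nm_ge0 a; lra.
pose B := nm b + 1; have B0 : 0 < B by rewrite /B; have := nm_ge0 b; lra.
have [d1 d10 h1] := hf (e / 2 / A) ltac:(by rewrite !divr_gt0).
have [d2 d20 h2] := hg (e / 2 / B) ltac:(by rewrite !divr_gt0).
have [d3 d30 h3] := hg 1 ltr01.
exists (Num.min d2 (Num.min d3 (d1 / A))); first by rewrite !lt_min d20 d30 divr_gt0.
move=> y; rewrite !lt_min => /and3P[y2 y3 y1].
have g3 : nm (g y - g z) <= A * nm (y - z).
  have := h3 y y3; have := nm_subr (g y - g z) (a * (y - z)); rewrite nmM /A; lra.
have g1 : nm (g y - g z) < d1.
  by apply: le_lt_trans g3 _; rewrite mulrC -ltr_pdivlMr.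
have -> : f (g y) - f (g z) - b * a * (y - z) =
  (f (g y) - f (g z) - b * (g y - g z)) + b * (g y - g z - a * (y - z)) by ring.
apply: le_trans (nmD _ _) _; rewrite nmM.
have -> : e * nm (y - z) = e / 2 / A * (A * nm (y - z)) + B * (e / 2 / B * nm (y - z)).
  by field; rewrite !gt_eqF.
apply: lerD.
  apply: le_trans (h1 _ g1) _; rewrite ler_pM2l// !divr_gt0//.
apply: ler_pM; rewrite ?nm_ge0//; last exact: h2.
by rewrite /B; lra.
Qed.

Lemma cdiff_ccont (f : C -> C) (D : set C) : (forall z, D z -> exists l, cdiff f z l) ->
  cont_on D f.
Proof.
move=> h z Dz e e0; have [l hl] := h z Dz.
by have [d d0 hd] := cdiff_cont hl e0; exists d => // y _; exact: hd.
Qed.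

Lemma cont_on_cst D (c : C) : cont_on D (fun=> c).
Proof. by move=> z _ e e0; exists 1 => // y _ _; rewrite subrr nm0 ltW. Qed.

Lemma cont_on_id D : cont_on D (id : C -> C).
Proof. by move=> z _ e e0; exists e => // y _ /ltW. Qed.

Lemma cont_onD D (f g : C -> C) : cont_on D f -> cont_on D g -> cont_on D (fun z => f z + g z).
Proof.
move=> hf hg z Dz e e0; have e2 : 0 < e / 2 by rewrite divr_gt0.
have [d d0 hd] := hf z Dz _ e2; have [d' d0' hd'] := hg z Dz _ e2.
exists (Num.min d d'); first by rewrite lt_min d0.
move=> y yD; rewrite lt_min => /andP[y1 y2].
have -> : f y + g y - (f z + g z) = (f y - f z) + (g y - g z) by ring.
apply: le_trans (nmD _ _) _; have := hd y yD y1; have := hd' y yD y2; lra.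
Qed.

Lemma cont_onM D (f g : C -> C) : cont_on D f -> cont_on D g -> cont_on D (fun z => f z * g z).
Proof.
move=> hf hg z Dz e e0.
pose M := nm (f z) + 1; have M0 : 0 < M by rewrite /M; have := nm_ge0 (f z); lra.
pose N := nm (g z) + 1; have N0 : 0 < N by rewrite /N; have := nm_ge0 (g z); lra.
have [d1 d10 h1] := hf z Dz 1 ltr01.
have [d2 d20 h2] := hf z Dz (e / 2 / N) ltac:(by rewrite !divr_gt0).
have [d3 d30 h3] := hg z Dz (e / 2 / M) ltac:(by rewrite !divr_gt0).
exists (Num.min d1 (Num.min d2 d3)); first by rewrite !lt_min d10 d20 d30.
move=> y yD; rewrite !lt_min => /and3P[y1 y2 y3].
have -> : f y * g y - f z * g z = f y * (g y - g z) + (f y - f z) * g z by ring.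
apply: le_trans (nmD _ _) _; rewrite !nmM.
have -> : e = M * (e / 2 / M) + (e / 2 / N) * N by field; rewrite !gt_eqF.
apply: lerD; apply: ler_pM => //; try exact: nm_ge0.
- by have := h1 y yD y1; have := nm_subr (f y) (f z); rewrite /M; lra.
- exact: h3.
- exact: h2.
- by rewrite /N; lra.
Qed.

Lemma cont_onX D (f : C -> C) n : cont_on D f -> cont_on D (fun z => f z ^+ n).
Proof.
move=> h; elim: n => [|n IH]; first exact: cont_on_cst.
have -> : (fun z => f z ^+ n.+1) = (fun z => f z * f z ^+ n).
  by apply/funext => z; rewrite exprS.
exact: cont_onM.
Qed.

Lemma cont_onN D (f : C -> C) : cont_on D f -> cont_on D (fun z => - f z).
Proof.
move=> h; have -> : (fun z => - f z) = (fun z => -1 * f z).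
  by apply/funext => z; rewrite mulN1r.
by apply: cont_onM => //; exact: cont_on_cst.
Qed.

Lemma cont_onB D (f g : C -> C) : cont_on D f -> cont_on D g -> cont_on D (fun z => f z - g z).
Proof. by move=> hf hg; apply: cont_onD => //; exact: cont_onN. Qed.

Lemma cont_onV D (f : C -> C) : (forall z, D z -> f z != 0) -> cont_on D f ->
  cont_on D (fun z => (f z)^-1).
Proof.
move=> f0 hf z Dz e e0.
pose m := nm (f z); have m0 : 0 < m by rewrite nm_gt0 f0.
have [d1 d10 h1] := hf z Dz (m / 2) ltac:(by rewrite !divr_gt0).
have [d2 d20 h2] := hf z Dz (e * (m / 2) * m) ltac:(by rewrite !(mulr_gt0, divr_gt0)).
exists (Num.min d1 d2); first by rewrite lt_min d10.
move=> y yab; rewrite lt_min => /andP[y1 y2].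
have fy : m / 2 <= nm (f y).
  have := h1 y yab y1; rewrite nmC; have := nm_subr (f z) (f y); rewrite /m; lra.
have -> : (f y)^-1 - (f z)^-1 = (f z - f y) / (f y * f z).
  by field; rewrite !f0.
rewrite nmM nmV nmM nmC ler_pdivrMr; last by rewrite mulr_gt0// (lt_le_trans _ fy)// divr_gt0.
apply: le_trans (h2 y yab y2) _; rewrite -mulrA ler_pM2l// ler_pM2r//.
Qed.

Lemma cont_on_sub (D D' : set C) f : D' `<=` D -> cont_on D f -> cont_on D' f.
Proof.
move=> h hf z /h Dz e e0; have [d d0 hd] := hf z Dz e e0.
by exists d => // y /h; exact: hd.
Qed.

Lemma cont_on_comp (D E : set C) f g : (forall z, D z -> E (g z)) ->
  cont_on D g -> cont_on E f -> cont_on D (fun z => f (g z)).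
Proof.
move=> h hg hf z Dz e e0; have [d d0 hd] := hf _ (h z Dz) e e0.
have [d' d0' hd'] := hg z Dz (d / 2) ltac:(by rewrite divr_gt0).
exists d' => // y Dy yz; apply: hd; first exact: h.
by apply: le_lt_trans (hd' y Dy yz) _; lra.
Qed.

Lemma cont_on_expi (D : set C) f a b : (forall t, a <= t <= b -> D (expi t)) ->
  cont_on D f -> ccont a b (fun t => f (expi t)).
Proof.
move=> hD hf x xab e e0; have [d d0 hd] := hf _ (hD x xab) e e0.
have [d' d0' hd'] := @ccont_expi R a b x xab (d / 2) ltac:(by rewrite divr_gt0).
exists d' => // y yab yx; apply: hd; first exact: hD.
by apply: le_lt_trans (hd' y yab yx) _; lra.
Qed.

Lemma cvg_natP (u : nat -> C) (l : C) : u @ \oo --> l <->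
  (forall e, 0 < e -> exists s0, forall s, (s0 <= s)%N -> nm (l - u s) <= e).
Proof.
split.
  move/cvgrPdist_le => h e e0; have /h : 0 < rc e by rewrite -rc0 rc_lt.
  by move=> [s0 _ hs]; exists s0 => s s0s; rewrite -nm_leE; apply: hs.
move=> h; apply/cvgrPdist_le => e /posC[e0 ->]; have [s0 hs] := h _ e0.
by exists s0 => // s s0s; rewrite /= nm_leE; exact: hs.
Qed.

End Conversions.

(** * Maximum principle *)

Section MaximumPrinciple.
Variable R : realType.
Local Notation C := (CC R).
Implicit Types (f g : C -> C) (z : C).

Definition annulus (r : R) : set C := [set z | r <= nm z <= 1].

Lemma polpt0_nm s t : 0 <= s -> nm (polpt 0 s t : C) = s.
Proof. by move=> s0; rewrite -[polpt _ _ _]subr0 polpt_nm ger0_norm. Qed.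

Lemma lt3 (a b s d : R) : 0 <= b -> 0 <= s <= 1 -> a < d / 3 -> b < d / 3 ->
  a + 2 * s * b < d.
Proof.
move=> b0 /andP[s0 s1] h1 h2; have : s * b <= b by apply: ler_piMl.
move: (s * b) (mulrA 2 s b) => x <-; lra.
Qed.

(** Polar coordinates present the annulus as the image of a compact rectangle, to which the extreme
    value theorem applies. *)
Lemma annulus_EVT (r : R) (v : C -> R) : 0 < r -> r <= 1 ->
  (forall z, annulus r z -> forall e, 0 < e -> exists2 d, 0 < d &
     forall y, annulus r y -> nm (y - z) < d -> `|v y - v z| <= e) ->
  exists2 a, annulus r a & forall z, annulus r z -> v z <= v a.
Proof.
move=> r0 r1 hv; have p0 := pi_ge0 R.
pose A : set (R * R) := `[r, 1] `*` `[0, 2 * pi].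
pose g (p : R * R) := v (polpt 0 p.1 p.2).
have Ain p : A p -> annulus r (polpt 0 p.1 p.2).
  case: p => s t [/=]; rewrite !in_itv /= => /andP[s1 s2] _; rewrite /annulus /=.
  by rewrite polpt0_nm ?s1 ?s2//; lra.
have A0 : A !=set0.
  by exists (r, 0); split => /=; rewrite in_itv /= lexx//=; lra.
have cA : compact A by apply: compact_setX; exact: segment_compact.
have gc : {within A, continuous g}.
  apply/subspace_continuousP => -[s t] Ap; apply/cvgrPdist_le => e e0.
  have [d d0 hd] := hv _ (Ain _ Ap) e e0.
  pose d' := d / 3; have d'0 : 0 < d' by rewrite divr_gt0.
  rewrite near_withinE; apply/nbhs_ballP; exists d' => //= -[s' t'].
  rewrite /ball /= /prod_ball /= => -[]; rewrite /ball /= => b1 b2 Ap'.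
  rewrite distrC; apply: hd; first exact: Ain Ap'.
  apply: le_lt_trans (polpt_dist _ _ _ _ _) _ => /=.
  case: Ap => /=; rewrite !in_itv /= => /andP[s1 s2] _.
  rewrite (ger0_norm (_ : 0 <= s)); last by lra.
  move: b1 b2; rewrite (distrC s) (distrC t) /d' => b1 b2.
  by apply: lt3 => //; rewrite (le_trans (ltW r0) s1) s2.
have [[s t] /[!inE] At hmax] := compact_EVT_max A0 cA gc.
exists (polpt 0 s t); first exact: (Ain (s, t)).
move=> z /andP[z1 z2]; have [x x0 ->] := polar z.
have -> : rc (nm z) * expi x = polpt 0 (nm z) x by rewrite /polpt add0r.
by apply: (hmax (nm z, x)); rewrite inE; split; rewrite /= in_itv /= ?z1.
Qed.

Lemma max_annulus_Re (r M : R) f : 0 < r -> r <= 1 ->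
  (forall z, r < nm z < 1 -> exists l, cdiff f z l) -> cont_on (annulus r) f ->
  (forall z, nm z = r \/ nm z = 1 -> complex.Re (f z) <= M) ->
  forall z, annulus r z -> complex.Re (f z) <= M.
Proof.
move=> r0 r1 fd fc fM z0 z0A; apply/ler_addgt0Pr => e e0; have p0 := pi_gt0 R.
(* [e * |z|^2] makes the function strictly subharmonic, so an interior maximum
   contradicts the mean value property of [f + 2 e conj(a) (z - a)]. *)
pose v z := complex.Re (f z) + e * nm z ^+ 2.
have [|a aA amax] := @annulus_EVT r v r0 r1.
  move=> z zA e1 e10; have [d1 d10 hd1] := fc z zA (e1 / 2) ltac:(by rewrite divr_gt0).
  exists (Num.min d1 (e1 / (4 * e))).
    by rewrite lt_min d10 divr_gt0// mulr_gt0.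
  move=> y yA; rewrite lt_min => /andP[y1 y2].
  have -> : v y - v z = complex.Re (f y - f z) + e * ((nm y - nm z) * (nm y + nm z)).
    by rewrite creB /v; ring.
  apply: le_trans (ler_normD _ _) _; have -> : e1 = e1 / 2 + e1 / 2 by field.
  apply: lerD; first by apply: le_trans (Re_nm _) _; exact: hd1.
  have n1 : `|nm y - nm z| <= nm (y - z).
    rewrite ler_norml; have := nm_subr y z; have := nm_subr z y; rewrite (nmC z); lra.
  have n2 : `|nm y + nm z| <= 2.
    case/andP: zA => _ ?; case/andP: yA => _ ?.
    by rewrite ger0_norm ?addr_ge0 ?nm_ge0//; lra.
  rewrite !normrM (gtr0_norm e0).
  move: y2; rewrite ltr_pdivlMr ?mulr_gt0// => y2.
  have := normr_ge0 (nm y + nm z); have := normr_ge0 (nm y - nm z) => h1 h2.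
  have : `|nm y - nm z| * `|nm y + nm z| <= nm (y - z) * 2 by apply: ler_pM.
  by nra.
have bd z : annulus r z -> complex.Re (f z) <= v z.
  by move=> _; rewrite /v; have := sqr_ge0 (nm z); nra.
have n1 z : annulus r z -> nm z ^+ 2 <= 1.
  by move=> /andP[_ h]; rewrite -(expr1n _ 2) ler_pXn2r ?nnegrE ?nm_ge0.
apply: le_trans (bd _ z0A) _; apply: le_trans (amax _ z0A) _.
have [ab|ab] := pselect (nm a = r \/ nm a = 1).
  by rewrite /v; have := fM a ab; have := n1 a aA; nra.
have ain : r < nm a < 1.
  case/andP: aA => a1 a2; rewrite !lt_neqAle a1 a2 !andbT.
  by apply/andP; split; apply/eqP => h; apply: ab; [left|right].
exfalso.
pose D := Num.min (nm a - r) (1 - nm a).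
have D0 : 0 < D by rewrite lt_min; lra.
have Din z : nm (z - a) < D -> r < nm z < 1.
  rewrite lt_min => /andP[h1 h2].
  have := nm_subr z a; have := nm_subr a z; rewrite (nmC a); lra.
pose k := rc (2 * e) * (a^*)%C.
pose h z := f z + k * (z - a).
have hdiff z : nm (z - a) < D -> exists l, cdiff h z l.
  move=> /Din /fd [l hl]; exists (l + (k * (1 - 0) + (z - a) * 0)).
  apply: cdiffD => //; apply: (cdiffM (f := fun=> k)); first exact: cdiff_cst.
  by apply: cdiffB; [exact: cdiff_id|exact: cdiff_cst].
pose s := D / 2; have s0 : 0 < s by rewrite divr_gt0.
have hac : ccont_at h a.
  by have [|l hl] := hdiff a; [rewrite subrr nm0|exact: cdiff_cont hl].
have hd' z : 0 < nm (z - a) < D -> exists l, cdiff h z l by case/andP=> _; exact: hdiff.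
have sD : s < D by rewrite /s; lra.
have := mean_value hd' hac s0 sD; rewrite {2}/h subrr mulr0 addr0 => /(congr1 (@complex.Re R)).
rewrite creM /= mul0r subr0.
have hcont : ccont 0 (2 * pi) (fun x => h (polpt a s x)).
  apply: polpt_ccont_t => t _; have [|l hl] := hdiff (polpt a s t).
    by rewrite polpt_nm gtr0_norm.
  exact: cdiff_cont hl.
(* By [|y|^2 - |a|^2 = |y - a|^2 + 2 Re (conj a (y - a))] the linear term of [h] absorbs the change
   of [e |y|^2] up to [e s^2], so maximality of [v] at [a] leaves a uniform loss on the circle. *)
have hle : rint 0 (2 * pi) (fun t => complex.Re (h (polpt a s t))) <=
    rint 0 (2 * pi) (fun=> complex.Re (f a) - e * s ^+ 2).
  apply: rint_le; [exact: ccont_Re|exact: rcont_cst|] => t _.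
  set y := polpt a s t.
  have yD : nm (y - a) < D by rewrite polpt_nm gtr0_norm.
  have yA : annulus r y by have /andP[/ltW y1 /ltW y2] := Din _ yD; rewrite /annulus /= y1.
  have := amax y yA; rewrite /v /h creD !nm_sqr /k => hm.
  have : s ^+ 2 = nm (y - a) ^+ 2 by rewrite polpt_nm gtr0_norm.
  rewrite nm_sqr creB cimB => ->; move: hm.
  move: (f y) (f a) => fy fa; case: (y) => y1 y2; case: (a) => a1 a2 /=; nra.
move=> E; rewrite E in hle; move: hle; rewrite rint_cst; last by lra.
have : 0 < e * s ^+ 2 * (2 * pi) by rewrite !mulr_gt0// exprn_gt0.
by rewrite subr0; lra.
Qed.

(** At a given point a unimodular factor [u] turns the modulus into a real part, and the principle
    for real parts applies to [u f]. *)
Lemma max_annulus (r M : R) f : 0 < r -> r <= 1 ->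
  (forall z, r < nm z < 1 -> exists l, cdiff f z l) -> cont_on (annulus r) f ->
  (forall z, nm z = r \/ nm z = 1 -> nm (f z) <= M) ->
  forall z, annulus r z -> nm (f z) <= M.
Proof.
move=> r0 r1 fd fc fM z0 z0A.
have [fz|fz] := eqVneq (f z0) 0.
  by rewrite fz nm0; apply: le_trans (nm_ge0 (f 1)) (fM 1 _); right; exact: nm1.
pose n := nm (f z0); have n0 : 0 < n by rewrite nm_gt0.
pose u : C := rc n^-1 * (f z0)^*%C.
have nu : nm u = 1.
  rewrite nmM nm_rc gtr0_norm ?invr_gt0// (_ : nm _ = n) ?mulVf ?gt_eqF//.
  apply/eqP; rewrite -(eqrXn2 (n := 2)) ?nm_ge0 ?ltW//; apply/eqP.
  by rewrite !nm_sqr; case: (f z0) => x y /=; rewrite sqrrN.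
have -> : nm (f z0) = complex.Re (u * f z0).
  have : n ^+ 2 = complex.Re (f z0) ^+ 2 + complex.Im (f z0) ^+ 2 by rewrite -nm_sqr.
  rewrite -/n /u; case: (f z0) => x y /= h.
  transitivity ( n^-1 * (x ^+ 2 + y ^+ 2)); first by rewrite -h; field; rewrite gt_eqF.
  by ring.
apply: (@max_annulus_Re r M (fun z => u * f z)) => //.
- move=> z /fd [l hl]; exists (u * l + f z * 0).
  by apply: (cdiffM (f := fun=> u)); first exact: cdiff_cst.
- by apply: (cont_onM (f := fun=> u)); first exact: cont_on_cst.
- move=> z hz; apply: le_trans (ler_norm _) _; apply: le_trans (Re_nm _) _.
  by rewrite nmM nu mul1r; exact: fM.
Qed.

(* The maximum principle for [z^k f] bounds [|f z|] by [M (r / |z|)^k]. *)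
Lemma circle_unique f :
  (forall z, 0 < nm z < 1 -> exists l, cdiff f z l) ->
  cont_on [set z | 0 < nm z <= 1] f -> (forall z, nm z = 1 -> f z = 0) ->
  forall z, 0 < nm z <= 1 -> f z = 0.
Proof.
move=> fd fc f1 z0 /andP[z00 z01].
have [z1|z1] := eqVneq (nm z0) 1; first exact: f1.
have {}z01 : nm z0 < 1 by rewrite lt_neqAle z1.
(* Half of [|z0|] makes the ratio [r / |z0|] equal to 1/2, so the bound becomes [M / 2 ^+ k]. *)
pose r := nm z0 / 2; have r0 : 0 < r by rewrite divr_gt0.
have r1 : r <= 1 by rewrite /r; lra.
have sub : annulus r `<=` [set z | 0 < nm z <= 1].
  by move=> z /andP[h1 h2] /=; rewrite h2 (lt_le_trans r0).
have fcA : cont_on (annulus r) f by exact: cont_on_sub fc.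
have [b bA bmax] : exists2 a, annulus r a & forall z, annulus r z -> nm (f z) <= nm (f a).
  apply: annulus_EVT => // z zA e e0; have [d d0 hd] := fcA z zA e e0.
  exists d => // y yA yz; apply: le_trans (hd y yA yz).
  rewrite ler_norml; have := nm_subr (f y) (f z); have := nm_subr (f z) (f y).
  rewrite (nmC (f z)); lra.
set M := nm (f b) in bmax.
have key k : nm z0 ^+ k * nm (f z0) <= r ^+ k * M.
  rewrite -nmX -nmM; apply: (@max_annulus r (r ^+ k * M) (fun z => z ^+ k * f z)) => //.
  - move=> z /andP[h1 h2]; have [|l hl] := fd z; first by rewrite h2 (lt_trans r0).
    have [l' hl'] : exists l', cdiff (fun z : C => z ^+ k) z l'.
      elim: k {h1 h2} => [|k [l' hl']]; first by exists 0; exact: cdiff_cst.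
      eexists; have -> : (fun z : C => z ^+ k.+1) = (fun z => z * z ^+ k).
        by apply/funext => y; rewrite exprS.
      by apply: cdiffM; [exact: cdiff_id|exact: hl'].
    by exists (z ^+ k * l + f z * l'); exact: cdiffM.
  - by apply: cont_onM => //; apply: cont_onX; exact: cont_on_id.
  - move=> z [zr|z1']; rewrite nmM nmX.
      rewrite zr; apply: ler_wpM2l; first by rewrite exprn_ge0// ltW.
      by apply: bmax; rewrite /annulus /= zr lexx.
    by rewrite f1// nm0 mulr0 mulr_ge0 ?nm_ge0// exprn_ge0// ltW.
  - by rewrite /annulus /= (ltW z01) /r; lra.
apply: nm_le_eq0 => e e0.
have key2 k : nm (f z0) <= M / 2 ^+ k.
  have := key k; rewrite /r expr_div_n mulrAC -mulrA ler_pM2l ?exprn_gt0//.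
have [k hk] : exists k : nat, M / e < k%:R.
  by exists (Num.trunc (M / e)).+1; exact: truncnS_gt.
apply: le_trans (key2 k) _; rewrite ler_pdivrMr ?exprn_gt0// -ler_pdivrMl// mulrC.
apply: ltW (lt_trans hk _); rewrite -natrX ltr_nat; exact: ltn_expl.
Qed.

(** No derivative is available on the circle itself: the mean value over radius [s < 1] is compared
    with the one over the circle, using that [f (s expi t)] tends to [f (expi t)] uniformly in
    [t]. *)
Lemma mean_value_circle f :
  (forall z, nm z < 1 -> exists l, cdiff f z l) -> cont_on [set z | nm z <= 1] f ->
  cint 0 (2 * pi) (fun t => f (expi t)) = rc (2 * pi) * f 0.
Proof.
move=> fd fc; have p0 := pi_gt0 R; have p2 : 0 <= 2 * pi :> R by lra.
have [l0 hl0] : exists l, cdiff f 0 l by apply: fd; rewrite nm0.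
have fd' z : 0 < nm (z - 0) < 1 -> exists l, cdiff f z l.
  by rewrite subr0 => /andP[_]; exact: fd.
have unif e : 0 < e -> exists2 h, 0 < h < 1 & forall s t, 1 - h < s < 1 ->
    0 <= t <= 2 * pi -> nm (f (polpt 0 s t) - f (expi t)) <= e.
  move=> e0.
  pose P n (x y : R) := exists2 h, 0 < h < 1 & forall s t, 1 - h < s < 1 ->
    y <= t <= y + 2 * pi / 2 ^+ n -> nm (f (polpt 0 s t) - f (expi t)) <= e.
  have : P 0%N 0 0.
    (* With a degenerate first side the dyadic induction runs over the angle alone and plays the
       role of compactness of the circle. *)
    apply: (@dyadic_ind _ P 0 0 0 (2 * pi)) => //.
    - move=> n x y _ _ _ _ [h1 h10 H1] _ [h2 h20 H2] _.
      exists (Num.min h1 h2).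
        by case/andP: h10 => ? ?; case/andP: h20 => ? _; rewrite lt_min gt_min; apply/andP; split; [apply/andP|apply/orP; left].
      move=> s t /andP[s1 s2] /andP[t1 t2].
      have : 1 - h1 < s /\ 1 - h2 < s.
        by move: s1; rewrite ltrBlDr -ltrBlDl lt_min => /andP[? ?]; split; lra.
      case=> s3 s4.
      have [tt|tt] := leP t (y + 2 * pi / 2 ^+ n.+1).
        by apply: H1; rewrite ?s3 ?s2 ?t1.
      apply: H2; rewrite ?s4 ?s2// (ltW tt) /= -addrA; apply: le_trans t2 _.
      rewrite lerD2l exprS le_eqVlt; apply/orP; left; apply/eqP; field.
      by rewrite expf_neq0.
    - move=> x y _ _.
      have [|d d0 hd] := fc (expi y) _ (e / 2) ltac:(by rewrite divr_gt0).
        by rewrite /= expi_nm.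
      pose d' := Num.min (1/2) (d / 4); exists d'; first by rewrite lt_min !divr_gt0.
      have d'1 : d' <= 1 / 2 by rewrite ge_min lexx.
      have d'2 : d' <= d / 4 by rewrite ge_min lexx orbT.
      have d'0 : 0 < d' by rewrite lt_min !divr_gt0.
      move=> n u v _ _ _ _ _ vy yv _ _ small; exists d'; first by lra.
      move=> s t /andP[s1 s2] /andP[t1 t2].
      have e1 u' : expi u' = polpt 0 1 u' :> C by rewrite /polpt add0r rc1 mul1r.
      have ty : `|t - y| <= 2 * pi / 2 ^+ n by rewrite ler_norml; lra.
      have c1 : nm (polpt 0 s t - expi y) < d.
        rewrite e1; apply: le_lt_trans (polpt_dist _ _ _ _ _) _.
        rewrite normr1 ltr0_norm; lra.
      have c2 : nm (expi t - expi y : C) < d.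
        rewrite !e1; apply: le_lt_trans (polpt_dist _ _ _ _ _) _.
        rewrite normr1 subrr normr0; lra.
      apply: le_trans (nm_tri _ (f (expi y)) _) _; rewrite [X in _ + X <= _]nmC.
      have -> : e = e / 2 + e / 2 by field.
      apply: lerD; apply: hd => //=; last by rewrite expi_nm.
      by rewrite polpt0_nm; lra.
  case=> h h0 H; exists h => // s t hs ht; apply: H => //.
  by rewrite expr0 divr1 add0r.
have c1 : ccont 0 (2 * pi) (fun t => f (expi t)).
  by apply: cont_on_expi fc => t _ /=; rewrite expi_nm.
apply/eqP; rewrite -subr_eq0; apply/eqP; apply: nm_le_eq0 => e e0.
pose e' := e / (4 * pi + 1); have e'0 : 0 < e' by rewrite divr_gt0//; lra.
have [h h0 H] := unif e' e'0; pose s := 1 - h / 2.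
have s0 : 0 < s by rewrite /s; lra. have s1 : s < 1 by rewrite /s; lra.
rewrite -(mean_value fd' (cdiff_cont hl0) s0 s1) -cintB//; last first.
  apply: polpt_ccont_t => t _; have [|l hl] := fd (polpt 0 s t).
    by rewrite polpt0_nm// ltW.
  exact: cdiff_cont hl.
apply: (le_trans (cint_bound (M := e') p2 _ _)).
- apply: ccontB => //; apply: polpt_ccont_t => t _; have [|l hl] := fd (polpt 0 s t).
    by rewrite polpt0_nm// ltW.
  exact: cdiff_cont hl.
- by move=> t ht; rewrite nmC; apply: H => //; rewrite /s; lra.
have -> : e = e' * (4 * pi + 1) by rewrite /e'; field; lra.
nra.
Qed.

Lemma nm_conj z : nm (z^*%C) = nm z.
Proof.
apply/eqP; rewrite -(eqrXn2 (n := 2)) ?nm_ge0//; apply/eqP.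
by rewrite !nm_sqr; case: z => x y /=; rewrite sqrrN.
Qed.

Lemma conj_expi t : (expi t : C)^*%C = expi (- t).
Proof. by rewrite /expi /= cosN sinN. Qed.

Lemma cint_conj a b (g : R -> C) : ccont a b g ->
  cint a b (fun t => (g t)^*%C) = ((cint a b g)^*)%C.
Proof.
move=> h; apply: ReIm_eq; rewrite /cint /=.
  by apply: eq_Rintegral => t _; case: (g t).
rewrite -mulN1r -rintZ; last exact: ccont_Im.
by apply: eq_Rintegral => t _; case: (g t) => x y /=; rewrite mulN1r.
Qed.

(* Apply the previous lemma to [conj (f (conj z))]. *)
Lemma mean_value_circleN f :
  (forall z, nm z < 1 -> exists l, cdiff f z l) -> cont_on [set z | nm z <= 1] f ->
  cint 0 (2 * pi) (fun t => f (expi (- t))) = rc (2 * pi) * f 0.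
Proof.
move=> fd fc; pose g (z : C) : C := ((f z^*%C)^*)%C.
have conjB (x y : C) : ((x - y)^*)%C = x^*%C - y^*%C by exact: rmorphB.
have conjM (x y : C) : ((x * y)^*)%C = x^*%C * y^*%C by exact: rmorphM.
have gd z : nm z < 1 -> exists l, cdiff g z l.
  move=> z1; have [|l hl] := fd (z^*)%C; first by rewrite nm_conj.
  exists (l^*)%C => e e0; have [d d0 hd] := hl e e0; exists d => // y yz.
  have := hd (y^*)%C; rewrite -conjB nm_conj => /(_ yz); rewrite -[X in X <= _]nm_conj.
  by rewrite !conjB conjM conjB !conjcK.
have gc : cont_on [set z | nm z <= 1] g.
  move=> z z1 e e0; have [|d d0 hd] := fc (z^*)%C _ e e0; first by rewrite /= nm_conj.
  exists d => // y y1 yz; rewrite -conjB nm_conj; apply: hd; first by rewrite /= nm_conj.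
  by rewrite -conjB nm_conj.
have c1 : ccont 0 (2 * pi) (fun t => g (expi t)).
  by apply: cont_on_expi gc => t _ /=; rewrite expi_nm.
have := mean_value_circle gd gc => /(congr1 (@conjc R)); rewrite -cint_conj//.
rewrite (@eq_cint _ _ _ _ (fun t => f (expi (- t)))) => [->|t _]; last first.
  by rewrite /g conjcK conj_expi.
by rewrite conjM /g conjcK conjc0 /rc conjc_real.
Qed.

End MaximumPrinciple.

(** * Power series with summable coefficients *)

Section SequenceLimit.
Variable R : realType.
Local Notation C := (CC R).
Implicit Types (u v : nat -> C) (l : C).

Definition slim u l := forall e : R, 0 < e ->
  exists s0, forall s, (s0 <= s)%N -> nm (l - u s) <= e.

Lemma slim_cst l : slim (fun=> l) l.
Proof. by move=> e e0; exists 0%N => s _; rewrite subrr nm0 ltW. Qed.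

Lemma slim_uniq u l l' : slim u l -> slim u l' -> l = l'.
Proof.
move=> h h'; apply/eqP; rewrite -subr_eq0; apply/eqP; apply: nm_le_eq0 => e e0.
have e2 : 0 < e / 2 by rewrite divr_gt0.
have [s1 h1] := h _ e2; have [s2 h2] := h' _ e2; pose s := maxn s1 s2.
apply: le_trans (nm_tri _ (u s) _) _; have := h1 s (leq_maxl _ _).
by have := h2 s (leq_maxr _ _); rewrite (nmC l'); lra.
Qed.

Lemma slimD u v l l' : slim u l -> slim v l' -> slim (fun s => u s + v s) (l + l').
Proof.
move=> h h' e e0; have e2 : 0 < e / 2 by rewrite divr_gt0.
have [s1 h1] := h _ e2; have [s2 h2] := h' _ e2; exists (maxn s1 s2) => s.
rewrite geq_max => /andP[/h1 a /h2 b]; rewrite opprD addrACA.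
by apply: le_trans (nmD _ _) _; lra.
Qed.

Lemma slimM u v l l' : slim u l -> slim v l' -> slim (fun s => u s * v s) (l * l').
Proof.
move=> h h' e e0.
pose M := nm l + 1; have M0 : 0 < M by rewrite /M; have := nm_ge0 l; lra.
pose N := nm l' + 1; have N0 : 0 < N by rewrite /N; have := nm_ge0 l'; lra.
have [s1 h1] := h 1 ltr01.
have [s2 h2] := h (e / 2 / N) ltac:(by rewrite !divr_gt0).
have [s3 h3] := h' (e / 2 / M) ltac:(by rewrite !divr_gt0).
exists (maxn s1 (maxn s2 s3)) => s; rewrite !geq_max => /and3P[/h1 a /h2 b /h3 c].
have -> : l * l' - u s * v s = u s * (l' - v s) + (l - u s) * l' by ring.
apply: le_trans (nmD _ _) _; rewrite !nmM.
have -> : e = M * (e / 2 / M) + (e / 2 / N) * N by field; rewrite !gt_eqF.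
apply: lerD; apply: ler_pM => //; try exact: nm_ge0; last by rewrite /N; lra.
by rewrite nmC in a; have := nm_subr (u s) l; rewrite /M; lra.
Qed.

Lemma slimZ c u l : slim u l -> slim (fun s => c * u s) (c * l).
Proof. by move=> h; apply: slimM => //; exact: slim_cst. Qed.

Lemma slimN u l : slim u l -> slim (fun s => - u s) (- l).
Proof.
by move=> h e /h [s0 hs]; exists s0 => s /hs; rewrite -opprD nmN.
Qed.

Lemma slimB u v l l' : slim u l -> slim v l' -> slim (fun s => u s - v s) (l - l').
Proof. by move=> h h'; apply: slimD => //; exact: slimN. Qed.

Lemma slim_sum n (u : nat -> nat -> C) (l : nat -> C) :
  (forall i, (i < n)%N -> slim (u i) (l i)) ->
  slim (fun s => \sum_(i < n) u i s) (\sum_(i < n) l i).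
Proof.
elim: n => [|n IH] h.
  have -> : (fun s => \sum_(i < 0) u i s) = fun=> 0 by apply/funext => s; rewrite big_ord0.
  by rewrite big_ord0; exact: slim_cst.
have -> : (fun s => \sum_(i < n.+1) u i s) = (fun s => \sum_(i < n) u i s + u n s).
  by apply/funext => s; rewrite big_ord_recr.
by rewrite big_ord_recr /=; apply: slimD; [apply: IH => i i_n; apply: h; exact: ltnW|exact: h].
Qed.

Lemma eq_slim u v l : (forall s, u s = v s) -> slim u l -> slim v l.
Proof. by move=> h; have -> : u = v by apply/funext. Qed.

Lemma slim_shift u l k : slim u l -> slim (fun s => u (s + k)%N) l.
Proof.
move=> h e /h [s0 hs]; exists s0 => s ss; apply: hs; exact: leq_trans ss (leq_addr _ _).
Qed.

Lemma slim_nm_le u l M : slim u l -> (forall s, nm (u s) <= M) -> nm l <= M.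
Proof.
move=> h hM; apply/ler_addgt0Pr => e /h [s0 /(_ s0 (leqnn _)) hs].
by have := nm_subr l (u s0); have := hM s0; lra.
Qed.

Lemma slim_nm_le_ev u l M : slim u l -> (exists s0, forall s, (s0 <= s)%N -> nm (u s) <= M) ->
  nm l <= M.
Proof.
move=> h [s0 hM]; apply: (slim_nm_le (slim_shift s0 h)) => s; apply: hM; exact: leq_addl.
Qed.

Lemma slim_exists u : (forall e, 0 < e -> exists s0, forall s s', (s0 <= s)%N ->
  (s0 <= s')%N -> nm (u s - u s') <= e) -> exists l, slim u l.
Proof.
move=> h.
have real (g : C -> R) : (forall x y : C, `|g x - g y| <= nm (x - y)) ->
    exists a, forall e, 0 < e -> exists s0, forall s, (s0 <= s)%N -> `|a - g (u s)| <= e.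
  move=> gl; have cv : cvgn (fun s => g (u s)).
    apply/cauchy_cvgP; apply/cauchy_exP => e e0.
    have [s0 hs] := h (e / 2) ltac:(by rewrite divr_gt0).
    exists (g (u s0)); exists s0 => // s /= ss.
    rewrite /ball /= /ball_; apply: le_lt_trans (gl _ _) _.
    by apply: le_lt_trans (hs s0 s (leqnn _) ss) _; lra.
  exists (limn (fun s => g (u s))) => e e0.
  by have /cvgrPdist_le /(_ e e0) [s0 _ hs] := cv; exists s0 => s /hs.
have [a ha] := real (@complex.Re R) (fun x y => ltac:(by rewrite -creB Re_nm)).
have [b hb] := real (@complex.Im R) (fun x y => ltac:(by rewrite -cimB Im_nm)).
exists (a +i* b)%C => e e0; have e2 : 0 < e / 2 by rewrite divr_gt0.
have [s1 h1] := ha _ e2; have [s2 h2] := hb _ e2.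
exists (maxn s1 s2) => s; rewrite geq_max => /andP[/h1 A /h2 B].
by apply: le_trans (nm_ReIm _) _; rewrite creB cimB /=; lra.
Qed.

End SequenceLimit.

(** * Weighted coefficient norm of polynomials *)

Section WeightedNorm.
Variable R : realType.
Local Notation C := (CC R).
Implicit Types (p q : {poly C}) (z a h : C) (rho : R).

(** The weighted l^1 norm of the coefficients. It is submultiplicative and dominates the supremum on
    [|z| <= rho]; the value [rho = 1] reaches the circle, smaller values leave room for
    derivatives. *)
Definition pn (rho : R) (p : {poly C}) : R := \sum_(i < size p) nm p`_i * rho ^+ i.

Lemma pn_widen rho p n : (size p <= n)%N -> pn rho p = \sum_(i < n) nm p`_i * rho ^+ i.
Proof.
move=> sn; rewrite /pn (big_ord_widen n (fun i => nm p`_i * rho ^+ i) sn).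
rewrite big_mkcond /=; apply: eq_bigr => i _; case: ltnP => // h.
by rewrite nth_default// nm0 mul0r.
Qed.

Lemma pn_ge0 rho p : 0 <= rho -> 0 <= pn rho p.
Proof. by move=> r0; apply: sumr_ge0 => i _; rewrite mulr_ge0 ?nm_ge0 ?exprn_ge0. Qed.

Lemma pn0 rho : pn rho 0 = 0.
Proof. by rewrite /pn size_poly0 big_ord0. Qed.

Lemma pnD rho p q : 0 <= rho -> pn rho (p + q) <= pn rho p + pn rho q.
Proof.
move=> r0; pose n := maxn (size p) (size q).
rewrite (@pn_widen _ _ n) ?size_polyD// (@pn_widen _ p n) ?leq_maxl//.
rewrite (@pn_widen _ q n) ?leq_maxr// -big_split /=; apply: ler_sum => i _.
by rewrite coefD -mulrDl ler_wpM2r ?exprn_ge0 ?nmD.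
Qed.

Lemma pnN rho p : pn rho (- p) = pn rho p.
Proof. by rewrite /pn size_polyN; apply: eq_bigr => i _; rewrite coefN nmN. Qed.

Lemma pnB rho p q : 0 <= rho -> pn rho (p - q) <= pn rho p + pn rho q.
Proof. by move=> r0; rewrite -(pnN _ q); exact: pnD. Qed.

Lemma pnC rho p q : pn rho (p - q) = pn rho (q - p).
Proof. by rewrite -pnN opprB. Qed.

Lemma pn_sum rho I (r : seq I) (P : pred I) (F : I -> {poly C}) : 0 <= rho ->
  pn rho (\sum_(i <- r | P i) F i) <= \sum_(i <- r | P i) pn rho (F i).
Proof.
move=> r0; elim/big_rec2: _ => [|i y x _ hh]; first by rewrite pn0.
by apply: le_trans (pnD _ _ r0) _; rewrite lerD2l.
Qed.

Lemma pn_coef_le n p : \sum_(i < n) nm p`_i <= pn 1 p.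
Proof.
rewrite (@pn_widen _ _ (maxn n (size p))) ?leq_maxr//.
rewrite (big_ord_widen (maxn n (size p)) (fun i => nm p`_i)) ?leq_maxl//.
rewrite big_mkcond /=; apply: ler_sum => i _; rewrite expr1n mulr1.
by case: ifP => // _; exact: nm_ge0.
Qed.

Lemma nm_coef_le p i : nm p`_i <= pn 1 p.
Proof.
apply: le_trans (pn_coef_le i.+1 p); rewrite big_ord_recr /= lerDr.
by apply: sumr_ge0 => *; exact: nm_ge0.
Qed.

Lemma pnZ rho c p : 0 <= rho -> pn rho (c *: p) = nm c * pn rho p.
Proof.
move=> r0; rewrite (@pn_widen _ _ (size p)) ?size_scale_leq// /pn mulr_sumr.
by apply: eq_bigr => i _; rewrite coefZ nmM mulrA.
Qed.

Lemma pnMXn rho p d : pn rho (p * 'X^d) = pn rho p * rho ^+ d.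
Proof.
have [->|p0] := eqVneq p 0; first by rewrite mul0r pn0 mul0r.
rewrite /pn size_mulXn// big_split_ord /= big1 ?add0r; last first.
  by move=> i _; rewrite coefMXn ltn_ord nm0 mul0r.
rewrite mulr_suml; apply: eq_bigr => i _.
by rewrite coefMXn ltnNge leq_addr /= addKn exprD -mulrA (mulrC (rho ^+ d)).
Qed.

Lemma pnXn rho d : pn rho 'X^d = rho ^+ d.
Proof.
have := pnMXn rho (1%:P) d; rewrite mul1r => ->.
by rewrite /pn size_poly1 big_ord1 coefC eqxx nm1 expr0 !mulr1 mul1r.
Qed.

Lemma pnCst rho c : pn rho c%:P = nm c.
Proof.
have [->|c0] := eqVneq c 0; first by rewrite pn0 nm0.
by rewrite /pn size_polyC c0 big_ord1 coefC eqxx expr0 mulr1.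
Qed.

Lemma pnM rho p q : 0 <= rho -> pn rho (p * q) <= pn rho p * pn rho q.
Proof.
move=> r0; rewrite -{1}[p]coefK poly_def mulr_suml.
apply: le_trans (pn_sum _ _ _ r0) _; rewrite {2}/pn mulr_suml; apply: ler_sum => i _.
by rewrite -scalerAl pnZ// ['X^i * q]mulrC pnMXn mulrA mulrAC.
Qed.

Lemma pn_horner rho p z : nm z <= rho -> nm p.[z] <= pn rho p.
Proof.
move=> zr; rewrite horner_coef; apply: le_trans (nm_sum _ _ _) _; apply: ler_sum => i _.
by rewrite nmM nmX ler_wpM2l ?nm_ge0// lerXn2r// nnegrE ?nm_ge0// (le_trans _ zr)// nm_ge0.
Qed.

Lemma pn_mono rho rho' p : 0 <= rho -> rho <= rho' -> pn rho p <= pn rho' p.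
Proof.
move=> r0 rr; apply: ler_sum => i _; rewrite ler_wpM2l ?nm_ge0// lerXn2r// nnegrE//.
exact: le_trans rr.
Qed.

End WeightedNorm.

(** * Functions on the disc as limits of polynomials *)

Section PolynomialLimits.
Variable R : realType.
Local Notation C := (CC R).
Implicit Types (p q : nat -> {poly C}) (z a h : C) (rho eta : R) (f g : C -> C).

Definition tr (x e : R) i := (x + e) ^+ i - x ^+ i - (x ^+ i.-1 * i%:R) * e.

Lemma trS x e i : tr x e i.+1 = (x + e) * tr x e i + e ^+ 2 * (x ^+ i.-1 * i%:R).
Proof.
case: i => [|i]; rewrite /tr /=; first by rewrite !exprS !expr0; ring.
by rewrite !exprS -[i.+2%:R]natr1; ring.
Qed.

Lemma tr_ge0 x e i : 0 <= x -> 0 <= e -> 0 <= tr x e i.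
Proof.
move=> x0 e0; elim: i => [|i IH]; first by rewrite /tr !expr0 mulr0 mul0r subrr subr0.
by rewrite trS addr_ge0// mulr_ge0// ?addr_ge0// ?exprn_ge0// mulr_ge0// exprn_ge0.
Qed.

(** The complex remainder and the real remainder [tr] obey the same recursion in [i], with [h ^+ 2]
    in place of [eta ^+ 2]; this is why the quotient of the squares factors out. *)
Lemma taylorX z h eta i : 0 < eta -> nm h <= eta ->
  nm ((z + h) ^+ i - z ^+ i - (z ^+ i.-1 * i%:R) * h) <= (nm h / eta) ^+ 2 * tr (nm z) eta i.
Proof.
move=> e0 he; elim: i => [|i IH].
  have -> : (z + h) ^+ 0 - z ^+ 0 - (z ^+ 0.-1 * 0%:R) * h = 0 by rewrite /= !expr0; ring.
  by rewrite nm0 mulr_ge0 ?sqr_ge0 ?tr_ge0 ?nm_ge0// ltW.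
have -> : (z + h) ^+ i.+1 - z ^+ i.+1 - (z ^+ i.+1.-1 * i.+1%:R) * h =
  (z + h) * ((z + h) ^+ i - z ^+ i - (z ^+ i.-1 * i%:R) * h) + h ^+ 2 * (z ^+ i.-1 * i%:R).
  case: (i) => [|k] /=; first by rewrite !exprS !expr0; ring.
  by rewrite !exprS -[k.+2%:R]natr1; ring.
apply: le_trans (nmD _ _) _; rewrite nmM trS mulrDr; apply: lerD.
  rewrite mulrCA; apply: ler_pM; rewrite ?nm_ge0//.
  by apply: le_trans (nmD _ _) _; rewrite lerD2l.
rewrite nmM nmX nmM nmX nm_nat le_eqVlt; apply/orP; left; apply/eqP.
by field; rewrite gt_eqF.
Qed.

Lemma horner_deriv_sum (P : {poly C}) z :
  (deriv P).[z] = \sum_(i < size P) P`_i * (z ^+ i.-1 * i%:R).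
Proof.
rewrite -{1}[P]coefK poly_def (raddf_sum (@deriv _)) horner_sum; apply: eq_bigr => i _.
rewrite /=. by rewrite derivZ hornerZ derivXn hornerMn hornerXn mulr_natr.
Qed.

(** The bound depends on [P] only through its norm, so it passes to limits of norm-bounded
    polynomials and yields their differentiability. *)
Lemma taylor_bound (P : {poly C}) z h eta rho : 0 < eta -> nm z + eta <= rho -> nm h <= eta ->
  nm (P.[z + h] - P.[z] - (deriv P).[z] * h) <= (nm h / eta) ^+ 2 * pn rho P.
Proof.
move=> e0 zr he; rewrite horner_deriv_sum !horner_coef mulr_suml -!sumrB.
apply: le_trans (nm_sum _ _ _) _; rewrite /pn mulr_sumr; apply: ler_sum => i _.
rewrite -mulrA -!mulrBr nmM mulrCA ler_wpM2l ?nm_ge0//.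
apply: le_trans (taylorX _ _ e0 he) _; rewrite ler_wpM2l ?sqr_ge0//.
apply: (@le_trans _ _ ((nm z + eta) ^+ i)).
  have h1 := exprn_ge0 i (nm_ge0 z).
  have h2 : 0 <= nm z ^+ i.-1 * i%:R * eta.
    by apply: mulr_ge0 (ltW e0); apply: mulr_ge0 => //; rewrite exprn_ge0 ?nm_ge0.
  rewrite /tr; lra.
by apply: lerXn2r => //; rewrite nnegrE; have := nm_ge0 z; lra.
Qed.

(** Coefficientwise this is [i rho^(i-1) (rho' - rho) <= rho'^i], a consequence of [tr] being
    nonnegative. Differentiation thus costs an arbitrarily small loss of radius. *)
Lemma pn_deriv (P : {poly C}) rho rho' : 0 <= rho -> rho < rho' ->
  pn rho (deriv P) <= pn rho' P / (rho' - rho).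
Proof.
move=> r0 rr; have d0 : 0 < rho' - rho by lra.
rewrite ler_pdivlMr// (@pn_widen _ rho' _ (size P).+1)// big_ord_recl /=.
rewrite (@pn_widen _ _ _ (size P)); last first.
  by have [->|/lt_size_deriv/ltnW//] := eqVneq P 0; rewrite deriv0 size_poly0.
rewrite mulr_suml; apply: ler_wpDl; first by rewrite expr0 mulr1 nm_ge0.
apply: ler_sum => i _; rewrite coef_deriv -mulr_natr nmM nm_nat.
have := @tr_ge0 rho (rho' - rho) i.+1 r0 (ltW d0); rewrite /tr /= (_ : rho + (rho' - rho) = rho'); last by ring.
move=> h; rewrite /bump /= add1n -!mulrA ler_wpM2l ?nm_ge0//.
have := exprn_ge0 i.+1 r0; move: h; set d := rho' - rho.
by rewrite (mulrC (rho ^+ i)) -mulrA; move: (_ * (_ * d)) => X; lra.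
Qed.

Definition ncauchy rho p := forall e, 0 < e -> exists s0, forall s s',
  (s0 <= s)%N -> (s0 <= s')%N -> pn rho (p s - p s') <= e.

Lemma ncauchy_mono rho rho' p : 0 <= rho -> rho <= rho' -> ncauchy rho' p -> ncauchy rho p.
Proof.
move=> r0 rr h e /h [s0 hs]; exists s0 => s s' a b.
exact: le_trans (pn_mono _ r0 rr) (hs s s' a b).
Qed.

Lemma ncauchy_bdd rho p : 0 <= rho -> ncauchy rho p -> exists2 M, 0 < M & forall s, pn rho (p s) <= M.
Proof.
move=> r0 h; have [s0 hs] := h 1 ltr01.
exists (\sum_(i < s0) pn rho (p i) + pn rho (p s0) + 1).
  by rewrite ltr_wpDl// addr_ge0 ?pn_ge0// sumr_ge0// => i _; exact: pn_ge0.
move=> s; have [ss|ss] := ltnP s s0.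
  rewrite (bigD1 (Ordinal ss))//= -!addrA lerDl !addr_ge0 ?pn_ge0// sumr_ge0// => i _.
  exact: pn_ge0.
have := hs s s0 ss (leqnn _); have := pnD (p s - p s0) (p s0) r0; rewrite subrK.
have : 0 <= \sum_(i < s0) pn rho (p i) by apply: sumr_ge0 => i _; exact: pn_ge0.
lra.
Qed.

Lemma ncauchy_cst rho (P : {poly C}) : ncauchy rho (fun=> P).
Proof. by move=> e e0; exists 0%N => s s' _ _; rewrite subrr pn0 ltW. Qed.

Lemma ncauchyD rho p q : 0 <= rho -> ncauchy rho p -> ncauchy rho q ->
  ncauchy rho (fun s => p s + q s).
Proof.
move=> r0 h h' e e0; have e2 : 0 < e / 2 by rewrite divr_gt0.
have [s1 h1] := h _ e2; have [s2 h2] := h' _ e2; exists (maxn s1 s2) => s s'.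
rewrite !geq_max => /andP[a b] /andP[a' b']; rewrite opprD addrACA.
by apply: le_trans (pnD _ _ r0) _; have := h1 s s' a a'; have := h2 s s' b b'; lra.
Qed.

Lemma ncauchyM rho p q : 0 <= rho -> ncauchy rho p -> ncauchy rho q ->
  ncauchy rho (fun s => p s * q s).
Proof.
move=> r0 hp hq e e0.
have [M M0 hM] := ncauchy_bdd r0 hp; have [N N0 hN] := ncauchy_bdd r0 hq.
have [s1 h1] := hp (e / 2 / N) ltac:(by rewrite !divr_gt0).
have [s2 h2] := hq (e / 2 / M) ltac:(by rewrite !divr_gt0).
exists (maxn s1 s2) => s s'; rewrite !geq_max => /andP[a b] /andP[a' b'].
have -> : p s * q s - p s' * q s' = p s * (q s - q s') + (p s - p s') * q s' by ring.
apply: le_trans (pnD _ _ r0) _.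
have -> : e = M * (e / 2 / M) + (e / 2 / N) * N by field; rewrite !gt_eqF.
apply: lerD; apply: le_trans (pnM _ _ r0) _; apply: ler_pM; rewrite ?pn_ge0//.
- exact: h2.
- exact: h1.
Qed.

Lemma ncauchyN rho p : ncauchy rho p -> ncauchy rho (fun s => - p s).
Proof.
by move=> h e /h [s0 hs]; exists s0 => s s' a b; rewrite -opprD pnN; exact: hs.
Qed.

Lemma ncauchyB rho p q : 0 <= rho -> ncauchy rho p -> ncauchy rho q ->
  ncauchy rho (fun s => p s - q s).
Proof. by move=> r0 h h'; apply: ncauchyD => //; exact: ncauchyN. Qed.

Lemma ncauchy_horner rho p z : nm z <= rho -> ncauchy rho p -> exists l, slim (fun s => (p s).[z]) l.
Proof.
move=> zr h; apply: slim_exists => e /h [s0 hs]; exists s0 => s s' a b.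
rewrite -hornerN -hornerD; apply: le_trans (pn_horner _ zr) _; exact: hs.
Qed.

(** Membership in the Wiener algebra of the disc. The approximating polynomials stay part of the
    data because parity and coefficients are read off from them. *)
Definition wiener f p := ncauchy 1 p /\ forall z, nm z <= 1 -> slim (fun s => (p s).[z]) (f z).

(** The weakening of [wiener] that is stable under differentiation: summability is kept on smaller
    discs only. *)
Definition analytic f p := (forall rho, 0 < rho -> rho < 1 -> ncauchy rho p) /\
  forall z, nm z < 1 -> slim (fun s => (p s).[z]) (f z).

Lemma wiener_analytic f p : wiener f p -> analytic f p.
Proof.
case=> h1 h2; split=> [rho r0 r1|z z1]; last exact/h2/ltW.
by apply: ncauchy_mono h1; exact: ltW.
Qed.

Lemma wiener_exists p : ncauchy 1 p -> exists f, wiener f p.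
Proof.
move=> h; have [f hf] : exists f : C -> C, forall z, nm z <= 1 -> slim (fun s => (p s).[z]) (f z).
  suff /choice [f hf] : forall z, exists l, nm z <= 1 -> slim (fun s => (p s).[z]) l by exists f.
  move=> z; have [z1|z1] := leP (nm z) 1; last by exists 0.
  by have [l hl] := ncauchy_horner z1 h; exists l.
by exists f.
Qed.

Lemma wiener_unif f p : wiener f p -> forall e, 0 < e -> exists s0, forall s, (s0 <= s)%N ->
  forall z, nm z <= 1 -> nm (f z - (p s).[z]) <= e.
Proof.
case=> h1 h2 e /h1 [s0 hs]; exists s0 => s ss z z1.
apply: (slim_nm_le_ev (slimB (h2 z z1) (slim_cst (p s).[z]))).
exists s0 => s' ss'; rewrite -hornerN -hornerD; apply: le_trans (pn_horner _ z1) _; exact: hs.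
Qed.

Lemma poly_cdiff (P : {poly C}) z : cdiff (horner P) z (deriv P).[z].
Proof.
move=> e e0; have N0 : 0 <= pn (nm z + 1) P by apply: pn_ge0; rewrite addr_ge0 ?nm_ge0.
exists (Num.min 1 (e / (pn (nm z + 1) P + 1))).
  by rewrite lt_min ltr01 divr_gt0// ltr_wpDl.
move=> y; rewrite lt_min => /andP[y1]; rewrite ltr_pdivlMr ?ltr_wpDl// => y2.
have := @taylor_bound P z (y - z) 1 (nm z + 1) ltr01 (lexx _) (ltW y1).
rewrite (_ : z + (y - z) = y); last by ring.
move=> h; apply: le_trans h _; rewrite divr1 expr2 -mulrA mulrC.
rewrite ler_wpM2r ?nm_ge0//; have := nm_ge0 (y - z); lra.
Qed.

Lemma wiener_cont f p : wiener f p -> cont_on [set z | nm z <= 1] f.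
Proof.
move=> h z z1 e e0; have [s0 hs] := wiener_unif h (ltac:(by rewrite divr_gt0) : 0 < e / 3).
have [d d0 hd] := cdiff_cont (poly_cdiff (p s0) z) (ltac:(by rewrite divr_gt0) : 0 < e / 3).
exists d => // y y1 yz; have a := hs s0 (leqnn _) y y1; have b := hs s0 (leqnn _) z z1.
have -> : f y - f z = (f y - (p s0).[y]) + ((p s0).[y] - (p s0).[z]) - (f z - (p s0).[z]).
  by ring.
apply: le_trans (nmB _ _) _; have := nmD (f y - (p s0).[y]) ((p s0).[y] - (p s0).[z]).
by have := hd y yz; lra.
Qed.

(** By [pn_deriv] the derivatives form a Cauchy sequence at every radius below 1, and [taylor_bound]
    passes to the limit in the difference quotients. *)
Lemma analytic_cdiff f p : analytic f p -> exists g,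
  analytic g (fun s => deriv (p s)) /\ forall z, nm z < 1 -> cdiff f z (g z).
Proof.
case=> h1 h2.
have hder rho : 0 < rho -> rho < 1 -> ncauchy rho (fun s => deriv (p s)).
  move=> r0 r1; pose rho' := (rho + 1) / 2.
  have rr : rho < rho' by rewrite /rho'; lra.
  have rr1 : rho' < 1 by rewrite /rho'; lra.
  have d0 : 0 < rho' - rho by lra.
  move=> e e0; have [s0 hs] := h1 rho' (lt_trans r0 rr) rr1 (e * (rho' - rho)) (mulr_gt0 e0 d0).
  exists s0 => s s' a b; rewrite -derivB; apply: le_trans (pn_deriv _ (ltW r0) rr) _.
  by rewrite ler_pdivrMr//; exact: hs.
have [g hg] : exists g : C -> C, forall z, nm z < 1 -> slim (fun s => (deriv (p s)).[z]) (g z).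
  suff /choice [g hg] : forall z, exists l, nm z < 1 -> slim (fun s => (deriv (p s)).[z]) l by exists g.
  move=> z; have [z1|z1] := ltP (nm z) 1; last by exists 0.
  have rr : nm z <= (nm z + 1) / 2 by lra.
  have [||l hl] := ncauchy_horner rr (hder _ _ _); last by exists l.
    by have := nm_ge0 z; lra.
  by lra.
exists g; split => // z z1 e e0.
pose eta := (1 - nm z) / 2; have eta0 : 0 < eta by rewrite /eta; lra.
pose rho := nm z + eta; have r1 : rho < 1 by rewrite /rho /eta; lra.
have r0 : 0 < rho by rewrite /rho; have := nm_ge0 z; lra.
have [M M0 hM] := ncauchy_bdd (ltW r0) (h1 rho r0 r1).
exists (Num.min eta (e * eta ^+ 2 / M)).
  by rewrite lt_min eta0 divr_gt0// mulr_gt0// exprn_gt0.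
move=> y; rewrite lt_min => /andP[y1 y2].
have yin : nm y < 1.
  by have := nmD (y - z) z; rewrite subrK; move: r1; rewrite /rho; lra.
have lim := slimB (slimB (h2 y yin) (h2 z z1)) (slimM (hg z z1) (slim_cst (y - z))).
apply: (slim_nm_le lim) => s.
have := @taylor_bound (p s) z (y - z) eta rho eta0 (lexx _) (ltW y1).
rewrite (_ : z + (y - z) = y); last by ring.
move=> h; apply: le_trans h _.
apply: (@le_trans _ _ ((nm (y - z) / eta) ^+ 2 * M)); first by rewrite ler_wpM2l ?sqr_ge0.
move: y2; rewrite ltr_pdivlMr// => y2.
have -> : (nm (y - z) / eta) ^+ 2 * M = nm (y - z) * M / eta ^+ 2 * nm (y - z).
  by field; rewrite gt_eqF.
rewrite ler_wpM2r ?nm_ge0// ler_pdivrMr ?exprn_gt0//; exact: ltW.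
Qed.

Lemma wiener_cdiff f p z : wiener f p -> nm z < 1 -> exists l, cdiff f z l.
Proof. by move=> /wiener_analytic /analytic_cdiff [g [_ h]] /h; exists (g z). Qed.

Lemma wienerB f g p q : wiener f p -> wiener g q -> wiener (fun z => f z - g z) (fun s => p s - q s).
Proof.
move=> [h1 h2] [h3 h4]; split; first exact: ncauchyB.
by move=> z z1; apply: eq_slim (slimB (h2 z z1) (h4 z z1)) => s; rewrite hornerD hornerN.
Qed.

Lemma wienerM f g p q : wiener f p -> wiener g q -> wiener (fun z => f z * g z) (fun s => p s * q s).
Proof.
move=> [h1 h2] [h3 h4]; split; first exact: ncauchyM.
by move=> z z1; apply: eq_slim (slimM (h2 z z1) (h4 z z1)) => s; rewrite hornerM.
Qed.

Lemma wiener_poly (P : {poly C}) : wiener (horner P) (fun=> P).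
Proof. by split=> [|z _]; [exact: ncauchy_cst|exact: slim_cst]. Qed.

Definition dv a (P : {poly C}) : {poly C} := (P - P.[a]%:P) %/ ('X - a%:P).

Lemma dvP a (P : {poly C}) : ('X - a%:P) * dv a P = P - P.[a]%:P.
Proof.
rewrite mulrC /dv divpK// dvdp_XsubCl /root hornerD hornerN hornerC subrr//.
Qed.

Lemma dv_inj a (P Q : {poly C}) : ('X - a%:P) * P = ('X - a%:P) * Q -> P = Q.
Proof. by apply: mulfI; rewrite polyXsubC_eq0. Qed.

Lemma dvB a (P Q : {poly C}) : dv a (P - Q) = dv a P - dv a Q.
Proof.
by apply: (@dv_inj a); rewrite mulrBr !dvP hornerD hornerN raddfB /= opprD addrACA -opprD.
Qed.

(** The divided difference of ['X^i] at [a] is a sum of [a^j 'X^(i-1-j)], whose norm is at most the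
    geometric series [1 / (1 - |a|)]. *)
Lemma pn_dv a (P : {poly C}) : nm a < 1 -> pn 1 (dv a P) <= pn 1 P / (1 - nm a).
Proof.
move=> a1; have d0 : 0 < 1 - nm a by lra.
have -> : dv a P = \sum_(i < size P) P`_i *: \sum_(j < i) a ^+ j *: 'X^(i.-1 - j).
  apply: (@dv_inj a); rewrite dvP mulr_sumr -{1}[P]coefK poly_def horner_coef.
  rewrite rmorph_sum -sumrB /=; apply: eq_bigr => i _.
  rewrite -scalerAr polyCM -mul_polyC -mulrBr mul_polyC; congr (_ *: _).
  rewrite rmorphXn /= subrXX; congr (_ * _); apply: eq_bigr => j _.
  by rewrite -rmorphXn /= mulrC mul_polyC.
apply: le_trans (pn_sum _ _ _ ler01) _; rewrite [pn 1 P]/pn mulr_suml; apply: ler_sum => i _.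
rewrite pnZ// expr1n mulr1 ler_wpM2l ?nm_ge0//.
apply: le_trans (pn_sum _ _ _ ler01) _.
apply: (@le_trans _ _ (\sum_(j < i) nm a ^+ j)).
  by apply: ler_sum => j _; rewrite pnZ// pnXn expr1n mulr1 nmX.
rewrite -div1r ler_pdivlMr//; have := subrX1 (nm a) i.
by have := exprn_ge0 i (nm_ge0 a); set S := \sum_(_ < _) _; lra.
Qed.

(** A zero inside the disc can be divided out without leaving the algebra, since [dv a] is bounded
    for the l^1 norm; on the limit the subtracted constant is [f a = 0]. *)
Lemma wiener_div f p a : wiener f p -> nm a < 1 -> f a = 0 -> exists g,
  wiener g (fun s => dv a (p s)) /\ forall z, nm z <= 1 -> f z = (z - a) * g z.
Proof.
move=> [h1 h2] a1 fa; have d0 : 0 < 1 - nm a by lra.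
have hc : ncauchy 1 (fun s => dv a (p s)).
  move=> e e0; have [s0 hs] := h1 (e * (1 - nm a)) (mulr_gt0 e0 d0).
  exists s0 => s s' u v; rewrite -dvB; apply: le_trans (pn_dv _ a1) _.
  by rewrite ler_pdivrMr//; exact: hs.
have [g hg] := wiener_exists hc; exists g; split => // z z1.
have L1 := slimB (h2 z z1) (h2 a (ltW a1)); rewrite fa subr0 in L1.
apply: (slim_uniq L1); apply: eq_slim (slimZ (z - a) (hg.2 z z1)) => s.
have := congr1 (horner^~ z) (dvP a (p s)).
by rewrite /= hornerM hornerXsubC hornerD hornerN hornerC.
Qed.

(** Each coefficient is dominated by the norm, hence converges; the partial sums of the limit series
    then approximate [f] just as well. This replaces arbitrary approximants by a true power
    series. *)
Lemma wiener_coef f p : wiener f p -> exists k : nat -> C,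
  (forall l, slim (fun s => (p s)`_l) (k l)) /\ wiener f (fun L => \poly_(l < L) k l).
Proof.
move=> [h1 h2].
have /choice [k hk] : forall l, exists c, slim (fun s => (p s)`_l) c.
  move=> l; apply: slim_exists => e /h1 [s0 hs]; exists s0 => s s' a b.
  by rewrite -coefB; apply: le_trans (nm_coef_le _ _) _; exact: hs.
exists k; split => //; pose P L := \poly_(l < L) k l.
have tl e : 0 < e -> exists s0, forall s L, (s0 <= s)%N -> (size (p s) <= L)%N ->
    pn 1 (P L - p s) <= e.
  move=> /h1 [s0 hs]; exists s0 => s L ss sL.
  have sz : (size (P L - p s)%R <= L)%N.
    by rewrite (leq_trans (size_polyD _ _))// size_polyN geq_max size_poly.
  rewrite (pn_widen _ sz).
  have lim : forall l, slim (fun s' => (p s')`_l - (p s)`_l) (k l - (p s)`_l).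
    by move=> l; apply: slimB => //; exact: slim_cst.
  pose U s' := \sum_(i < L) nm ((p s')`_i - (p s)`_i).
  have U1 : forall s', (s0 <= s')%N -> U s' <= e.
    move=> s' ss'; apply: le_trans (hs s' s ss' ss); apply: le_trans (pn_coef_le L _).
    by apply: ler_sum => i _; rewrite coefB.
  apply/ler_addgt0Pr => d d0.
  have dL : 0 < d / L.+1%:R by rewrite divr_gt0.
  (* Only finitely many coefficients are involved, so their convergence is uniform; the share
     [d / L.+1] keeps the total error within [d], also for [L = 0]. *)
  have : forall m, exists s1, forall s', (s1 <= s')%N -> forall i, (i < m)%N ->
      nm (k i - (p s')`_i) <= d / L.+1%:R.
    elim=> [|m [s1 IH]]; first by exists 0%N.
    have [s2 h3] := hk m _ dL; exists (maxn s1 s2) => s'.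
    rewrite geq_max => /andP[a b] i; rewrite ltnS leq_eqVlt => /predU1P[->|im]; first exact: h3.
    exact: IH.
  move=> /(_ L).
  case=> s1 hs1; pose s' := maxn s0 s1.
  have := U1 s' (leq_maxl _ _) => U2; apply: (@le_trans _ _ (U s' + d)); last by rewrite lerD2r.
  apply: (@le_trans _ _ (U s' + \sum_(i < L) d / L.+1%:R)); last first.
    rewrite lerD2l sumr_const card_ord -[_ *+ L]mulr_natr mulrAC ler_pdivrMr// ler_pM2l// ler_nat.
    exact: leqnSn.
  rewrite /U -big_split /=; apply: ler_sum => i _.
  rewrite expr1n mulr1 coefB coef_poly ltn_ord.
  apply: le_trans (nm_tri _ (p s')`_i _) _; rewrite [leLHS]addrC lerD2l.
  by apply: hs1 => //; exact: leq_maxr.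
split.
- move=> e e0; have [s0 hs] := tl (e / 2) ltac:(by rewrite divr_gt0).
  exists (size (p s0)) => L L' a b.
  have -> : P L - P L' = (P L - p s0) - (P L' - p s0) by ring.
  apply: le_trans (pnB _ _ ler01) _; have := hs s0 L (leqnn _) a.
  by have := hs s0 L' (leqnn _) b; lra.
- move=> z z1 e e0; have e2 : 0 < e / 2 by rewrite divr_gt0.
  have [s0 hs] := tl _ e2; have [s1 hs1] := h2 z z1 _ e2; pose s := maxn s0 s1.
  exists (size (p s)) => L sL; apply: le_trans (nm_tri _ (p s).[z] _) _.
  have -> : e = e / 2 + e / 2 by field.
  apply: lerD; first exact: hs1 (leq_maxr _ _).
  rewrite nmC -hornerN -hornerD; apply: le_trans (pn_horner _ z1) _.
  exact: hs (leq_maxl _ _) sL.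
Qed.

End PolynomialLimits.

(** * One-sided recursions *)

Section OneSidedRecursion.
Variable R : realType.
Local Notation C := (CC R).
Local Notation vec := ('I_2 -> {poly C}).
Variables (c : 'I_2) (d : 'I_2 -> nat) (M : nat -> 'I_2 -> 'I_2 -> {poly C}) (tau : nat -> R).
Hypothesis dc : d c = 0%N.
Hypothesis tau_ge0 : forall k, 0 <= tau k.
Hypothesis tau_lim : forall e, 0 < e -> exists k0, forall k, (k0 <= k)%N -> tau k <= e.
Hypothesis Mtau : forall k, \sum_i \sum_j pn 1 (M k i j) <= tau k - tau k.+1.

Let vn (v : vec) : R := \sum_i pn 1 (v i).

(** One step back from level [k.+1] to level [k]. The perturbations are summable in the form [Mtau]:
    [tau k] majorizes the tail of their norms, so sums over levels telescope. *)
Definition rstep k (v : vec) : vec := fun i => 'X^(d i) * v i + \sum_j M k i j * v j.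

Fixpoint rsteps k s (v : vec) : vec := if s is s'.+1 then rstep k (rsteps k.+1 s' v) else v.

Definition unitv : vec := fun i => ((i == c)%:R)%:P.

Definition jpoly k s : vec := rsteps k s unitv.

Lemma vn_ge0 v : 0 <= vn v.
Proof. by apply: sumr_ge0 => i _; exact: pn_ge0. Qed.

Lemma vn_comp v i : pn 1 (v i) <= vn v.
Proof. by rewrite /vn (bigD1 i)//= lerDl sumr_ge0// => j _; exact: pn_ge0. Qed.

Lemma vn_D (v w : vec) : vn (fun i => v i + w i) <= vn v + vn w.
Proof. by rewrite /vn -big_split /=; apply: ler_sum => i _; exact: pnD. Qed.

Lemma vn_X (v : vec) : vn (fun i => 'X^(d i) * v i) = vn v.
Proof. by apply: eq_bigr => i _; rewrite mulrC pnMXn expr1n mulr1. Qed.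

Lemma vn_M k (v : vec) : vn (fun i => \sum_j M k i j * v j) <= (tau k - tau k.+1) * vn v.
Proof.
apply: (@le_trans _ _ ((\sum_i \sum_j pn 1 (M k i j)) * vn v)); last first.
  by rewrite ler_wpM2r ?vn_ge0.
rewrite mulr_suml; apply: ler_sum => i _; rewrite mulr_suml.
apply: le_trans (pn_sum _ _ _ ler01) _; apply: ler_sum => j _.
apply: le_trans (pnM _ _ ler01) _; rewrite ler_wpM2l ?pn_ge0//; exact: vn_comp.
Qed.

Lemma tau_decr k : tau k.+1 <= tau k.
Proof.
rewrite -subr_ge0; apply: le_trans (Mtau k).
by apply: sumr_ge0 => i _; apply: sumr_ge0 => j _; exact: pn_ge0.
Qed.

Lemma tau_le0 k : tau k <= tau 0%N.
Proof. by elim: k => // k IH; exact: le_trans (tau_decr k) IH. Qed.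

Lemma vn_step k v : vn (rstep k v) <= (1 + (tau k - tau k.+1)) * vn v.
Proof. by apply: le_trans (vn_D _ _) _; rewrite vn_X mulrDl mul1r lerD2l vn_M. Qed.

Lemma expR_step k : (1 + (tau k - tau k.+1)) * expR (tau k.+1) <= expR (tau k).
Proof.
have -> : expR (tau k) = expR (tau k - tau k.+1) * expR (tau k.+1).
  by rewrite -expRD subrK.
by rewrite ler_wpM2r ?expR_ge0// expR_ge1Dx.
Qed.

(** A discrete Gronwall bound: the diagonal part preserves the norm, and [1 + x <= expR x] turns the
    product of the step factors into [expR] of a telescoping sum. *)
Lemma vn_steps k s v : vn (rsteps k s v) <= expR (tau k) * vn v.
Proof.
elim: s k => [|s IH] k /=.
  by rewrite ler_peMl ?vn_ge0// -expR0 ler_expR.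
apply: le_trans (vn_step _ _) _.
apply: (@le_trans _ _ ((1 + (tau k - tau k.+1)) * (expR (tau k.+1) * vn v))).
  by rewrite ler_wpM2l// ler_wpDr// subr_ge0 tau_decr.
by rewrite mulrA ler_wpM2r ?vn_ge0// expR_step.
Qed.

Lemma rstepB k (v w : vec) : rstep k (fun i => v i - w i) = (fun i => rstep k v i - rstep k w i).
Proof.
apply/funext => i; rewrite /rstep mulrBr opprD addrACA; congr (_ + _).
by rewrite -sumrB; apply: eq_bigr => j _; rewrite mulrBr.
Qed.

Lemma rstepsB k s (v w : vec) :
  rsteps k s (fun i => v i - w i) = (fun i => rsteps k s v i - rsteps k s w i).
Proof. by elim: s k => //= s IH k; rewrite IH rstepB. Qed.

Lemma rsteps_cat k s s' v : rsteps k (s + s') v = rsteps k s (rsteps (k + s) s' v).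
Proof.
elim: s k => [|s IH] k; first by rewrite addn0.
by rewrite addSn /= IH addSnnS.
Qed.

Lemma vn_unit : vn unitv = 1.
Proof.
rewrite /vn (bigD1 c)//= /unitv eqxx pnCst nm1 big1 ?addr0// => i /negPf ->.
by rewrite pnCst nm0.
Qed.

Let E := expR (tau 0%N).

(** Since [d c = 0], the diagonal part fixes the unit vector at [c]; the deviation from it therefore
    collects only the contributions of [M]. *)
Lemma jpoly_unit k s : vn (fun i => jpoly k s i - unitv i) <= E * tau k.
Proof.
elim: s k => [|s IH] k.
  rewrite /jpoly /= /vn big1 ?mulr_ge0 ?expR_ge0// => i _.
  by rewrite subrr pn0.
rewrite /jpoly /=; set w := rsteps _ _ _.
have -> : (fun i => rstep k w i - unitv i) =
    (fun i => 'X^(d i) * (w i - unitv i) + \sum_j M k i j * w j).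
  apply/funext => i; rewrite /rstep mulrBr -!addrA; congr (_ + _); rewrite addrC; congr (_ + _).
  rewrite /unitv; case: (eqVneq i c) => [->|_]; last by rewrite mulr0.
  by rewrite dc expr0 mul1r.
apply: le_trans (vn_D _ _) _.
have -> : E * tau k = E * tau k.+1 + (tau k - tau k.+1) * E by ring.
rewrite (vn_X (fun i => w i - unitv i)); apply: lerD; first exact: IH.
apply: le_trans (vn_M _ _) _; rewrite ler_wpM2l ?subr_ge0 ?tau_decr//.
apply: le_trans (vn_steps _ _ _) _; rewrite vn_unit mulr1 ler_expR; exact: tau_le0.
Qed.

(** By linearity the two iterates differ by the propagation of a deviation born at level [k + s]:
    one factor [E] for its size, the other for its propagation. *)
Lemma jpoly_diff k s s' i : pn 1 (jpoly k (s + s') i - jpoly k s i) <= E * E * tau (k + s).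
Proof.
rewrite /jpoly rsteps_cat.
apply: le_trans (vn_comp (fun i => rsteps k s (rsteps (k + s) s' unitv) i - rsteps k s unitv i) i) _.
rewrite -(rstepsB k s _ unitv); apply: le_trans (vn_steps _ _ _) _.
rewrite -mulrA; apply: ler_pM; rewrite ?expR_ge0 ?vn_ge0 ?ler_expR ?tau_le0//.
exact: jpoly_unit.
Qed.

Lemma jpoly_cauchy k i : ncauchy 1 (fun s => jpoly k s i).
Proof.
move=> e e0; have E0 : 0 < E by exact: expR_gt0.
have [k0 hk] := tau_lim (ltac:(by rewrite !divr_gt0) : 0 < e / E / E).
have wl s s' : (k0 <= s)%N -> (s <= s')%N -> pn 1 (jpoly k s' i - jpoly k s i) <= e.
  move=> a b; rewrite -(subnKC b); apply: le_trans (jpoly_diff _ _ _ _) _.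
  have := hk (k + s)%N (leq_trans a (leq_addl _ _)).
  by rewrite !ler_pdivlMr// => h; rewrite mulrC mulrA.
exists k0 => s s' a b; have [ss|/ltnW ss] := leqP s s'; last exact: wl.
by rewrite pnC; exact: wl.
Qed.

Definition jsol k i : C -> C := projT1 (cid (wiener_exists (jpoly_cauchy k i))).

Lemma jsol_wiener k i : wiener (jsol k i) (fun s => jpoly k s i).
Proof. exact: (projT2 (cid (wiener_exists (jpoly_cauchy k i)))). Qed.

Definition zstep k z (v : 'I_2 -> C) i := z ^+ d i * v i + \sum_j (M k i j).[z] * v j.

Lemma jsol_rec k i z : nm z <= 1 -> jsol k i z = zstep k z (fun j => jsol k.+1 j z) i.
Proof.
move=> z1; apply: (slim_uniq (slim_shift 1 ((jsol_wiener k i).2 z z1))).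
apply: (@eq_slim _ (fun s => z ^+ d i * (jpoly k.+1 s i).[z] +
  \sum_(j < 2) (M k i j).[z] * (jpoly k.+1 s j).[z])).
  move=> s; rewrite addn1 /jpoly /= /rstep hornerD hornerM hornerXn horner_sum.
  by congr (_ + _); apply: eq_bigr => j _; rewrite hornerM.
apply: slimD; first by apply: slimZ; exact: (jsol_wiener k.+1 i).2.
pose u (j s : nat) := (M k i (inord j)).[z] * (jpoly k.+1 s (inord j)).[z].
pose l (j : nat) := (M k i (inord j)).[z] * jsol k.+1 (inord j) z.
have h : slim (fun s => \sum_(j < 2) u j s) (\sum_(j < 2) l j).
  by apply: slim_sum => j _; apply: slimZ; exact: (jsol_wiener k.+1 _).2.
rewrite (eq_bigr (fun j : 'I_2 => l j)); last by move=> j _; rewrite /l inord_val.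
by apply: eq_slim h => s; apply: eq_bigr => j _; rewrite /u inord_val.
Qed.

Lemma jsol_unit k i z : nm z <= 1 -> nm (jsol k i z - (i == c)%:R) <= E * tau k.
Proof.
move=> z1; apply: (slim_nm_le (slimB ((jsol_wiener k i).2 z z1) (slim_cst (i == c)%:R))) => s.
have := le_trans (vn_comp (fun i => jpoly k s i - unitv i) i) (jpoly_unit k s).
by apply: le_trans; have := pn_horner (jpoly k s i - unitv i) z1; rewrite hornerD hornerN hornerC.
Qed.

Lemma E_lim e : 0 < e -> exists k0, forall k, (k0 <= k)%N -> E * tau k <= e.
Proof.
move=> e0; have E0 : 0 < E by exact: expR_gt0.
have [k0 hk] := tau_lim (ltac:(by rewrite !divr_gt0) : 0 < e / E).
by exists k0 => k /hk; rewrite ler_pdivlMr// mulrC.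
Qed.

Lemma jsol_lim i z : nm z <= 1 -> slim (fun k => jsol k i z) (i == c)%:R.
Proof.
move=> z1 e /E_lim [k0 hk]; exists k0 => k /hk; apply: le_trans.
by rewrite nmC; exact: jsol_unit.
Qed.

Let sn (v : 'I_2 -> C) : R := \sum_i nm (v i).

Lemma sn_step k z v : nm z <= 1 -> sn (zstep k z v) <= (1 + (tau k - tau k.+1)) * sn v.
Proof.
move=> z1; have s0 u : 0 <= sn u by apply: sumr_ge0 => i _; exact: nm_ge0.
have sc u i : nm (u i) <= sn u.
  by rewrite /sn (bigD1 i)//= lerDl sumr_ge0// => j _; exact: nm_ge0.
apply: (@le_trans _ _ (\sum_i (nm (v i) + (\sum_j pn 1 (M k i j)) * sn v))).
  apply: ler_sum => i _; apply: le_trans (nmD _ _) _; apply: lerD.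
    by rewrite nmM nmX ler_piMl ?nm_ge0// exprn_ile1 ?nm_ge0.
  apply: le_trans (nm_sum _ _ _) _; rewrite mulr_suml; apply: ler_sum => j _.
  by rewrite nmM ler_pM ?nm_ge0 ?pn_horner.
by rewrite big_split /= -mulr_suml mulrDl mul1r lerD2l ler_wpM2r.
Qed.

(** The difference of two solutions solves the same linear recursion and tends to 0, while going
    back from level [k + s] to [k] enlarges it at most by [expR (tau k)]. *)
Lemma jsol_unique (v : nat -> 'I_2 -> C) z : nm z <= 1 ->
  (forall k i, v k i = zstep k z (v k.+1) i) ->
  (forall i, slim (fun k => v k i) (i == c)%:R) -> forall k i, v k i = jsol k i z.
Proof.
move=> z1 vrec vlim k0 i0; pose w k i := v k i - jsol k i z.
have wrec k : w k = zstep k z (w k.+1).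
  apply/funext => i; rewrite /w vrec jsol_rec// /zstep mulrBr opprD addrACA; congr (_ + _).
  by rewrite -sumrB; apply: eq_bigr => j _; rewrite mulrBr.
have s0 u : 0 <= sn u by apply: sumr_ge0 => i _; exact: nm_ge0.
have bd k s : sn (w k) <= expR (tau k) * sn (w (k + s)%N).
  elim: s k => [|s IH] k.
    by rewrite addn0 ler_peMl// -expR0 ler_expR.
  rewrite wrec; apply: le_trans (sn_step _ _ z1) _.
  apply: (@le_trans _ _ ((1 + (tau k - tau k.+1)) * (expR (tau k.+1) * sn (w (k.+1 + s)%N)))).
    by rewrite ler_wpM2l// ler_wpDr// subr_ge0 tau_decr.
  by rewrite mulrA addSnnS ler_wpM2r// expR_step.
apply/eqP; rewrite -subr_eq0; apply/eqP; apply: nm_le_eq0 => e e0.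
apply: (@le_trans _ _ (sn (w k0))).
  by rewrite /sn (bigD1 i0)//= lerDl sumr_ge0// => j _; exact: nm_ge0.
pose F := expR (tau k0); have F0 : 0 < F by exact: expR_gt0.
have e2 : 0 < e / F / 2 by rewrite !divr_gt0.
have wl i : slim (fun k => w k i) 0.
  by rewrite -(subrr ((i == c)%:R)); apply: slimB; [exact: vlim|exact: jsol_lim].
have [s1 h1] := wl ord0 _ e2; have [s2 h2] := wl ord_max _ e2.
apply: le_trans (bd k0 (maxn s1 s2)) _; rewrite mulrC -ler_pdivlMr//.
have -> : e / F = e / F / 2 + e / F / 2 by field; rewrite gt_eqF.
rewrite /sn big_ord_recl big_ord1 (_ : lift ord0 ord0 = ord_max); last exact: val_inj.
have a1 : (s1 <= k0 + maxn s1 s2)%N by rewrite (leq_trans (leq_maxl s1 s2)) ?leq_addl.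
have a2 : (s2 <= k0 + maxn s1 s2)%N by rewrite (leq_trans (leq_maxr s1 s2)) ?leq_addl.
have := h1 _ a1; have := h2 _ a2; rewrite !sub0r !nmN => b1 b2.
exact: lerD.
Qed.

Definition evenp (P : {poly C}) := forall l, odd l -> P`_l = 0.

Lemma evenpM P Q : evenp P -> evenp Q -> evenp (P * Q).
Proof.
move=> hP hQ l lo; rewrite coefM big1// => i _.
have [oi|oi] := boolP (odd i); first by rewrite hP// mul0r.
by rewrite hQ ?mulr0// oddB ?lo ?(negPf oi)// -ltnS.
Qed.

Lemma evenpD P Q : evenp P -> evenp Q -> evenp (P + Q).
Proof. by move=> hP hQ l lo; rewrite coefD hP// hQ// addr0. Qed.

Hypothesis dM_even : forall i, ~~ odd (d i).
Hypothesis M_even : forall k i j, evenp (M k i j).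

Lemma jpoly_even k s i : evenp (jpoly k s i).
Proof.
elim: s k i => [|s IH] k i.
  by move=> l lo; rewrite /jpoly /= /unitv coefC; case: l lo.
rewrite /jpoly /=; apply: evenpD.
  apply: evenpM; last exact: IH.
  by move=> l lo; rewrite coefXn; case: eqP lo (dM_even i) => // ->  ->.
move=> l lo; rewrite coef_sum big1// => j _; exact: (evenpM (M_even k i j) (IH k.+1 j) lo).
Qed.

End OneSidedRecursion.

(** * Derivatives and integrals of monomials *)

Section GeneralizedBinomial.
Variable R : realType.
Local Notation C := (CC R).
Implicit Types (x y p : int) (k : nat) (a : C).

Definition ffz p k : C := \prod_(i < k) (p%:~R - i%:R).
Definition gb p k : C := ffz p k / k`!%:R.

Lemma ffzS p k : ffz p k.+1 = ffz p k * (p%:~R - k%:R).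
Proof. by rewrite /ffz big_ord_recr. Qed.

Lemma ffz_shift p k : ffz (p + 1) k.+1 = (p%:~R + 1) * ffz p k.
Proof.
rewrite /ffz big_ord_recl subr0 intrD; congr (_ * _); apply: eq_bigr => i _.
by rewrite /= /bump /= natrD; ring.
Qed.

Lemma fact_neq0 k : k`!%:R != 0 :> C.
Proof. by rewrite pnatr_eq0 -lt0n fact_gt0. Qed.

Lemma gb0 p : gb p 0 = 1.
Proof. by rewrite /gb /ffz big_ord0 fact0 divr1. Qed.

Lemma gb0S k : gb 0 k.+1 = 0.
Proof. by rewrite /gb /ffz big_ord_recl subrr !mul0r. Qed.

Lemma gb_pascal p k : gb (p + 1) k.+1 = gb p k.+1 + gb p k.
Proof.
rewrite /gb ffz_shift ffzS factS natrM -natr1.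
have k1 : k%:R + 1 != 0 :> C by rewrite natr1 pnatr_eq0.
by field; rewrite k1 fact_neq0.
Qed.

(** Both sides satisfy Pascal's rule in [x], which propagates the identity from 0 to all integers:
    [up] directly, [down] by an inner induction on the order [k]. *)
Lemma vandermonde x y k : gb (x + y) k = \sum_(i < k.+1) gb x i * gb y (k - i).
Proof.
have S x' k' : \sum_(i < k'.+2) gb (x' + 1) i * gb y (k'.+1 - i) =
    \sum_(i < k'.+2) gb x' i * gb y (k'.+1 - i) + \sum_(i < k'.+1) gb x' i * gb y (k' - i).
  rewrite big_ord_recl [X in _ = X + _]big_ord_recl !gb0 -addrA; congr (_ + _).
  rewrite -big_split /=; apply: eq_bigr => i _.
  by rewrite /bump /= add1n subSS gb_pascal mulrDl.
have up x' : (forall k, gb (x' + y) k = \sum_(i < k.+1) gb x' i * gb y (k - i)) ->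
    forall k, gb (x' + 1 + y) k = \sum_(i < k.+1) gb (x' + 1) i * gb y (k - i).
  move=> h [|k']; first by rewrite big_ord1 !gb0 mul1r.
  by rewrite S -!h addrAC gb_pascal.
have down x' : (forall k, gb (x' + 1 + y) k = \sum_(i < k.+1) gb (x' + 1) i * gb y (k - i)) ->
    forall k, gb (x' + y) k = \sum_(i < k.+1) gb x' i * gb y (k - i).
  move=> h; elim=> [|k' IH]; first by rewrite big_ord1 !gb0 mul1r.
  have := h k'.+1; rewrite S -IH addrAC gb_pascal => /eqP.
  by rewrite (inj_eq (addIr _)) => /eqP.
have e1 n : Posz n.+1 = n%:Z + 1 by rewrite intS addrC.
move: k; case: x => n.
  elim: n => [|n IH]; last by rewrite e1; exact: (up _ IH).
  move=> k; rewrite add0r big_ord_recl gb0 mul1r subn0 big1 ?addr0// => i _.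
  by rewrite gb0S mul0r.
rewrite NegzE; elim: n => [|n IH].
  apply: down; move=> k; rewrite addNr add0r big_ord_recl gb0 mul1r subn0 big1 ?addr0// => i _.
  by rewrite gb0S mul0r.
by apply: down; rewrite (_ : - n.+2%:Z + 1 = - n.+1%:Z)//; rewrite -[n.+2]addn1 PoszD; ring.
Qed.

(* The coefficient of [(z - a)^k] in the expansion of [z^p] at [a]. *)
Definition ez a p k : C := gb p k * a ^ (p - k%:Z).

Lemma ez0 a p : ez a p 0 = a ^ p.
Proof. by rewrite /ez gb0 mul1r subr0. Qed.

Lemma ez0S a k : ez a 0 k.+1 = 0.
Proof. by rewrite /ez gb0S mul0r. Qed.

Lemma ez_pascal a p k : a != 0 -> ez a (p + 1) k.+1 = a * ez a p k.+1 + ez a p k.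
Proof.
move=> a0; rewrite /ez gb_pascal mulrDl -addn1 PoszD.
have -> : p + 1 - (k%:Z + 1) = p - k%:Z by ring.
have -> : p - k%:Z = 1 + (p - (k%:Z + 1)) by ring.
rewrite expfzDr// expr1z; ring.
Qed.

Lemma ez_vandermonde a x y k : a != 0 ->
  ez a (x + y) k = \sum_(i < k.+1) ez a x i * ez a y (k - i).
Proof.
move=> a0; rewrite /ez vandermonde mulr_suml; apply: eq_bigr => i _.
rewrite [RHS]mulrACA -expfzDr//; congr (_ * _ ^ _).
have ik : (i <= k)%N by rewrite -ltnS.
by rewrite -[in LHS](subnK ik) PoszD; ring.
Qed.

(** Compares residues at opposite poles: for odd [p] the right-hand side is [ez a p k], so the two
    poles contribute equally. *)
Lemma ez_parity a p k : ez (- a) p k * (-1) ^+ k.+1 = - (-1) ^ p * ez a p k.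
Proof.
rewrite /ez -[- a]mulN1r expfzMl.
have -> : (-1) ^ (p - k%:Z) = (-1) ^ p * (-1) ^+ k :> C.
  rewrite expfzDr ?oppr_eq0 ?oner_eq0//; congr (_ * _).
  by rewrite -exprnN -exprVn invrN1.
have h : (-1) ^+ k * (-1) ^+ k = 1 :> C by rewrite -expr2 sqrr_sign.
rewrite exprS; transitivity (- (-1) ^ p * gb p k * a ^ (p - k%:Z) * ((-1) ^+ k * (-1) ^+ k)).
  by ring.
by rewrite h; ring.
Qed.

End GeneralizedBinomial.

(** * Termwise derivatives in the disc variable *)

Section TermwiseDerivative.
Variable R : realType.
Local Notation C := (CC R).

(* [b = false] is the problem in [|z| < 1] and [b = true] the barred one in
   [|z| > 1]; the latter is studied in the disc variable [w = 1/z]. *)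
Definition inv_if (b : bool) (z : C) : C := if b then z^-1 else z.
Definition sg (b : bool) : int := if b then -1 else 1.

Lemma inv_ifK b : involutive (inv_if b).
Proof. by case: b => z; rewrite /inv_if //= invrK. Qed.

Lemma inv_if_exp b (z : C) (l : nat) : inv_if b z ^+ l = z ^ (sg b * l%:Z).
Proof.
case: b; rewrite /sg /inv_if /=; last by rewrite mul1r.
by rewrite mulN1r exprVn exprnN.
Qed.

Lemma expz_pred (z : C) (p : int) : z != 0 -> z * z ^ (p - 1) = z ^ p.
Proof. by move=> z0; rewrite -{1}[z]expr1z -expfzDr// addrC subrK. Qed.

Lemma exprz_cdiff (tau : int) (z : C) : z != 0 ->
  cdiff (fun y => y ^ tau) z (tau%:~R * z ^ (tau - 1)).
Proof.
move=> z0.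
have pos n : cdiff (fun y : C => y ^+ n) z (n%:R * z ^ (n%:Z - 1)).
  elim: n => [|n IH].
    by rewrite mul0r; exact: cdiff_cst.
  have -> : (fun y : C => y ^+ n.+1) = (fun y => y * y ^+ n) by apply/funext => y; rewrite exprS.
  apply: cdiff_eq (cdiffM (cdiff_id z) IH) _.
  rewrite (_ : n.+1%:Z - 1 = n%:Z); last by rewrite -addn1 PoszD addrK.
  by rewrite /= mulrCA expz_pred// -[n.+1%:R]natr1 mulr1 -exprnP; ring.
case: tau => n; first exact: pos.
have -> : (fun y : C => y ^ (Negz n)) = (fun y => (y ^+ n.+1)^-1) by apply/funext.
apply: cdiff_eq (cdiffV _ (pos n.+1)) _; first by rewrite expf_neq0.
have h : z ^ (- n.+1%:Z - 1) = (z ^+ n.+1) ^- 2 * z ^ (n.+1%:Z - 1).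
  by rewrite -exprM exprnN -expfzDr//; congr (_ ^ _); rewrite PoszM; ring.
by rewrite NegzE h mulrNz -pmulrn; ring.
Qed.

Lemma inv_if_cdiff b (z : C) : z != 0 -> cdiff (inv_if b) z ((sg b)%:~R * inv_if b z / z).
Proof.
rewrite /inv_if; case: b => z0; rewrite /sg /=; last by rewrite mul1r mulfV//; exact: cdiff_id.
apply: cdiff_eq (cdiffV z0 (cdiff_id z)) _.
by rewrite mulrN1z; field.
Qed.

(** The condition [z != 0] is essential for [b = true]: as [0^-1 = 0], the origin would otherwise
    belong to the exterior domain. *)
Definition udom b : set C := [set z | z != 0 /\ nm (inv_if b z) < 1].

Lemma udom_open b z : udom b z -> exists2 d : R, 0 < d & forall y, nm (y - z) < d -> udom b y.
Proof.
move=> [z0 z1]; have := cdiff_cont (inv_if_cdiff b z0).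
move=> /(_ ((1 - nm (inv_if b z)) / 2)) [|d d0 hd]; first by rewrite divr_gt0// subr_gt0.
have nz : 0 < nm z by rewrite nm_gt0.
exists (Num.min d (nm z)); first by rewrite lt_min d0.
move=> y; rewrite lt_min => /andP[/hd y1 y2]; split.
  rewrite -nm_gt0; have := nm_subr z y; rewrite nmC; lra.
by have := nm_subr (inv_if b y) (inv_if b z); lra.
Qed.

(** The operator [tau + sg b * w d/dw] on polynomials in [w = inv_if b z], so that the derivative of
    [z ^ tau * P(w)] in [z] is [z ^ (tau - 1)] times [del P] at [w]. *)
Definition del b (tau : int) (P : {poly C}) : {poly C} :=
  tau%:~R%:P * P + (sg b)%:~R%:P * ('X * deriv P).

Fixpoint delk b tau k P := if k is k'.+1 then del b (tau - k'%:Z) (delk b tau k' P) else P.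

Lemma delk_coef b tau k P l : (delk b tau k P)`_l = P`_l * ffz R (tau + sg b * l%:Z) k.
Proof.
elim: k => [|k IH]; first by rewrite /ffz big_ord0 mulr1.
rewrite /= /del coefD !coefCM coefXM coef_deriv ffzS intrB intrD intrM.
case: l IH => [|l] IH /=; first by rewrite IH !mulr0 addr0 -!pmulrn; ring.
by rewrite -[_ *+ l.+1]mulr_natr IH -!pmulrn; ring.
Qed.

Lemma analyticM f g (p q : nat -> {poly C}) : analytic f p -> analytic g q ->
  analytic (fun z => f z * g z) (fun s => p s * q s).
Proof.
move=> [h1 h2] [h3 h4]; split.
  by move=> rho r0 r1; apply: ncauchyM; [exact: ltW|exact: h1|exact: h3].
by move=> z z1; apply: eq_slim (slimM (h2 z z1) (h4 z z1)) => s; rewrite hornerM.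
Qed.

Lemma analyticD f g (p q : nat -> {poly C}) : analytic f p -> analytic g q ->
  analytic (fun z => f z + g z) (fun s => p s + q s).
Proof.
move=> [h1 h2] [h3 h4]; split.
  by move=> rho r0 r1; apply: ncauchyD; [exact: ltW|exact: h1|exact: h3].
by move=> z z1; apply: eq_slim (slimD (h2 z z1) (h4 z z1)) => s; rewrite hornerD.
Qed.

Lemma analytic_poly (P : {poly C}) : analytic (horner P) (fun=> P).
Proof. exact/wiener_analytic/wiener_poly. Qed.

Lemma termwise_step b tau (g : C -> C) p : analytic g p -> exists g1,
  analytic g1 (fun s => del b tau (p s)) /\
  forall z, udom b z -> cdiff (fun y => y ^ tau * g (inv_if b y)) z (z ^ (tau - 1) * g1 (inv_if b z)).
Proof.
move=> hg; have [g' [hg' dg]] := analytic_cdiff hg.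
exists (fun w => (tau%:~R%:P : {poly C}).[w] * g w + ((sg b)%:~R%:P : {poly C}).[w] * (('X : {poly C}).[w] * g' w)).
split.
  apply: analyticD; first by apply: analyticM => //; exact: analytic_poly.
  apply: analyticM; first exact: analytic_poly.
  by apply: analyticM => //; exact: analytic_poly.
move=> z [z0 z1].
apply: cdiff_eq (cdiffM (exprz_cdiff tau z0) (cdiff_comp (inv_if_cdiff b z0) (dg _ z1))) _.
rewrite !hornerC hornerX.
have <- : z * z ^ (tau - 1) = z ^ tau by exact: expz_pred.
by field.
Qed.

Lemma termwise_derive b tau (g : C -> C) p (f : C -> C) : analytic g p ->
  (forall z, udom b z -> f z = z ^ tau * g (inv_if b z)) ->
  forall k, exists gk, analytic gk (fun s => delk b tau k (p s)) /\
    forall z, udom b z -> derive1n k f z = z ^ (tau - k%:Z) * gk (inv_if b z).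
Proof.
move=> hg hf; elim=> [|k [gk [hgk IH]]].
  by exists g; split => // z zU; rewrite derive1n0 subr0 hf.
have [g1 [hg1 dg1]] := termwise_step b (tau - k%:Z) hgk.
exists g1; split => // z zU; rewrite derive1nS.
have [d d0 hd] := udom_open zU.
rewrite (_ : tau - k.+1%:Z = tau - k%:Z - 1); last by rewrite -addn1 PoszD; ring.
apply: cdiff_derive1; apply: (cdiff_near d0) (dg1 z zU) => y /hd yU.
by rewrite -IH.
Qed.

(** The Taylor coefficient of [f] at [z] is the limit of the combinations of the Taylor coefficients
    of the monomials [z ^ (tau + sg b * l)], because [delk] acts on each coefficient by a falling
    factorial. *)
Lemma termwise_lim b tau (g : C -> C) p (f : C -> C) (n : nat -> nat) z k : analytic g p ->
  (forall z, udom b z -> f z = z ^ tau * g (inv_if b z)) -> udom b z ->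
  (forall s, (size (p s) <= n s)%N) ->
  slim (fun s => \sum_(l < n s) (p s)`_l * ez z (tau + sg b * l%:Z) k) (derive1n k f z / k`!%:R).
Proof.
move=> hg hf zU hn; have [gk [hgk ->//]] := termwise_derive hg hf k.
have [z0 z1] := zU.
apply: eq_slim (slimM (slimZ (z ^ (tau - k%:Z)) (hgk.2 _ z1)) (slim_cst (k`!%:R^-1))) => s.
have sz : (size (delk b tau k (p s)) <= n s)%N.
  apply/leq_sizeP => l nl; rewrite delk_coef nth_default ?mul0r//.
  exact: leq_trans (hn s) nl.
rewrite (horner_coef_wide _ sz) mulr_sumr mulr_suml; apply: eq_bigr => l _.
rewrite delk_coef inv_if_exp /ez /gb.
have -> : tau + sg b * l%:Z - k%:Z = tau - k%:Z + sg b * l%:Z by ring.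
by rewrite [z ^ (_ - _ + _)]expfzDr//; ring.
Qed.

End TermwiseDerivative.

(** * Contour integrals over the unit circle *)

Section CircleIntegral.
Variable R : realType.
Local Notation C := (CC R).
Implicit Types (f g F : C -> C) (z a : C).

Definition circ_cont f := ccont 0 (2 * pi) (fun t : R => f (expi t)).

Lemma tpi_gt0 : 0 < 2 * pi :> R. Proof. by rewrite mulr_gt0// pi_gt0. Qed.
Let tpi_ge0 : 0 <= 2 * pi :> R. Proof. exact: ltW tpi_gt0. Qed.

Lemma cont_on_circ f : cont_on [set z | nm z = 1] f -> circ_cont f.
Proof. by apply: cont_on_expi => t _ /=; exact: expi_nm. Qed.

Lemma eq_circ f g : (forall z, nm z = 1 -> f z = g z) -> circ_int f = circ_int g.
Proof.
move=> h; rewrite !circ_intE; congr (_ * _); apply: eq_cint => t _.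
by rewrite h// expi_nm.
Qed.

Lemma eq_circ_cont f g : (forall z, nm z = 1 -> f z = g z) -> circ_cont f -> circ_cont g.
Proof. by move=> h; apply: eq_ccont => t _; rewrite h// expi_nm. Qed.

Lemma circ_contD f g : circ_cont f -> circ_cont g -> circ_cont (fun z => f z + g z).
Proof. exact: ccontD. Qed.

Lemma circ_contB f g : circ_cont f -> circ_cont g -> circ_cont (fun z => f z - g z).
Proof. exact: ccontB. Qed.

Lemma circ_contM f g : circ_cont f -> circ_cont g -> circ_cont (fun z => f z * g z).
Proof. exact: ccontM. Qed.

Lemma circ_cont_cst c : circ_cont (fun=> c).
Proof. exact: ccont_cst. Qed.

Lemma circ_contV f : (forall z, nm z = 1 -> f z != 0) -> circ_cont f -> circ_cont (fun z => (f z)^-1).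
Proof. by move=> h; apply: ccontV => t _; apply: h; exact: expi_nm. Qed.

Lemma nm1_neq0 z : nm z = 1 -> z != 0.
Proof. by move=> h; rewrite -nm_gt0 h. Qed.

Lemma circ_cont_expz p : circ_cont (fun z => z ^ p).
Proof.
have pos n : circ_cont (fun z => z ^+ n).
  apply: cont_on_circ; apply: cont_onX; exact: cont_on_id.
case: p => n; first exact: pos.
by apply: circ_contV => // z z1; rewrite expf_neq0// nm1_neq0.
Qed.

Lemma circM_expi f : circ_cont f -> ccont 0 (2 * pi) (fun t : R => f (expi t) * expi t).
Proof. by move=> h; apply: ccontM => //; exact: ccont_expi. Qed.

Lemma circD f g : circ_cont f -> circ_cont g ->
  circ_int (fun z => f z + g z) = circ_int f + circ_int g.
Proof.
move=> hf hg; rewrite !circ_intE -mulrDr -cintD; try exact: (circM_expi hf); try exact: (circM_expi hg).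
by congr (_ * _); apply: eq_cint => t _; rewrite mulrDl.
Qed.

Lemma circZ c f : circ_cont f -> circ_int (fun z => c * f z) = c * circ_int f.
Proof.
move=> hf; rewrite !circ_intE [RHS]mulrCA; congr (_ * _).
by rewrite -(cintZ _ (circM_expi hf)); apply: eq_cint => t _; rewrite mulrA.
Qed.

Lemma circB f g : circ_cont f -> circ_cont g ->
  circ_int (fun z => f z - g z) = circ_int f - circ_int g.
Proof.
move=> hf hg; rewrite !circ_intE -mulrBr -cintB; try exact: (circM_expi hf); try exact: (circM_expi hg).
by congr (_ * _); apply: eq_cint => t _; rewrite mulrBl.
Qed.

Lemma circ_bound f M : circ_cont f -> (forall z, nm z = 1 -> nm (f z) <= M) ->
  nm (circ_int f) <= 2 * M.
Proof.
move=> hf h; rewrite circ_intE nmM nm_rc ger0_norm ?invr_ge0//.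
rewrite mulrC ler_pdivrMr ?tpi_gt0//.
apply: le_trans (cint_bound (M := M) tpi_ge0 (circM_expi hf) _) _; last by rewrite subr0.
by move=> t _; rewrite nmM expi_nm mulr1; apply: h; exact: expi_nm.
Qed.

Lemma circ_slim f (fs : nat -> C -> C) : circ_cont f -> (forall s, circ_cont (fs s)) ->
  (forall e, 0 < e -> exists s0, forall s, (s0 <= s)%N -> forall z, nm z = 1 ->
     nm (f z - fs s z) <= e) ->
  slim (fun s => circ_int (fs s)) (circ_int f).
Proof.
move=> hf hfs h e e0; have [s0 hs] := h (e / 2) ltac:(by rewrite divr_gt0).
exists s0 => s ss; rewrite -circB//.
apply: le_trans (circ_bound (circ_contB hf (hfs s)) (hs s ss)) _.
by rewrite mulrC divfK.
Qed.

Lemma circ_disc F g : (forall z, nm z < 1 -> exists l, cdiff F z l) ->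
  cont_on [set z | nm z <= 1] F -> (forall z, nm z = 1 -> g z * z = F z) -> circ_int g = F 0.
Proof.
move=> Fd Fc h; rewrite circ_intE (@eq_cint _ _ _ _ (fun t => F (expi t))); last first.
  by move=> t _; rewrite h// expi_nm.
rewrite mean_value_circle// mulrA -rcM mulVf ?rc1 ?mul1r// gt_eqF//; exact: tpi_gt0.
Qed.

(** The version for integrands holomorphic outside the circle: [F] is read in the variable [1/z],
    and its value at 0 belongs to the point at infinity. *)
Lemma circ_discN F g : (forall z, nm z < 1 -> exists l, cdiff F z l) ->
  cont_on [set z | nm z <= 1] F -> (forall z, nm z = 1 -> g z * z = F z^-1) -> circ_int g = F 0.
Proof.
move=> Fd Fc h; rewrite circ_intE (@eq_cint _ _ _ _ (fun t => F (expi (- t)))); last first.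
  by move=> t _; rewrite h ?expi_nm// expiN.
rewrite mean_value_circleN// mulrA -rcM mulVf ?rc1 ?mul1r// gt_eqF//; exact: tpi_gt0.
Qed.

Lemma rat_disc (P Q : {poly C}) : (forall z, nm z <= 1 -> Q.[z] != 0) ->
  (forall z, nm z < 1 -> exists l, cdiff (fun z => P.[z] / Q.[z]) z l) /\
  cont_on [set z | nm z <= 1] (fun z => P.[z] / Q.[z]).
Proof.
move=> Q0; split.
  move=> z z1; eexists; apply: cdiffM; first exact: poly_cdiff.
  by apply: cdiffV; [exact/Q0/ltW|exact: poly_cdiff].
have pc (S : {poly C}) : cont_on [set z | nm z <= 1] (horner S).
  by apply: cdiff_ccont => z _; eexists; exact: poly_cdiff.
by apply: cont_onM; [exact: pc|apply: cont_onV => //; exact: pc].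
Qed.

Definition Jc a (p : int) k : C := circ_int (fun z => z ^ p * (z - a) ^- k).

Lemma zsub_neq0 a z : nm a != 1 -> nm z = 1 -> z - a != 0.
Proof. by move=> a1 z1; rewrite subr_eq0; apply: contra a1 => /eqP <-; rewrite z1. Qed.

Lemma J_cont a p k : nm a != 1 -> circ_cont (fun z => z ^ p * (z - a) ^- k).
Proof.
move=> a1; apply: circ_contM; first exact: circ_cont_expz.
apply: circ_contV; first by move=> z z1; rewrite expf_neq0// zsub_neq0.
apply: cont_on_circ; apply: cont_onX; apply: cont_onB; [exact: cont_on_id|exact: cont_on_cst].
Qed.

Lemma J_rec a p k : nm a != 1 -> Jc a (p + 1) k.+1 = Jc a p k + a * Jc a p k.+1.
Proof.
move=> a1; rewrite /Jc -circZ; last exact: J_cont.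
rewrite -circD; [|exact: J_cont|by apply: circ_contM; [exact: circ_cont_cst|exact: J_cont]].
apply: eq_circ => z z1; rewrite expfzDr ?nm1_neq0// expr1z exprS.
have h := zsub_neq0 a1 z1.
by field; rewrite h expf_neq0.
Qed.

(** The residue of [z^p / (z - a)^(k+1)] by recursion: [Jc] and [ez] satisfy the same Pascal rule,
    and the cases [p = 0] and order 0 follow from mean values. *)
Lemma J_inner a p k : a != 0 -> nm a < 1 -> Jc a (Posz p) k.+1 = ez a p k.
Proof.
move=> a0 a1; have a1' : nm a != 1 by rewrite lt_eqF.
have J0 n : Jc a n%:Z 0 = 0.
  rewrite /Jc (@circ_disc (horner ('X^(n.+1)))); first by rewrite hornerXn exprS mul0r.
  - by move=> z _; eexists; exact: poly_cdiff.
  - by apply: cdiff_ccont => z _; eexists; exact: poly_cdiff.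
  - by move=> z _; rewrite hornerXn expr0 invr1 mulr1 -exprnP -exprSr.
have J1 j : Jc a 0 j.+1 = (j == 0%N)%:R.
  (* In the variable [w = 1/z] the integrand times [z] becomes [w^j / (1 - a w)^(j+1)], whose
     denominator has no zero in the closed disc. *)
  pose Q : {poly C} := (1%:P - a *: 'X) ^+ j.+1.
  have Q0 z : nm z <= 1 -> Q.[z] != 0.
    move=> z1; rewrite horner_exp hornerD hornerN hornerC hornerZ hornerX expf_neq0//.
    rewrite subr_eq0; apply/negP => /eqP /(congr1 (@nm R)); rewrite nm1 nmM => h.
    by have := nm_ge0 z; have := nm_ge0 a; nra.
  have [Qd Qc] := rat_disc 'X^j Q0.
  rewrite /Jc (circ_discN Qd Qc).
    rewrite hornerXn horner_exp hornerD hornerN hornerC hornerZ hornerX mulr0 subr0.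
    by rewrite expr1n divr1 expr0n.
  move=> z z1; have z0 := nm1_neq0 z1; have h := zsub_neq0 a1' z1.
  rewrite hornerXn horner_exp hornerD hornerN hornerC hornerZ hornerX expr0z mul1r.
  have -> : 1 - a * z^-1 = (z - a) / z by field.
  rewrite expr_div_n !exprVn !exprS.
  by field; rewrite z0 h !expf_neq0.
elim: p k => [|p IH] k.
  by rewrite J1; case: k => [|k]; rewrite ?ez0 ?ez0S.
have e1 : Posz p.+1 = p%:Z + 1 by rewrite intS addrC.
rewrite e1 J_rec//; case: k => [|k]; last by rewrite !IH ez_pascal// addrC.
by rewrite J0 add0r IH !ez0 expfzDr// expr1z mulrC.
Qed.

(** The sign is that of a residue outside the contour. The recursion now runs towards negative
    exponents, solving [J_rec] for the term multiplied by [a], hence the inner induction on the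
    order. *)
Lemma J_outer a p k : 1 < nm a -> Jc a (Negz p) k.+1 = - ez a (Negz p) k.
Proof.
move=> a1; have a1' : nm a != 1 by rewrite gt_eqF.
have a0 : a != 0 by rewrite -nm_gt0 (lt_trans ltr01).
have J0 n : Jc a (Negz n) 0 = (n == 0%N)%:R.
  rewrite /Jc (@circ_discN (horner ('X^n))); first by rewrite hornerXn expr0n.
  - by move=> z _; eexists; exact: poly_cdiff.
  - by apply: cdiff_ccont => z _; eexists; exact: poly_cdiff.
  - move=> z z1; rewrite hornerXn expr0 invr1 mulr1 NegzE -exprnN exprVn exprS.
    by field; rewrite expf_neq0 nm1_neq0.
have J1 j : Jc a 0 j.+1 = 0.
  pose Q : {poly C} := ('X - a%:P) ^+ j.+1.
  have Q0 z : nm z <= 1 -> Q.[z] != 0.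
    move=> z1; rewrite horner_exp hornerXsubC expf_neq0// subr_eq0.
    by apply/negP => /eqP h; move: z1; rewrite h; lra.
  have [Qd Qc] := rat_disc 'X Q0.
  rewrite /Jc (circ_disc Qd Qc); first by rewrite hornerX mul0r.
  by move=> z z1; rewrite hornerX horner_exp hornerXsubC expr0z mul1r mulrC.
elim: p k => [|p IH] k.
  have key j : a * Jc a (Negz 0) j.+1 = - Jc a (Negz 0) j.
    have := @J_rec a (Negz 0) j a1'; rewrite (_ : Negz 0 + 1 = 0)// J1 => h.
    by apply/eqP; rewrite -addr_eq0 addrC -h.
  apply: (mulfI a0); rewrite key; elim: k => [|k IH].
    by rewrite J0 ez0 NegzE -exprnN expr1 mulrN mulfV.
  apply: (mulfI a0); rewrite mulrN key IH.
  have := @ez_pascal R a (Negz 0) k a0; rewrite (_ : Negz 0 + 1 = 0)// ez0S => h.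
  have e : a * ez a (Negz 0) k.+1 = - ez a (Negz 0) k by apply/eqP; rewrite -addr_eq0 -h.
  by rewrite [a * - ez a _ k.+1]mulrN e; ring.
have e1 : Negz p.+1 + 1 = Negz p by rewrite !NegzE -[p.+2]addn1 PoszD; ring.
have hr j : a * Jc a (Negz p.+1) j.+1 = - ez a (Negz p) j - Jc a (Negz p.+1) j.
  by have := @J_rec a (Negz p.+1) j a1'; rewrite e1 IH => ->; ring.
elim: k => [|k IHk]; apply: (mulfI a0); rewrite hr.
  by rewrite J0 subr0 !ez0 -e1 expfzDr// expr1z; ring.
by rewrite IHk -e1 ez_pascal//; ring.
Qed.

End CircleIntegral.

(** * Powers of the Jordan triplet *)

Section JordanTriplet.
Variable R : realType.
Local Notation C := (CC R).

(** The function [z^p] evaluated at a Jordan block: the superdiagonals carry the Taylor coefficients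
    of [z^p] at [a], for negative [p] as well. *)
Definition jordan_pow (a : C) (m : nat) (p : int) : 'M[C]_m :=
  \matrix_(i < m, l < m) (if (i <= l)%N then ez a p (l - i) else 0).

Lemma jordan_powS (a : C) m p : a != 0 ->
  jordan a m *m jordan_pow a m p = jordan_pow a m (p + 1).
Proof.
move=> a0; apply/matrixP => i l; rewrite !mxE (bigD1 i)//= !mxE eqxx.
have [im|im] := ltnP i.+1 m.
  have ne : (Ordinal im) != i by rewrite -val_eqE /= gtn_eqF.
  rewrite (bigD1 (Ordinal im))//= !mxE /= gtn_eqF// eqxx mul1r big1 ?addr0; last first.
    move=> j /andP[j1 j2]; rewrite !mxE (_ : (j == i :> nat) = false).
      rewrite (_ : (j == i.+1 :> nat) = false) ?mul0r//.
      by apply/negP => /eqP e; case/eqP: j2; apply: val_inj.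
    by apply/negP => /eqP e; case/eqP: j1; apply: val_inj.
  case: (ltngtP i l) => il.
  - rewrite (_ : (l - i)%N = (l - i.+1).+1) ?ez_pascal//; last by rewrite subnSK.
  - by rewrite mulr0 addr0.
  - by rewrite -il subnn !ez0 expfzDr// expr1z addr0 mulrC.
rewrite big1 ?addr0; last first.
  move=> j j1; rewrite !mxE (_ : (j == i :> nat) = false).
    by rewrite (_ : (j == i.+1 :> nat) = false) ?mul0r//; apply: ltn_eqF; exact: leq_trans im.
  by apply/negP => /eqP e; case/eqP: j1; apply: val_inj.
case: ifP => il; last by rewrite mulr0.
have -> : (l - i)%N = 0%N.
  by apply/eqP; rewrite subn_eq0 -ltnS; exact: leq_trans im.
by rewrite !ez0 expfzDr// expr1z mulrC.
Qed.

Lemma jordan_pow0 (a : C) m : jordan_pow a m 0 = 1%:M.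
Proof.
apply/matrixP => i l; rewrite !mxE -val_eqE /=; case: (ltngtP i l) => // il; last first.
  by rewrite -il subnn ez0 expr0z.
by rewrite -(subnSK il) ez0S.
Qed.

Variables (N : nat) (zs : 'I_N -> C) (ms : 'I_N -> nat).
Hypothesis zs0 : forall j, zs j != 0.

Let Bp (p : int) : 'M[C]_(\sum_(j < N) ms j, 1) :=
  \mxcol_(j < N) (jordan_pow (zs j) (ms j) p *m Bblock R (ms j)).

Lemma Amat_Bp p : Amat zs ms *m Bp p = Bp (p + 1).
Proof.
rewrite /Amat /Bp mul_mxdiag_mxcol; apply: eq_mxcol => j.
by rewrite mulmxA jordan_powS.
Qed.

Lemma Bp0 : Bp 0 = Bmat R ms.
Proof. by apply: eq_mxcol => j; rewrite jordan_pow0 mul1mx. Qed.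

(** The inverse is explicit: the block diagonal matrix of the [jordan_pow] with exponent -1. *)
Lemma Amat_unit : Amat zs ms \in unitmx.
Proof.
suff : Amat zs ms *m \mxdiag_(j < N) jordan_pow (zs j) (ms j) (-1) = 1%:M.
  by move=> /mulmx1_unit [].
rewrite /Amat {2}/mxdiag mul_mxdiag_mxblock.
rewrite -[1%:M](mxdiagZ (p_ := ms)) /mxdiag; apply: eq_mxblock => i j.
case: (eqVneq i j) => [->|_]; last by rewrite mulmx0.
by rewrite !conform_mx_id jordan_powS// addNr jordan_pow0.
Qed.

Lemma mxpowz_Bp p : mxpowz (Amat zs ms) p *m Bmat R ms = Bp p.
Proof.
case: p => n /=.
  elim: n => [|n IH]; first by rewrite expr0 -Bp0 mul1mx.
  rewrite exprS -[_ * _]/(_ *m _) -mulmxA IH Amat_Bp; congr Bp.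
  by rewrite intS addrC.
have inv p : invmx (Amat zs ms) *m Bp (p + 1) = Bp p.
  by rewrite -Amat_Bp mulmxA mulVmx ?mul1mx// Amat_unit.
elim: n => [|n IH].
  by rewrite expr1 -Bp0 -(inv (Negz 0)).
rewrite exprS -[_ * _]/(_ *m _) -mulmxA IH -(inv (Negz n.+1)); congr (_ *m Bp _).
by rewrite !NegzE -[n.+2]addn1 PoszD; ring.
Qed.

(** [Bblock] selects the last column of each power, which read upwards is [ez (zs j) p k] for
    [k = 0, 1, ...]; [Cblock] lists its constants in the opposite order, whence the reversal of the
    index. *)
Lemma triplet_pow (c : 'I_N -> nat -> C) p :
  (Cmat ms c *m mxpowz (Amat zs ms) p *m Bmat R ms) 0 0 =
  \sum_j \sum_(k < ms j) c j k * ez (zs j) p k.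
Proof.
rewrite -mulmxA mxpowz_Bp /Cmat /Bp mul_mxrow_mxcol summxE; apply: eq_bigr => j _.
case E : (ms j) => [|m]; first by rewrite !mxE !big_ord0.
rewrite !mxE (reindex_inj rev_ord_inj) /=; apply: eq_bigr => k _.
rewrite !mxE /= (bigD1 ord_max)//= !mxE eqxx mulr1 big1 ?addr0; last first.
  move=> l lm; rewrite !mxE eqSS (_ : (l == m :> nat) = false) ?mulr0//.
  by apply/negP => /eqP e; case/eqP: lm; apply: val_inj.
have km : (k <= m)%N by rewrite -ltnS.
rewrite !subSS (_ : (rev_ord k <= @ord_max m)%N) /= ?subSS ?subKn//; exact: leq_subr.
Qed.

End JordanTriplet.

(** * Principal parts of the transmission coefficient *)

Section PoleDecomposition.
Variable R : realType.
Local Notation C := (CC R).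
Implicit Types (s : seq C) (z a y : C) (f g : C -> C).

Definition pp_poly s : {poly C} := \prod_(a <- s) ('X - a%:P).

Lemma pp_poly_cons a s y : (pp_poly (a :: s)).[y] = (y - a) * (pp_poly s).[y].
Proof. by rewrite /pp_poly big_cons hornerM hornerXsubC. Qed.

Lemma pp_poly_root s y : ((pp_poly s).[y] == 0) = (y \in s).
Proof. by rewrite -[LHS]/(root _ _) /pp_poly root_prod_XsubC. Qed.

Lemma avoid_seq s z : z \notin s -> exists2 d : R, 0 < d & forall y, nm (y - z) < d -> y \notin s.
Proof.
elim: s => [|a s IH]; first by exists 1.
rewrite inE negb_or => /andP[za /IH [d d0 hd]].
exists (Num.min d (nm (z - a))); first by rewrite lt_min d0 nm_gt0 subr_eq0.
move=> y; rewrite lt_min => /andP[/hd y1 y2]; rewrite inE negb_or y1 andbT.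
by apply/negP => /eqP e; move: y2; rewrite e nmC ltxx.
Qed.

Lemma avoid_punctured s a : exists2 d : R, 0 < d & forall y, 0 < nm (y - a) < d -> y \notin s.
Proof.
have [|d d0 hd] := @avoid_seq [seq x <- s | x != a] a.
  by rewrite mem_filter eqxx.
exists d => // y /andP[y0 /hd]; apply: contra => ys.
by rewrite mem_filter ys andbT -subr_eq0 -nm_gt0.
Qed.

Definition near_bdd f g a := exists d M : R, 0 < d /\
  forall y, 0 < nm (y - a) < d -> nm (f y) <= M * nm (g y).

(** Being dominated by the polynomial near a root forces a zero there; dividing [f] by [z - a]
    cancels one linear factor of the bound away from [a]. Multiplicities are handled by repetitions
    in the list. *)
Lemma wiener_bdd_div s f p : wiener f p -> (forall a, a \in s -> nm a < 1) ->
  (forall a, a \in s -> near_bdd f (horner (pp_poly s)) a) ->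
  exists g q, wiener g q /\ forall z, nm z <= 1 -> f z = (pp_poly s).[z] * g z.
Proof.
elim: s f p => [|a s IH] f p hf hs hb.
  by exists f, p; split => // z _; rewrite /pp_poly big_nil hornerC mul1r.
have a1 : nm a < 1 by apply: hs; rewrite mem_head.
have ball1 (b : C) : nm b < 1 -> exists2 d : R, 0 < d & forall y, nm (y - b) < d -> nm y < 1.
  move=> b1; exists (1 - nm b); first by rewrite subr_gt0.
  by move=> y yb; have := nmD (y - b) b; rewrite subrK; lra.
have fa : f a = 0.
  have [d [M [d0 hM]]] := hb a (mem_head _ _).
  apply: nm_le_eq0 => e e0.
  have [l hl] := wiener_cdiff hf a1.
  have [d1 d10 h1] := cdiff_cont hl (ltac:(by rewrite divr_gt0) : 0 < e / 2).
  have [d2 d20 h2] := cdiff_cont (poly_cdiff (pp_poly (a :: s)) a)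
    (ltac:(by rewrite !divr_gt0// ltr_wpDl) : 0 < e / 2 / (`|M| + 1)).
  pose h := Num.min d (Num.min d1 d2) / 2.
  have m0 : 0 < Num.min d (Num.min d1 d2) by rewrite !lt_min d0 d10 d20.
  have h0 : 0 < h by rewrite divr_gt0.
  have [hd hd1 hd2] : [/\ h < d, h < d1 & h < d2].
    have : h < Num.min d (Num.min d1 d2) by rewrite /h; lra.
    by rewrite !lt_min => /and3P[].
  pose y := a + rc h; have ya : nm (y - a) = h.
    by rewrite /y addrC addKr nm_rc gtr0_norm.
  have := hM y; rewrite ya h0 hd => /(_ isT) b1.
  have := h1 y; rewrite ya => /(_ hd1) b2.
  have := h2 y; rewrite ya (_ : (pp_poly (a :: s)).[a] = 0) ?subr0; last first.
    by apply/eqP; rewrite pp_poly_root mem_head.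
  move=> /(_ hd2); rewrite ler_pdivlMr ?ltr_wpDl// => b3.
  have b4 : nm (f y) <= e / 2.
    apply: le_trans b1 _; apply: le_trans _ b3; rewrite mulrC ler_wpM2l ?nm_ge0//.
    by apply: le_trans (ler_norm _) _; rewrite lerDl.
  by have := nm_subr (f a) (f y); rewrite nmC; lra.
have [g [hg fg]] := wiener_div hf a1 fa.
have [||h [q [hq gh]]] := IH g _ hg.
- by move=> b bs; apply: hs; rewrite inE bs orbT.
- move=> b bs; have bs' : b \in a :: s by rewrite inE bs orbT.
  have [d [M [d0 hM]]] := hb b bs'; have [d1 d10 h1] := ball1 b (hs b bs').
  have [d2 d20 h2] := avoid_punctured [:: a] b.
  exists (Num.min d (Num.min d1 d2)), M; split; first by rewrite !lt_min d0 d10 d20.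
  move=> y /andP[y0]; rewrite !lt_min => /and3P[y1 y2 y3].
  have := hM y; rewrite y0 y1 => /(_ isT); rewrite pp_poly_cons fg; last by apply/ltW/h1.
  rewrite !nmM mulrCA ler_pM2l// nm_gt0 subr_eq0.
  by have := h2 y; rewrite y0 y3 inE => /(_ isT).
- exists h, q; split => // z z1; by rewrite fg// gh// pp_poly_cons mulrA.
Qed.

Variables (s : seq C) (T W PP : C -> C) (pW : nat -> {poly C}) (A : {poly C}).
Let P := pp_poly s.
Hypothesis s_in : forall a, a \in s -> 0 < nm a < 1.
Hypothesis T_diff : forall z, 0 < nm z < 1 -> z \notin s -> exists l, cdiff T z l.
Hypothesis T_cont : cont_on [set z | 0 < nm z <= 1 /\ z \notin s] T.
Hypothesis T_pole : forall a, a \in s -> exists d c1 c2 : R, [/\ 0 < d, 0 < c1 &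
  forall y, 0 < nm (y - a) < d -> c1 <= nm (P.[y] * T y) <= c2].
Hypothesis hW : wiener W pW.
Hypothesis W0 : W 0 != 0.
Hypothesis TW1 : forall z, nm z = 1 -> T z * W z = 1.

Lemma wiener_bound f p : wiener f p -> exists2 M : R, 0 < M & forall z, nm z <= 1 -> nm (f z) <= M.
Proof.
case=> h1 h2; have [M M0 hM] := ncauchy_bdd ler01 h1; exists M => // z z1.
by apply: (slim_nm_le (h2 z z1)) => i; apply: le_trans (pn_horner _ z1) _.
Qed.

(** The identity is extended from the circle by [circle_unique], applied to a multiple of [T W - 1]
    whose singularities at the poles are removed. *)
Lemma TW_eq1 z : 0 < nm z <= 1 -> z \notin s -> T z * W z = 1.
Proof.
move=> z01 zs; pose f y := P.[y] ^+ 3 * (T y * W y - 1).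
suff fz : f z = 0.
  have : P.[z] ^+ 3 != 0 by rewrite expf_neq0// pp_poly_root.
  by move/eqP: fz; rewrite mulf_eq0 => /orP[->//|]; rewrite subr_eq0 => /eqP.
have Wd y : nm y < 1 -> exists l, cdiff W y l by exact: wiener_cdiff hW.
have P3 y : exists l, cdiff (fun y => P.[y] ^+ 3) y l.
  exists (deriv (P ^+ 3)).[y].
  have -> : (fun y => P.[y] ^+ 3) = horner (P ^+ 3) by apply/funext => u; rewrite horner_exp.
  exact: poly_cdiff.
have fd y : 0 < nm y < 1 -> exists l, cdiff f y l.
  move=> y01; have [ys|ys] := boolP (y \in s); last first.
    have [l1 h1] := T_diff y01 ys; have /andP[_ /Wd [l2 h2]] := y01; have [l3 h3] := P3 y.
    by eexists; apply: cdiffM h3 (cdiffB (cdiffM h1 h2) (cdiff_cst 1 y)).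
  (* Since [P T] stays bounded, [P^3 (T W - 1) = P^2 (P T W - P)] is [(u - y)^2] times a bounded
     function near a pole [y]: the cube gives a derivative, equal to 0. *)
  exists 0 => e e0; have [d [c1 [c2 [d0 c10 hc]]]] := T_pole ys.
  have [M M0 hM] := wiener_bound hW.
  pose q := P %/ ('X - y%:P); have Pq u : P.[u] = (u - y) * q.[u].
    have dP : 'X - y%:P %| P by rewrite dvdp_XsubCl /root pp_poly_root.
    by have /(congr1 (horner^~ u)) := divpK dP; rewrite /= hornerM hornerXsubC mulrC => <-.
  pose K := pn (nm y + 1) q; have K0 : 0 <= K by apply: pn_ge0; rewrite addr_ge0 ?nm_ge0.
  have qK u : nm (u - y) < 1 -> nm q.[u] <= K.
    by move=> h; apply: pn_horner; have := nmD (u - y) y; rewrite subrK; lra.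
  pose L := K ^+ 2 * (`|c2| * M + K) + 1.
  have L0 : 0 < L by rewrite ltr_wpDl// mulr_ge0 ?sqr_ge0// addr_ge0// mulr_ge0// ltW.
  exists (Num.min (Num.min d 1) (Num.min (1 - nm y) (e / L))).
    have y1 : 0 < 1 - nm y by rewrite subr_gt0; case/andP: y01.
    by rewrite !lt_min d0 ltr01 y1 divr_gt0.
  move=> u; rewrite !lt_min => /andP[/andP[u1 u2] /andP[u3 u4]].
  have fy0 : f y = 0 by rewrite /f Pq subrr mul0r expr0n /= mul0r.
  rewrite fy0 subr0 mul0r subr0.
  have [->|uy] := eqVneq u y; first by rewrite fy0 subrr nm0 mulr0.
  have u0 : 0 < nm (u - y) by rewrite nm_gt0 subr_eq0.
  have /andP[_ b1] : c1 <= nm (P.[u] * T u) <= c2 by apply: hc; rewrite u0.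
  have b2 : nm (W u) <= M.
    by apply: hM; have := nmD (u - y) y; rewrite subrK; lra.
  have -> : f u = (u - y) ^+ 2 * (q.[u] ^+ 2 * (P.[u] * T u * W u - P.[u])).
    by rewrite /f !Pq; ring.
  have b3 : nm P.[u] <= K.
    rewrite Pq nmM; have := qK u u2; have := nm_ge0 q.[u]; nra.
  have b4 : nm (q.[u] ^+ 2 * (P.[u] * T u * W u - P.[u])) <= L.
    rewrite nmM nmX; apply: (@le_trans _ _ (K ^+ 2 * (`|c2| * M + K))); last by rewrite lerDl.
    apply: ler_pM; rewrite ?sqr_ge0 ?nm_ge0//.
      by rewrite lerXn2r ?nnegrE ?nm_ge0// qK.
    apply: le_trans (nmB _ _) _; apply: lerD => //; rewrite nmM.
    by apply: ler_pM; rewrite ?nm_ge0//; apply: le_trans b1 (ler_norm _).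
  rewrite nmM nmX expr2 -mulrA mulrC; apply: ler_wpM2r; first exact: nm_ge0.
  apply: (@le_trans _ _ (nm (u - y) * L)); first by rewrite ler_wpM2l ?nm_ge0.
  by rewrite -ler_pdivlMr// ltW.
have fc : cont_on [set z | 0 < nm z <= 1] f.
  move=> y /= /andP[y0 y1] e e0.
  have [ylt|yge] := ltP (nm y) 1.
    have [|l hl] := fd y; first by rewrite y0.
    by have [d d0 hd] := cdiff_cont hl e0; exists d => // u _; exact: hd.
  have ys : y \notin s.
    by apply/negP => /s_in /andP[_]; rewrite ltNge yge.
  have [d1 d10 h1] := avoid_seq ys.
  pose D : set C := [set z | 0 < nm z <= 1 /\ z \notin s].
  have Dc : cont_on D f.
    apply: cont_onM; first by apply: cdiff_ccont => u _; exact: P3.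
    apply: cont_onB; last exact: cont_on_cst.
    apply: cont_onM => //; apply: cont_on_sub (wiener_cont hW) => u [/andP[_ ?] _] //.
  have Dy : D y by rewrite /D /= y0 y1.
  have [d d0 hd] := Dc y Dy e e0.
  exists (Num.min d d1); first by rewrite lt_min d0.
  by move=> u u01; rewrite lt_min => /andP[u1 /h1 u2]; apply: hd.
apply: (circle_unique fd fc _ z01) => y y1.
by rewrite /f TW1// subrr mulr0.
Qed.

Hypothesis PP_A : forall z, 0 < nm z <= 1 -> z \notin s -> P.[z] * PP z = A.[z].
Hypothesis T_PP : forall a, a \in s -> near_bdd (fun z => T z - PP z) (fun=> 1) a.

(** Write [W = P V] with [V] nonvanishing on the closed disc. Since [P T V = 1], boundedness of
    [T - PP] at the poles makes [1 - A V] divisible by [P]; with quotient [U], the extension is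
    [U / V]. *)
Lemma pole_split : exists S : C -> C,
  [/\ forall z, nm z < 1 -> exists l, cdiff S z l,
      cont_on [set z | nm z <= 1] S &
      forall z, nm z = 1 -> S z = T z - PP z].
Proof.
have s1 a : a \in s -> nm a < 1 by move=> /s_in /andP[].
have near_ok a : a \in s -> exists2 d : R, 0 < d & forall y, 0 < nm (y - a) < d ->
    [/\ 0 < nm y <= 1, y \notin s & T y * W y = 1].
  move=> /s_in /andP[a0 a1]; have [d d0 hd] := avoid_punctured s a.
  exists (Num.min d (Num.min (nm a) (1 - nm a))); first by rewrite !lt_min d0 a0 subr_gt0.
  move=> y /andP[y0]; rewrite !lt_min => /and3P[y1 y2 y3].
  have ys : y \notin s by apply: hd; rewrite y0.
  have y01 : 0 < nm y <= 1.
    by have := nm_subr y a; have := nm_subr a y; rewrite (nmC a); lra.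
  by split => //; exact: TW_eq1.
(* Near a pole [|W| = 1 / |T| <= |P| / c1], by the lower bound on [|P T|]; hence [P] divides [W]. *)
have [a sa|V [pV [hV WPV]]] := wiener_bdd_div hW s1.
  have [d [c1 [c2 [d0 c10 hc]]]] := T_pole sa; have [d' d0' hd'] := near_ok a sa.
  exists (Num.min d d'), c1^-1; split; first by rewrite lt_min d0.
  move=> y /andP[y0]; rewrite lt_min => /andP[y1 y2].
  have [_ _ TWy] : [/\ 0 < nm y <= 1, y \notin s & T y * W y = 1] by apply: hd'; rewrite y0.
  have /andP[b1 _] : c1 <= nm (P.[y] * T y) <= c2 by apply: hc; rewrite y0.
  rewrite mulrC ler_pdivlMr//; apply: le_trans (ler_wpM2l (nm_ge0 _) b1) _.
  by rewrite -nmM mulrCA (mulrC (W y)) TWy mulr1.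
(* At the origin this is the hypothesis on [W 0], elsewhere off the poles it is [T W = 1]. At a
   pole, [|P T| |V| = 1] nearby with [|P T| <= c2] keeps [V] away from 0. *)
have V0 z : nm z <= 1 -> V z != 0.
  move=> z1; have [zs|zs] := boolP (z \in s); last first.
    have [->|z0] := eqVneq z 0.
      by apply: contra W0 => /eqP h; rewrite WPV ?nm0// h mulr0.
    apply/negP => /eqP h; have := @TW_eq1 z; rewrite nm_gt0 z0 z1 WPV// h !mulr0.
    by move=> /(_ isT zs)/esym/eqP; rewrite oner_eq0.
  have [d [c1 [c2 [d0 c10 hc]]]] := T_pole zs; have [d' d0' hd'] := near_ok z zs.
  have c20 : 0 < c2.
    pose h := Num.min d d' / 2; have m0 : 0 < Num.min d d' by rewrite lt_min d0.
    have h0 : 0 < h by rewrite divr_gt0.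
    have := hc (z + rc h); rewrite (addrC z) addrK nm_rc gtr0_norm// h0 => /(_ _)/andP[].
      by have : h < Num.min d d' by [rewrite /h; lra]; rewrite lt_min => /andP[].
    by move=> ? ?; lra.
  apply/negP => /eqP Vz.
  have [l hl] := wiener_cdiff hV (s1 z zs).
  have [d1 d10 h1] := cdiff_cont hl (ltac:(by rewrite divr_gt0// mulr_gt0) : 0 < 1 / (2 * c2)).
  pose m := Num.min (Num.min d d') d1; have m0 : 0 < m by rewrite !lt_min d0 d0' d10.
  pose h := m / 2; have h0 : 0 < h by rewrite divr_gt0.
  have hm : h < m by rewrite /h; lra.
  move: hm; rewrite !lt_min => /andP[/andP[hd hd1] hd2].
  pose y := z + rc h; have yz : nm (y - z) = h by rewrite /y addrC addKr nm_rc gtr0_norm.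
  have [y01 ys TWy] := hd' y ltac:(by rewrite yz h0).
  have /andP[_ b1] := hc y ltac:(by rewrite yz h0).
  have := h1 y; rewrite yz Vz subr0 => /(_ hd2) b2.
  have : nm (P.[y] * T y) * nm (V y) = 1.
    rewrite -nmM -[RHS](nm1 R) -TWy WPV; last by case/andP: y01.
    by congr nm; rewrite /P; ring.
  have : nm (P.[y] * T y) * nm (V y) <= c2 * (1 / (2 * c2)) by apply: ler_pM; rewrite ?nm_ge0.
  have -> : c2 * (1 / (2 * c2)) = 1 / 2 by field; rewrite gt_eqF.
  lra.
have hAV := wienerB (wiener_poly 1%:P) (wienerM (wiener_poly A) hV).
have [a sa|U [pU [hU AVU]]] := wiener_bdd_div hAV s1.
  have [d [M [d0 hM]]] := T_PP sa; have [d' d0' hd'] := near_ok a sa.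
  have [M' M0' hM'] := wiener_bound hV.
  exists (Num.min d d'), (`|M| * M'); split; first by rewrite lt_min d0.
  move=> y /andP[y0]; rewrite lt_min => /andP[y1 y2].
  have [y01 ys TWy] := hd' y ltac:(by rewrite y0).
  have yle : nm y <= 1 by case/andP: y01.
  have -> : (1%:P : {poly C}).[y] - A.[y] * V y = (T y - PP y) * V y * P.[y].
    rewrite hornerC -PP_A// -[1]TWy WPV// /P; ring.
  rewrite !nmM ler_wpM2r ?nm_ge0//; apply: ler_pM; rewrite ?nm_ge0//; last exact: hM'.
  by have := hM y; rewrite y0 y1 nm1 mulr1 => /(_ isT) h; apply: le_trans h (ler_norm _).
exists (fun z => U z / V z); split.
- move=> z z1; have [l1 h1] := wiener_cdiff hU z1; have [l2 h2] := wiener_cdiff hV z1.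
  by eexists; apply: cdiffM h1 (cdiffV (V0 z (ltW z1)) h2).
- apply: cont_onM; first exact: wiener_cont hU.
  by apply: cont_onV => //; exact: wiener_cont hV.
- move=> z z1; have zle : nm z <= 1 by rewrite z1.
  have zs : z \notin s by apply/negP => /s1; rewrite z1 ltxx.
  have z01 : 0 < nm z <= 1 by rewrite z1 ltr01 lexx.
  have Pz : P.[z] != 0 by rewrite pp_poly_root.
  apply: (mulfI Pz); apply: (mulIf (V0 z zle)).
  rewrite mulrBr PP_A// mulrBl; have := AVU z zle; rewrite hornerC -/P => e.
  rewrite mulrA mulfVK ?V0// -e; congr (_ - _).
  by rewrite -(TW1 z1) WPV// /P; ring.
Qed.

End PoleDecomposition.

(** * Poles and principal parts in the disc variable *)

Section BoundStateData.
Variable R : realType.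
Local Notation C := (CC R).
Implicit Types (z a y w : C).

Lemma inv_if_neq0 b z : (inv_if b z != 0) = (z != 0).
Proof. by case: b; rewrite /inv_if //= invr_eq0. Qed.

Lemma inv_ifN b z : inv_if b (- z) = - inv_if b z.
Proof. by case: b; rewrite /inv_if //= invrN. Qed.

Lemma inv_if_eq b z a : (inv_if b z == inv_if b a) = (z == a).
Proof. by rewrite (inj_eq (can_inj (inv_ifK b))). Qed.

Lemma inv_if_nm1 b z : nm z = 1 -> nm (inv_if b z) = 1.
Proof. by case: b; rewrite /inv_if //= nmV => ->; rewrite invr1. Qed.

Lemma inv_if_lip b a : a != 0 -> exists d k1 k2 : R, [/\ 0 < d, 0 < k1, 0 < k2 &
  forall y, nm (y - a) < d -> y != 0 /\
    k1 * nm (y - a) <= nm (inv_if b y - inv_if b a) <= k2 * nm (y - a)].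
Proof.
move=> a0; have A0 : 0 < nm a by rewrite nm_gt0.
have y0 y : nm (y - a) < nm a / 2 -> nm a / 2 < nm y /\ nm y < 2 * nm a.
  by move=> h; have := nm_subr a y; have := nm_subr y a; rewrite (nmC a); lra.
have nz y : nm (y - a) < nm a / 2 -> y != 0.
  by move=> /y0 [h _]; rewrite -nm_gt0; lra.
case: b; rewrite /inv_if.
- exists (nm a / 2), (2 * nm a ^+ 2)^-1, (2 / nm a ^+ 2); split.
  + by rewrite divr_gt0.
  + by rewrite invr_gt0 mulr_gt0// exprn_gt0.
  + by rewrite divr_gt0// exprn_gt0.
  move=> y ya; have [h1 h2] := y0 y ya; have yn := nz y ya; split => //.
  have Y0 : 0 < nm y by rewrite nm_gt0.
  have -> : y^-1 - a^-1 = - (y - a) / (y * a) by field; rewrite yn a0.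
  rewrite nmM nmV nmM nmN.
  have e1 : nm (y - a) / (nm y * nm a) * (nm y * nm a) = nm (y - a).
    by rewrite divfK// mulf_neq0// gt_eqF.
  rewrite [X in X <= _]mulrC [X in _ && (_ <= X)]mulrC.
  apply/andP; split; apply: ler_wpM2l; rewrite ?nm_ge0//.
    by rewrite lef_pV2 ?posrE ?mulr_gt0 ?exprn_gt0// expr2 mulrA ler_pM2r// ltW.
  rewrite -[leRHS]invf_div lef_pV2 ?posrE ?mulr_gt0 ?divr_gt0 ?exprn_gt0//.
  by rewrite expr2 mulrAC ler_pM2r// ltW.
- exists (nm a / 2), 1, 1; split => //; first by rewrite divr_gt0.
  by move=> y /nz yn; rewrite !mul1r lexx.
Qed.

(** For [z = 1/w] the fraction [1 / (1/w - 1/a)] is [- a w / (w - a)]. The numerator is still a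
    polynomial, so principal parts in [z] stay rational in [w] with poles of the same order. *)
Definition vpoly b a : {poly C} := if b then (- a) *: 'X else 1%:P.

Lemma inv_if_subV b w a : w != 0 -> a != 0 ->
  (inv_if b w - inv_if b a)^-1 = (vpoly b a).[w] / (w - a).
Proof.
move=> w0 a0; case: b; rewrite /inv_if /vpoly; last by rewrite hornerC mul1r.
rewrite hornerZ hornerX; have [->|wa] := eqVneq w a; first by rewrite !subrr !invr0 mulr0.
have wa0 : w - a != 0 by rewrite subr_eq0.
have aw0 : a - w != 0 by rewrite subr_eq0 eq_sym.
have -> : w^-1 - a^-1 = (a - w) / (w * a) by field; rewrite w0 a0.
by field; rewrite wa0 aw0 w0 a0.
Qed.

(** Two-sided bounds in place of a limit: they survive the passage to [1/z], for which bilipschitz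
    estimates then suffice. *)
Definition pole_bd (T : C -> C) a (m : nat) := exists d c1 c2 : R, [/\ 0 < d, 0 < c1 &
  forall z, 0 < nm (z - a) < d -> c1 <= nm ((z - a) ^+ m * T z) <= c2].

Lemma pole_of_order_bd T a m : pole_of_order T a m -> pole_bd T a m.
Proof.
case=> L [L0 cv]; have nL : 0 < nm L by rewrite nm_gt0.
move/cvgrPdist_le : cv => /(_ (rc (nm L / 2))).
rewrite -rc0 rc_lt divr_gt0// => /(_ isT).
rewrite near_withinE => /nbhs_ballP [d /= d0 hd].
have [d0' dE] := posC d0; exists (complex.Re d), (nm L / 2), (2 * nm L); split => //.
  by rewrite divr_gt0.
move=> z /andP[z0 zd]; have := hd z; rewrite -ball_normE /= dE nm_ltE nmC => /(_ zd).
rewrite nm_leE -subr_eq0 -nm_gt0 => /(_ z0) h.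
set x := _ * _ in h *; have := nm_subr L x; have := nm_subr x L; rewrite (nmC x); lra.
Qed.

Definition ppart (T : C -> C) a m (t : nat -> C) := exists d M : R, 0 < d /\
  forall z, 0 < nm (z - a) < d -> nm (T z - \sum_(k < m) t k.+1 * (z - a) ^- k.+1) <= M.

Lemma principal_part_ppart T a m t : principal_part T a m t -> ppart T a m t.
Proof.
case=> d [M [d0 h]]; have [d0' dE] := posC d0.
exists (complex.Re d), (complex.Re M); split => // z /andP[z0 zd].
have := h z; rewrite dE nm_ltE zd -rc0 nmE rc_lt z0 => /(_ isT).
rewrite nmE lecE /= => /andP[_].
by rewrite big_add1 big_mkord.
Qed.

Lemma count_pp_poly (s : seq C) a : pp_poly s =
  ('X - a%:P) ^+ (count_mem a s) * pp_poly [seq x <- s | x != a].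
Proof.
elim: s => [|x s IH]; first by rewrite /pp_poly big_nil mul1r.
rewrite {1}/pp_poly big_cons -/(pp_poly s) IH /=; case: (eqVneq x a) => [->|xa] /=.
  by rewrite add1n exprS mulrA.
by rewrite add0n /pp_poly big_cons mulrCA.
Qed.

Variables (b : bool) (N : nat) (zs : 'I_N -> C) (ms : 'I_N -> nat).

Definition cdom : set C := [set z | z != 0 /\ nm (inv_if b z) <= 1].

Definition plist : seq C := flatten [seq nseq (ms j) (inv_if b (zs j)) ++
  nseq (ms j) (- inv_if b (zs j)) | j <- enum 'I_N].

Hypothesis zs_in : forall j, udom b (zs j).
Hypothesis zs_neq : forall i j, i != j -> zs i != zs j /\ zs i != - zs j.
Hypothesis ms_gt0 : forall j, (0 < ms j)%N.

Lemma zs0 j : zs j != 0. Proof. by case: (zs_in j). Qed.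

Lemma zsN j : zs j != - zs j.
Proof.
apply/negP => /eqP h; have := zs0 j; have : zs j + zs j = 0 by rewrite {1}h addNr.
by rewrite -mulr2n -mulr_natl => /eqP; rewrite mulf_eq0 pnatr_eq0 /= => ->.
Qed.

Lemma plistP w : reflect (exists j, w = inv_if b (zs j) \/ w = - inv_if b (zs j)) (w \in plist).
Proof.
apply: (iffP flatten_mapP) => [[j _]|[j h]].
  rewrite mem_cat !mem_nseq => /orP[/andP[_ /eqP ->]|/andP[_ /eqP ->]];
    exists j; by [left|right].
exists j; rewrite ?mem_enum// mem_cat !mem_nseq ms_gt0 /=.
by case: h => ->; rewrite eqxx ?orbT.
Qed.

Lemma plist_inv z : inv_if b z \in plist <-> pole_set zs z.
Proof.
split=> [/plistP [j h]|[j h]].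
  exists j; case: h => /(congr1 (inv_if b)); rewrite ?inv_ifN !inv_ifK; by [left|right].
apply/plistP; exists j; case: h => ->; [by left|by right; rewrite inv_ifN].
Qed.

Lemma plist_opp w : (- w \in plist) = (w \in plist).
Proof.
have imp u : u \in plist -> - u \in plist.
  move=> /plistP [j h]; apply/plistP; exists j.
  by case: h => ->; rewrite ?opprK; [right|left].
by apply/idP/idP => /imp //; rewrite opprK.
Qed.

Lemma plist_in w : w \in plist -> 0 < nm w < 1.
Proof.
move=> /plistP [j h]; have [z0 z1] := zs_in j.
have : 0 < nm (inv_if b (zs j)) < 1 by rewrite nm_gt0 inv_if_neq0 z0.
by case: h => ->; rewrite ?nmN.
Qed.

(** The points [zs i] and [- zs i] are pairwise distinct, so no two blocks of the list merge and
    each signed pole keeps its exact multiplicity. *)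
Lemma count_plist j e : count_mem ((-1) ^+ e * inv_if b (zs j)) plist = ms j.
Proof.
rewrite /plist count_flatten -map_comp sumnE big_map big_enum /= (bigD1 j)//= big1 ?addn0.
  rewrite count_cat !count_nseq /=.
  have ne : (- inv_if b (zs j) == inv_if b (zs j)) = false.
    by rewrite -inv_ifN inv_if_eq eq_sym; apply/negbTE/zsN.
  rewrite -signr_odd; case: (odd e); rewrite ?expr1 ?expr0 ?mulN1r ?mul1r eqxx ?ne.
    by rewrite eq_sym ne mul0n mul1n.
  by rewrite mul1n mul0n addn0.
move=> i ij; rewrite count_cat !count_nseq /=; have [h1 h2] := zs_neq ij.
have e1 : (inv_if b (zs i) == inv_if b (zs j)) = false by rewrite inv_if_eq; exact/negbTE.
have e2 : (inv_if b (zs i) == - inv_if b (zs j)) = false.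
  by rewrite -inv_ifN inv_if_eq; exact/negbTE.
rewrite -signr_odd; case: (odd e); rewrite ?expr1 ?expr0 ?mulN1r ?mul1r.
  by rewrite e2 eqr_opp e1.
by rewrite e1 eqr_oppLR e2.
Qed.

(** The data describe [T] at [zs j] only. The part at [- zs j] is its mirror image, with the sign
    that makes the total even in [z], as [T] will turn out to be. *)
Definition PPart (t : 'I_N -> nat -> C) (z : C) : C := \sum_(j < N) \sum_(k < ms j)
  t j k.+1 * ((z - zs j) ^- k.+1 + (-1) ^+ k.+1 * (z + zs j) ^- k.+1).

Let P := pp_poly plist.

Definition polyable (f : C -> C) := exists A : {poly C},
  forall w, 0 < nm w <= 1 -> w \notin plist -> P.[w] * f w = A.[w].

Lemma polyableD f g : polyable f -> polyable g -> polyable (fun w => f w + g w).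
Proof.
move=> [A hA] [B hB]; exists (A + B) => w w1 ws.
by rewrite mulrDr hA// hB// hornerD.
Qed.

Lemma polyableZ c f : polyable f -> polyable (fun w => c * f w).
Proof. by move=> [A hA]; exists (c *: A) => w w1 ws; rewrite mulrCA hA// hornerZ. Qed.

Lemma polyable_sum I (r : seq I) (F : I -> C -> C) : (forall i, polyable (F i)) ->
  polyable (fun w => \sum_(i <- r) F i w).
Proof.
move=> h; elim: r => [|i r IH].
  by exists 0 => w _ _; rewrite big_nil mulr0 hornerC.
have -> : (fun w => \sum_(j <- i :: r) F j w) = (fun w => F i w + \sum_(j <- r) F j w).
  by apply/funext => w; rewrite big_cons.
exact: polyableD.
Qed.

Lemma polyable_pole j e k : (k <= ms j)%N ->
  polyable (fun w => (inv_if b w - (-1) ^+ e * zs j) ^- k).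
Proof.
move=> km; pose a := (-1) ^+ e * inv_if b (zs j).
have ea : (-1) ^+ e * zs j = inv_if b a.
  rewrite /a -signr_odd; case: (odd e); rewrite ?expr1 ?expr0 ?mulN1r ?mul1r.
    by rewrite inv_ifN inv_ifK.
  by rewrite inv_ifK.
have a0 : a != 0 by rewrite mulf_neq0 ?signr_eq0// inv_if_neq0 zs0.
pose Q := pp_poly [seq x <- plist | x != a].
exists (vpoly b a ^+ k * (('X - a%:P) ^+ (ms j - k) * Q)) => w /andP[w0 _] ws.
have wa : w - a != 0.
  by rewrite subr_eq0; apply: contra ws => /eqP ->; apply/count_memPn; rewrite count_plist; apply/eqP; rewrite -lt0n.
rewrite nm_gt0 in w0.
rewrite ea -exprVn inv_if_subV// /P (count_pp_poly _ a) count_plist -/Q.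
rewrite !hornerM !horner_exp hornerXsubC -{1}(subnK km) exprD exprMn exprVn.
by field; rewrite expf_neq0.
Qed.

Lemma polyable_PPart t : polyable (fun w => PPart t (inv_if b w)).
Proof.
apply: polyable_sum => j; apply: polyable_sum => k; apply: polyableZ.
apply: polyableD; first by have := @polyable_pole j 0 k.+1 (ltn_ord k); rewrite expr0 mul1r.
apply: polyableZ; have := @polyable_pole j 1 k.+1 (ltn_ord k).
by rewrite expr1 mulN1r opprK.
Qed.

End BoundStateData.

(** * The transmission coefficient without its principal parts *)

Section Transmission.
Variable R : realType.
Local Notation C := (CC R).
Implicit Types (z a y w : C) (f g : C -> C).

Definition loc_bdd f z := exists d M : R, 0 < d /\ forall y, nm (y - z) < d -> nm (f y) <= M.

Lemma loc_bddD f g z : loc_bdd f z -> loc_bdd g z -> loc_bdd (fun y => f y + g y) z.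
Proof.
move=> [d [M [d0 h]]] [d' [M' [d0' h']]]; exists (Num.min d d'), (M + M').
split; first by rewrite lt_min d0.
move=> y; rewrite lt_min => /andP[/h a /h' b]; apply: le_trans (nmD _ _) _; exact: lerD.
Qed.

Lemma loc_bddZ c f z : loc_bdd f z -> loc_bdd (fun y => c * f y) z.
Proof.
move=> [d [M [d0 h]]]; exists d, (nm c * M); split => // y /h a.
by rewrite nmM ler_wpM2l ?nm_ge0.
Qed.

Lemma loc_bdd_sum I (r : seq I) (Q : pred I) (F : I -> C -> C) z : (forall i, Q i -> loc_bdd (F i) z) ->
  loc_bdd (fun y => \sum_(i <- r | Q i) F i y) z.
Proof.
move=> h; elim: r => [|i r IH].
  by exists 1, 0; split => // y _; rewrite big_nil nm0.
have -> : (fun y => \sum_(j <- i :: r | Q j) F j y) =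
    (fun y => (if Q i then F i y else 0) + \sum_(j <- r | Q j) F j y).
  by apply/funext => y; rewrite big_cons; case: (Q i) => //; rewrite add0r.
apply: loc_bddD IH; case E : (Q i); first exact: h.
by exists 1, 0; split => // y _; rewrite nm0.
Qed.

Lemma cont_loc_bdd f z : ccont_at f z -> loc_bdd f z.
Proof.
move=> /(_ 1 ltr01) [d d0 hd]; exists d, (1 + nm (f z)); split => // y /hd h.
by have := nm_subr (f y) (f z); lra.
Qed.

Lemma loc_bdd_pole c k z : z != c -> loc_bdd (fun y => (y - c) ^- k) z.
Proof.
move=> zc; apply: cont_loc_bdd; apply: cdiff_cont.
have := @poly_cdiff R (('X - c%:P) ^+ k) z.
have -> : horner (('X - c%:P) ^+ k) = fun y => (y - c) ^+ k.
  by apply/funext => y; rewrite horner_exp hornerXsubC.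
by apply: cdiffV; rewrite expf_neq0// subr_eq0.
Qed.

Variables (b : bool) (N : nat) (zs : 'I_N -> C) (ms : 'I_N -> nat) (t : 'I_N -> nat -> C).
Variables (T W : C -> C) (pW : nat -> {poly C}).
Hypothesis zs_in : forall j, udom b (zs j).
Hypothesis zs_neq : forall i j, i != j -> zs i != zs j /\ zs i != - zs j.
Hypothesis ms_gt0 : forall j, (0 < ms j)%N.
Hypothesis T_diff : forall z, udom b z -> ~ pole_set zs z -> exists l, cdiff T z l.
Hypothesis T_cont : cont_on (@cdom R b `\` pole_set zs) T.
Hypothesis T_ord : forall j, pole_bd T (zs j) (ms j) /\ pole_bd T (- zs j) (ms j).
Hypothesis T_part : forall j, ppart T (zs j) (ms j) (t j).
Hypothesis hW : wiener W pW.
Hypothesis W_even : forall w, nm w <= 1 -> W (- w) = W w.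
Hypothesis W0 : W 0 != 0.
Hypothesis TW1 : forall z, nm z = 1 -> T z * W (inv_if b z) = 1.

Let s := plist b zs ms.
Let Th w := T (inv_if b w).

Lemma plist_sgn a : a \in s -> exists j e, a = (-1) ^+ e * inv_if b (zs j).
Proof.
move=> /(plistP b zs ms_gt0) [j [->|->]].
  by exists j, 0%N; rewrite expr0 mul1r.
by exists j, 1%N; rewrite expr1 mulN1r.
Qed.

Lemma inv_if_sgn e z : inv_if b ((-1) ^+ e * z) = (-1) ^+ e * inv_if b z.
Proof.
rewrite -signr_odd; case: (odd e); rewrite ?expr1 ?expr0 ?mulN1r ?mul1r//.
exact: inv_ifN.
Qed.

Lemma Th_diff z : 0 < nm z < 1 -> z \notin s -> exists l, cdiff Th z l.
Proof.
move=> /andP[z0 z1] zs'; rewrite nm_gt0 in z0.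
have [||l hl] := T_diff (z := inv_if b z).
- by split; rewrite ?inv_if_neq0// inv_ifK.
- by move=> /(plist_inv b zs ms_gt0); rewrite inv_ifK => h; rewrite h in zs'.
by eexists; exact: cdiff_comp (inv_if_cdiff b z0) hl.
Qed.

Lemma Th_cont : cont_on [set z | 0 < nm z <= 1 /\ z \notin s] Th.
Proof.
apply: cont_on_comp T_cont.
  move=> z [/andP[z0 z1] zs']; rewrite nm_gt0 in z0; split.
    by split; rewrite ?inv_if_neq0// inv_ifK.
  by move=> /(plist_inv b zs ms_gt0); rewrite inv_ifK => h; rewrite h in zs'.
apply: cdiff_ccont => z [/andP[z0 _] _]; rewrite nm_gt0 in z0.
by eexists; exact: inv_if_cdiff.
Qed.

(** The distance to the pole changes by bounded factors under [inv_if], and the cofactor [Q] of the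
    pole in [pp_poly s] is nonzero there. *)
Lemma Th_pole a : a \in s -> exists d c1 c2 : R, [/\ 0 < d, 0 < c1 &
  forall y, 0 < nm (y - a) < d -> c1 <= nm ((pp_poly s).[y] * Th y) <= c2].
Proof.
move=> /plist_sgn [j [e ae]]; set m := ms j.
have a0 : a != 0 by rewrite ae mulf_neq0 ?signr_eq0// inv_if_neq0 (zs0 zs_in).
have ia : inv_if b a = (-1) ^+ e * zs j by rewrite ae inv_if_sgn inv_ifK.
have [d [c1 [c2 [d0 c10 hc]]]] : pole_bd T (inv_if b a) m.
  rewrite ia; have [h1 h2] := T_ord j.
  by rewrite -signr_odd; case: (odd e); rewrite ?expr1 ?expr0 ?mulN1r ?mul1r.
have [d1 [k1 [k2 [d10 k10 k20 hk]]]] := inv_if_lip b a0.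
pose Q := pp_poly [seq x <- s | x != a].
have Q0 : 0 < nm Q.[a] by rewrite nm_gt0 pp_poly_root mem_filter eqxx.
have [d2 d20 hq] := cdiff_cont (poly_cdiff Q a) (ltac:(by rewrite divr_gt0) : 0 < nm Q.[a] / 2).
have kd : 0 < Num.min d1 d2 by rewrite lt_min d10.
exists (Num.min (Num.min d1 d2) (d / k2)), (c1 / k2 ^+ m * (nm Q.[a] / 2)),
  (c2 / k1 ^+ m * (2 * nm Q.[a])); split.
- by rewrite lt_min kd divr_gt0.
- by rewrite mulr_gt0// divr_gt0// exprn_gt0.
move=> y /andP[y0]; rewrite !lt_min => /andP[/andP[y1 y2]]; rewrite ltr_pdivlMr// => y3.
have [yn /andP[l1 l2]] := hk y y1.
have := hc (inv_if b y); set x := inv_if b y - inv_if b a => hx.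
have /hx : 0 < nm x < d.
  apply/andP; split; first by apply: lt_le_trans l1; rewrite mulr_gt0.
  by apply: le_lt_trans l2 _; rewrite mulrC.
rewrite nmM nmX -/(Th y) => /andP[x1 x2].
have yq := hq y y2.
have q1 : nm Q.[a] / 2 <= nm Q.[y].
  by have := nm_subr Q.[a] Q.[y]; rewrite nmC; lra.
have q2 : nm Q.[y] <= 2 * nm Q.[a] by have := nm_subr Q.[y] Q.[a]; lra.
have -> : nm ((pp_poly s).[y] * Th y) = nm (y - a) ^+ m * nm (Th y) * nm Q.[y].
  rewrite (count_pp_poly s a) /s ae count_plist// -ae -/s -/Q -/m.
  by rewrite hornerM horner_exp hornerXsubC !nmM nmX mulrAC.
have t0 := nm_ge0 (Th y).
have m1 : (k1 * nm (y - a)) ^+ m <= nm x ^+ m.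
  by rewrite lerXn2r ?nnegrE ?nm_ge0// ltW// mulr_gt0.
have m2 : nm x ^+ m <= (k2 * nm (y - a)) ^+ m.
  by rewrite lerXn2r ?nnegrE ?nm_ge0// ltW// mulr_gt0.
rewrite !exprMn in m1 m2.
have K1 : 0 < k1 ^+ m by rewrite exprn_gt0. have K2 : 0 < k2 ^+ m by rewrite exprn_gt0.
have u1 : 0 <= c1 / k2 ^+ m by rewrite divr_ge0// ltW.
have u2 : 0 <= nm Q.[a] / 2 by rewrite divr_ge0// nm_ge0.
have u3 : 0 <= nm (y - a) ^+ m * nm (Th y) by rewrite mulr_ge0// exprn_ge0// nm_ge0.
have u4 := nm_ge0 Q.[y].
apply/andP; split; apply: ler_pM => //.
- rewrite ler_pdivrMr//; apply: le_trans x1 _.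
  rewrite [leRHS](_ : _ = k2 ^+ m * nm (y - a) ^+ m * nm (Th y)); last by ring.
  by rewrite ler_wpM2r.
- rewrite ler_pdivlMr//; apply: le_trans _ x2.
  rewrite [leLHS](_ : _ = k1 ^+ m * nm (y - a) ^+ m * nm (Th y)); last by ring.
  by rewrite ler_wpM2r.
Qed.

Lemma ThW1 z : nm z = 1 -> Th z * W z = 1.
Proof. by move=> z1; rewrite /Th -{2}(inv_ifK b z) TW1// inv_if_nm1. Qed.

Lemma Th_W z : 0 < nm z <= 1 -> z \notin s -> Th z * W z = 1.
Proof.
apply: (TW_eq1 _ Th_diff Th_cont Th_pole hW ThW1) => a.
exact: (plist_in zs_in ms_gt0).
Qed.

(** Evenness of [T] is inherited from its reciprocal [W]. *)
Lemma Th_even z : 0 < nm z <= 1 -> z \notin s -> Th (- z) = Th z.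
Proof.
move=> z1 zs'; have h1 := Th_W z1 zs'; have h2 := @Th_W (- z).
have Wz : W z != 0 by apply/negP => /eqP h; move/eqP: h1; rewrite h mulr0 eq_sym oner_eq0.
apply: (mulIf Wz); rewrite h1 -h2 ?nmN ?W_even//; first by case/andP: z1.
by rewrite /s plist_opp.
Qed.

Lemma PPart_even z : PPart zs ms t (- z) = PPart zs ms t z.
Proof.
apply: eq_bigr => j _; apply: eq_bigr => k _; congr (_ * _).
have e1 : - z - zs j = -1 * (z + zs j) by ring.
have e2 : - z + zs j = -1 * (z - zs j) by ring.
rewrite e1 e2 !exprMn !invfM -!exprVn invrN1 addrC; congr (_ + _).
by rewrite mulrA -exprMn mulrNN mul1r expr1n mul1r.
Qed.

(** At [zs j] the own principal part cancels by hypothesis and all other summands are regular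
    there. *)
Lemma Th_PP a : a \in s -> near_bdd (fun y => Th y - PPart zs ms t (inv_if b y)) (fun=> 1) a.
Proof.
have main j : near_bdd (fun y => Th y - PPart zs ms t (inv_if b y)) (fun=> 1) (inv_if b (zs j)).
  have z0 : zs j != 0 by exact: (zs0 zs_in).
  have a0 : inv_if b (zs j) != 0 by rewrite inv_if_neq0.
  have [d [M [d0 hM]]] := T_part j.
  pose own z := \sum_(k < ms j) t j k.+1 * (z - zs j) ^- k.+1.
  have [d' [M' [d0' hM']]] : loc_bdd (fun z => PPart zs ms t z - own z) (zs j).
    have -> : (fun z => PPart zs ms t z - own z) = (fun z =>
        \sum_(k < ms j) t j k.+1 * ((-1) ^+ k.+1 * (z - - zs j) ^- k.+1) +
        \sum_(i < N | i != j) \sum_(k < ms i)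
          t i k.+1 * ((z - zs i) ^- k.+1 + (-1) ^+ k.+1 * (z - - zs i) ^- k.+1)).
      apply/funext => z; rewrite /PPart (bigD1 j)//= addrAC; congr (_ + _).
        by rewrite /own -sumrB; apply: eq_bigr => k _; rewrite opprK; ring.
      by apply: eq_bigr => i _; apply: eq_bigr => k _; rewrite opprK.
    apply: loc_bddD.
      apply: loc_bdd_sum => k _; do 2 apply: loc_bddZ; apply: loc_bdd_pole; exact: (zsN zs_in).
    apply: loc_bdd_sum => i ij; apply: loc_bdd_sum => k _; apply: loc_bddZ.
    have [h1 h2] := zs_neq ij.
    apply: loc_bddD; first by apply: loc_bdd_pole; rewrite eq_sym.
    by apply: loc_bddZ; apply: loc_bdd_pole; rewrite -eqr_oppLR eq_sym.
  have [d1 [k1 [k2 [d10 k10 k20 hk]]]] := inv_if_lip b a0.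
  exists (Num.min d1 (Num.min (d / k2) (d' / k2))), (M + M').
  split; first by rewrite !lt_min d10 !divr_gt0.
  move=> y /andP[y0]; rewrite !lt_min !ltr_pdivlMr// => /and3P[y1 y2 y3].
  have [yn] := hk y y1; rewrite inv_ifK => /andP[l1 l2].
  have x0 : 0 < nm (inv_if b y - zs j) by apply: lt_le_trans l1; rewrite mulr_gt0.
  have x1 : nm (inv_if b y - zs j) < d by apply: le_lt_trans l2 _; rewrite mulrC.
  have x2 : nm (inv_if b y - zs j) < d' by apply: le_lt_trans l2 _; rewrite mulrC.
  have := hM (inv_if b y); rewrite x0 x1 => /(_ isT) b1.
  have b2 := hM' _ x2; rewrite nm1 mulr1.
  have -> : Th y - PPart zs ms t (inv_if b y) = (T (inv_if b y) - own (inv_if b y)) -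
    (PPart zs ms t (inv_if b y) - own (inv_if b y)) by rewrite /Th; ring.
  by apply: le_trans (nmB _ _) _; exact: lerD.
move=> as_; have /plistP := as_; move=> /(_ ms_gt0) [j [->//|ae]].
(* At the opposite pole the bound is reflected, using that both [Th] and the sum of the principal
   parts are even. *)
have [d [M [d0 hM]]] := main j.
have [d1 d10 h1] := avoid_punctured s a.
have /andP[a0 a1] := plist_in zs_in ms_gt0 as_.
exists (Num.min (Num.min d d1) (Num.min (nm a) (1 - nm a))), M.
split; first by rewrite !lt_min d0 d10 a0 subr_gt0.
move=> y /andP[y0]; rewrite !lt_min => /andP[/andP[y1 y2] /andP[y3 y4]].
have ys : y \notin s by apply: h1; rewrite y0.
have y01 : 0 < nm y <= 1.
  by have := nm_subr y a; have := nm_subr a y; rewrite (nmC a); lra.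
rewrite -Th_even// -PPart_even -inv_ifN.
have e : nm (- y - inv_if b (zs j)) = nm (y - a) by rewrite -nmN opprD !opprK ae opprK.
by apply: hM; rewrite e y0.
Qed.

Lemma transmission_split : exists S : C -> C,
  [/\ forall w, nm w < 1 -> exists l, cdiff S w l,
      cont_on [set w | nm w <= 1] S &
      forall z, nm z = 1 -> S (inv_if b z) = T z - PPart zs ms t z].
Proof.
have [A hA] := polyable_PPart zs_in zs_neq ms_gt0 t.
have sin a : a \in s -> 0 < nm a < 1 by exact: (plist_in zs_in ms_gt0).
have [S [h1 h2 h3]] := pole_split sin Th_diff Th_cont Th_pole hW W0 ThW1 hA Th_PP.
exists S; split; [exact: h1|exact: h2|move=> z z1].
by rewrite (h3 _ (inv_if_nm1 b z1)) /Th inv_ifK.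
Qed.

(* With [w = z] inside ([b = false]) and [w = 1/z] outside ([b = true]), the
   integrand is [S(w) G(w) dw] up to sign. *)
Lemma transmission_integral (G : C -> C) :
  (forall w, nm w < 1 -> exists l, cdiff G w l) -> cont_on [set w | nm w <= 1] G ->
  circ_int (fun z => (T z - PPart zs ms t z) * (z ^ (sg b - 1) * G (inv_if b z))) = 0.
Proof.
move=> Gd Gc; have [S [Sd Sc hS]] := transmission_split.
pose F w := S w * G w * w.
have Fd w : nm w < 1 -> exists l, cdiff F w l.
  move=> w1; have [l1 h1] := Sd w w1; have [l2 h2] := Gd w w1.
  by eexists; exact: cdiffM (cdiffM h1 h2) (cdiff_id w).
have Fc : cont_on [set w | nm w <= 1] F.
  by apply: cont_onM; [exact: cont_onM|exact: cont_on_id].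
have F0 : F 0 = 0 by rewrite /F mulr0.
have E z : nm z = 1 -> (T z - PPart zs ms t z) * (z ^ (sg b - 1) * G (inv_if b z)) * z = F (inv_if b z).
  move=> z1; have z0 := nm1_neq0 z1; rewrite /F hS//.
  have -> : inv_if b z = z ^ (sg b - 1) * z.
    rewrite mulrC expz_pred//; have := inv_if_exp b z 1.
    by rewrite expr1 mulr1.
  by ring.
case: (b) E => E.
  by rewrite (circ_discN Fd Fc).
by rewrite (circ_disc Fd Fc).
Qed.

End Transmission.

(** * One row of the Marchenko equation *)

Section Algebra.
Variable R : realType.
Local Notation C := (CC R).

Lemma odd_abszD (x y : int) : odd (absz (x + y)) = odd (absz x) (+) odd (absz y).
Proof. lia. Qed.

Lemma odd_sg b (x : int) : odd (absz (sg b * x)) = odd (absz x).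
Proof. by rewrite abszM oddM; case: b. Qed.

Lemma signz_odd (x : int) : odd (absz x) -> (-1) ^ x = -1 :> C.
Proof.
case: x => n /= no; first by rewrite -exprnP -signr_odd no expr1.
by rewrite NegzE -exprnN -exprVn invrN1 -signr_odd /= no expr1.
Qed.

Lemma sum_from (M u : nat) (f : nat -> C) : (u <= M)%N ->
  \sum_(0 <= k < M | (u <= k)%N) f k = \sum_(l < M - u) f (u + l)%N.
Proof.
move=> uM; rewrite (big_cat_nat (leq0n u) uM)/= big_nat_cond big1 ?add0r.
  rewrite -{1}[u]add0n big_addn big_mkord; apply: eq_big => [l|l _]; rewrite addnC//.
  by rewrite leq_addr.
by move=> k /andP[/andP[_ ku]]; rewrite leqNgt ku.
Qed.

(** An exchange of convolutions: if [y = G * x] then [E * y = G * (E * x)], read as coefficients of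
    truncated polynomials. Collecting the terms with [t] by the index of [E * x] produces the sums
    of the norming constants. *)
Lemma dependency_sum (M : nat) (t E G x y : nat -> C) :
  (forall k, (k < M)%N -> y k = \sum_(l < k.+1) G (k - l)%N * x l) ->
  \sum_(k < M) t k.+1 * \sum_(i < k.+1) E (k - i)%N * y i =
  \sum_(u < M) (\sum_(l < M - u) t (u + 1 + l)%N * G l) * \sum_(i < u.+1) E (u - i)%N * x i.
Proof.
move=> hy; pose pE := \poly_(i < M) E i; pose pG := \poly_(i < M) G i.
pose px := \poly_(i < M) x i.
have lt_sub k i : (k < M)%N -> (k - i < M)%N by move=> h; rewrite (leq_ltn_trans _ h)// leq_subr.
have lt_ord k (i : 'I_k.+1) : (k < M)%N -> (i < M)%N.
  by move=> h; rewrite (leq_ltn_trans _ h)// -ltnS.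
have cM (a c : nat -> C) k : (k < M)%N ->
    (\poly_(i < M) a i * \poly_(i < M) c i)`_k = \sum_(i < k.+1) a (k - i)%N * c i.
  move=> kM; rewrite coefMr; apply: eq_bigr => i _.
  by rewrite !coef_poly lt_sub// (lt_ord _ _ kM).
have conv k : (k < M)%N -> \sum_(i < k.+1) E (k - i)%N * y i =
    \sum_(u < k.+1) G (k - u)%N * \sum_(i < u.+1) E (u - i)%N * x i.
  move=> kM; transitivity ((pE * (pG * px))`_k).
    rewrite coefMr; apply: eq_bigr => i _; have iM := lt_ord _ i kM.
    by rewrite cM// coef_poly lt_sub// hy.
  rewrite mulrCA coefMr; apply: eq_bigr => i _; have iM := lt_ord _ i kM.
  by rewrite cM// coef_poly lt_sub.
set X := fun u => \sum_(i < u.+1) E (u - i)%N * x i.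
transitivity (\sum_(0 <= k < M) \sum_(0 <= u < M | (u <= k)%N) t k.+1 * G (k - u)%N * X u).
  rewrite big_mkord; apply: eq_bigr => k _; rewrite conv// mulr_sumr.
  rewrite -(big_mkord xpredT (fun u => t k.+1 * (G (k - u)%N * X u))).
  rewrite (big_nat_widen _ _ M)//=; apply: eq_big => [u|u _]; first by rewrite ltnS.
  by rewrite mulrA.
rewrite (exchange_big_dep_nat xpredT)//= big_mkord; apply: eq_bigr => u _.
rewrite sum_from ?(ltnW (ltn_ord u))// mulr_suml; apply: eq_bigr => l _.
by rewrite addKn addnAC addn1.
Qed.

End Algebra.

(** * Integrals of series and residues of principal parts *)

Section MarchenkoHalf.
Variable R : realType.
Local Notation C := (CC R).
Implicit Types (z a y w : C) (f g : C -> C).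

Lemma circ_big I (r : seq I) (F : I -> C -> C) : (forall i, circ_cont (F i)) ->
  circ_cont (fun z => \sum_(i <- r) F i z) /\
  circ_int (fun z => \sum_(i <- r) F i z) = \sum_(i <- r) circ_int (F i).
Proof.
move=> h; elim: r => [|i r [IH1 IH2]].
  have -> : (fun z => \sum_(i <- [::]) F i z) = (fun=> 0 * 0).
    by apply/funext => z; rewrite big_nil mul0r.
  split; first exact: circ_cont_cst.
  by rewrite big_nil (@circZ R 0 (fun=> 0)) ?mul0r//; exact: circ_cont_cst.
have -> : (fun z => \sum_(j <- i :: r) F j z) = (fun z => F i z + \sum_(j <- r) F j z).
  by apply/funext => z; rewrite big_cons.
by split; [exact: circ_contD|rewrite circD// big_cons IH2].
Qed.

Lemma slim_big I (r : seq I) (u : I -> nat -> C) (l : I -> C) : (forall i, slim (u i) (l i)) ->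
  slim (fun s => \sum_(i <- r) u i s) (\sum_(i <- r) l i).
Proof.
move=> h; elim: r => [|i r IH].
  have -> : (fun s => \sum_(i <- [::]) u i s) = fun=> 0 by apply/funext => s; rewrite big_nil.
  by rewrite big_nil; exact: slim_cst.
have -> : (fun s => \sum_(j <- i :: r) u j s) = (fun s => u i s + \sum_(j <- r) u j s).
  by apply/funext => s; rewrite big_cons.
by rewrite big_cons; exact: slimD.
Qed.

Lemma circ_cont_bounded f : circ_cont f -> exists2 M : R, 0 < M & forall z, nm z = 1 -> nm (f z) <= M.
Proof.
move=> hf; have p0 := ltW (tpi_gt0 R).
have rc' : rcont 0 (2 * pi) (fun t => nm (f (expi t))).
  move=> x xab e e0; have [d d0 hd] := hf x xab e e0; exists d => // y yab yx.
  have := hd y yab yx; rewrite ler_norml; have := nm_subr (f (expi y)) (f (expi x)).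
  by have := nm_subr (f (expi x)) (f (expi y)); rewrite (nmC (f (expi x))); lra.
have [c _ hc] := EVT_max p0 (rcont_within rc').
exists (nm (f (expi c)) + 1); first by rewrite ltr_wpDl// nm_ge0.
move=> z /polar_unit [t tab ->]; apply: (@le_trans _ _ (nm (f (expi c)))); last by rewrite lerDl.
by apply: hc; rewrite in_itv.
Qed.

Lemma circ_cont_inv b f : cont_on [set w | nm w <= 1] f -> circ_cont (fun z => f (inv_if b z)).
Proof.
move=> hf; apply: cont_on_circ; apply: (cont_on_comp (E := [set w | nm w <= 1])) hf.
  by move=> z /= z1; rewrite inv_if_nm1.
by apply: cdiff_ccont => z /= /nm1_neq0 z0; eexists; exact: inv_if_cdiff.
Qed.

(** A continuous factor is bounded on the circle and the polynomials converge uniformly there, so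
    integration is termwise. *)
Lemma circ_wiener_lim b (h g : C -> C) p : circ_cont h -> wiener g p ->
  slim (fun s => circ_int (fun z => h z * (p s).[inv_if b z])) (circ_int (fun z => h z * g (inv_if b z))).
Proof.
move=> hh hg; have [M M0 hM] := circ_cont_bounded hh.
apply: circ_slim.
- by apply: circ_contM => //; apply: circ_cont_inv; exact: wiener_cont hg.
- move=> s; apply: circ_contM => //; apply: circ_cont_inv.
  exact: wiener_cont (wiener_poly (p s)).
- move=> e e0; have [s0 hs] := wiener_unif hg (ltac:(by rewrite divr_gt0) : 0 < e / M).
  exists s0 => s ss z z1; rewrite -mulrBr nmM.
  have -> : e = M * (e / M) by field; rewrite gt_eqF.
  by apply: ler_pM; rewrite ?nm_ge0 ?hM//; apply: hs => //; rewrite inv_if_nm1.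
Qed.

Lemma circ_poly b (h : C -> C) (P : {poly C}) (n : nat) : circ_cont h -> (size P <= n)%N ->
  circ_int (fun z => h z * P.[inv_if b z]) =
  \sum_(l < n) P`_l * circ_int (fun z => h z * z ^ (sg b * l%:Z)).
Proof.
move=> hh sn; have hF (l : 'I_n) : circ_cont (fun z => h z * z ^ (sg b * l%:Z)).
  by apply: circ_contM => //; exact: circ_cont_expz.
rewrite (@eq_circ _ _ (fun z => \sum_(l < n) P`_l * (h z * z ^ (sg b * l%:Z)))); last first.
  move=> z z1; rewrite (horner_coef_wide _ sn) mulr_sumr; apply: eq_bigr => l _.
  by rewrite inv_if_exp mulrCA.
have [_ ->] := @circ_big _ (index_enum 'I_n) (fun l z => P`_(l : 'I_n) * (h z * z ^ (sg b * l%:Z)))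
  (fun l => circ_contM (circ_cont_cst _) (hF l)).
by apply: eq_bigr => l _; rewrite circZ.
Qed.

(** The limit is the Taylor coefficient of [z^q f] in product form; for each monomial of the series
    the product rule is [ez_vandermonde]. *)
Lemma jet_mul_lim b tau (q : int) g p f (n : nat -> nat) z k : analytic g p ->
  (forall z, udom b z -> f z = z ^ tau * g (inv_if b z)) -> udom b z ->
  (forall s, (size (p s) <= n s)%N) ->
  slim (fun s => \sum_(l < n s) (p s)`_l * ez z (tau + sg b * l%:Z + q) k)
    (\sum_(i < k.+1) ez z q (k - i) * (derive1n i f z / i`!%:R)).
Proof.
move=> hg hf zU hn; have [z0 _] := zU.
apply: (@eq_slim _ (fun s => \sum_(i < k.+1) ez z q (k - i) *
    \sum_(l < n s) (p s)`_l * ez z (tau + sg b * l%:Z) i)).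
  move=> s; under eq_bigr do rewrite mulr_sumr.
  rewrite exchange_big /=; apply: eq_bigr => l _.
  rewrite (ez_vandermonde _ _ _ z0) mulr_sumr; apply: eq_bigr => i _.
  by ring.
apply: slim_big => i; apply: slimZ; exact: (termwise_lim _ hg hf zU hn).
Qed.

Lemma PPart_cont b N (zs : 'I_N -> C) ms t : (forall j, udom b (zs j)) -> circ_cont (PPart zs ms t).
Proof.
move=> hz; have a1 j : nm (zs j) != 1.
  have [_] := hz j; apply: contraTN => /eqP h; by rewrite inv_if_nm1// ltxx.
have pc j e k : circ_cont (fun z => (z - (-1) ^+ e * zs j) ^- k).
  have := @J_cont R ((-1) ^+ e * zs j) 0 k.
  rewrite nmM nmX nmN nm1 expr1n mul1r => /(_ (a1 j)); apply: eq_circ_cont => z _.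
  by rewrite expr0z mul1r.
apply: (circ_big _ _).1 => j; apply: (circ_big _ _).1 => k.
apply: circ_contM; first exact: circ_cont_cst.
apply: circ_contD.
  by have := pc j 0%N k.+1; rewrite expr0 mul1r.
apply: circ_contM; first exact: circ_cont_cst.
by have := pc j 1%N k.+1; rewrite expr1 mulN1r opprK.
Qed.

(** The exponents for which [z^q] adds no residue on the relevant side: no pole at 0 inside, and
    enough decay at infinity outside. *)
Definition qdom b (q : int) := if b then q < 0 else 0 <= q.

(** Oddness of [q] makes the residues at [zs j] and [- zs j] equal, whence the 2; [sg b] records the
    side of the contour on which the poles lie. *)
Lemma PPart_monomial b N (zs : 'I_N -> C) ms t (q : int) : (forall j, udom b (zs j)) ->
  qdom b q -> odd (absz q) ->
  circ_int (fun z => PPart zs ms t z * z ^ q) =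
  2 * (sg b)%:~R * \sum_(j < N) \sum_(k < ms j) t j k.+1 * ez (zs j) q k.
Proof.
move=> hz hq oq; have z0 j : zs j != 0 by have [] := hz j.
have a1 j e : nm ((-1) ^+ e * zs j) != 1.
  rewrite nmM nmX nmN nm1 expr1n mul1r.
  have [_] := hz j; apply: contraTN => /eqP h; by rewrite inv_if_nm1// ltxx.
have J j e k : Jc ((-1) ^+ e * zs j) q k.+1 = (sg b)%:~R * ez ((-1) ^+ e * zs j) q k.
  have s0 : (-1) ^+ e * zs j != 0 by rewrite mulf_neq0 ?signr_eq0.
  have := hz j; move: hq; rewrite /qdom /udom /inv_if /sg; case: (b); case: q {oq} => q // _ [_ h].
    rewrite J_outer ?mulN1r//; move: h; rewrite nmV invf_lt1 ?nm_gt0// => h.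
    by rewrite nmM nmX nmN nm1 expr1n mul1r.
  by rewrite J_inner ?mul1r//; rewrite nmM nmX nmN nm1 expr1n mul1r.
have Jcont j e k : circ_cont (fun z => z ^ q * (z - (-1) ^+ e * zs j) ^- k) by exact: J_cont.
pose F j k z := t j k.+1 * (z ^ q * (z - (-1) ^+ 0 * zs j) ^- k.+1) +
  t j k.+1 * ((-1) ^+ k.+1 * (z ^ q * (z - (-1) ^+ 1 * zs j) ^- k.+1)).
have Fc1 j k : circ_cont (fun z => t j k.+1 * (z ^ q * (z - (-1) ^+ 0 * zs j) ^- k.+1)).
  by apply: circ_contM; [exact: circ_cont_cst|exact: Jcont].
have Fc2 j k : circ_cont (fun z => (-1) ^+ k.+1 * (z ^ q * (z - (-1) ^+ 1 * zs j) ^- k.+1)).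
  by apply: circ_contM; [exact: circ_cont_cst|exact: Jcont].
have Fc3 j k : circ_cont (fun z => t j k.+1 * ((-1) ^+ k.+1 * (z ^ q * (z - (-1) ^+ 1 * zs j) ^- k.+1))).
  by apply: circ_contM; [exact: circ_cont_cst|exact: Fc2].
have Fc j k : circ_cont (F j k) by exact: circ_contD.
have Fs j : circ_cont (fun z => \sum_(k < ms j) F j k z) by apply: (circ_big _ _).1 => k.
rewrite (@eq_circ _ _ (fun z => \sum_(j < N) \sum_(k < ms j) F j k z)); last first.
  move=> z _; rewrite mulr_suml; apply: eq_bigr => j _; rewrite mulr_suml; apply: eq_bigr => k _.
  by rewrite /F expr0 mul1r expr1 mulN1r opprK; ring.
rewrite (circ_big _ Fs).2 mulr_sumr; apply: eq_bigr => j _.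
rewrite (circ_big _ (fun k : 'I_(ms j) => Fc j k)).2 mulr_sumr; apply: eq_bigr => k _.
rewrite /F circD// !circZ//.
rewrite -[circ_int _]/(Jc ((-1) ^+ 0 * zs j) q k.+1) J.
rewrite -[circ_int _]/(Jc ((-1) ^+ 1 * zs j) q k.+1) J.
rewrite expr0 mul1r expr1 mulN1r.
have := ez_parity (zs j) q k; rewrite (signz_odd R oq) opprK mul1r => e.
by rewrite [X in _ + t j k.+1 * X]mulrCA (mulrC _ (ez (- zs j) q k)) e; ring.
Qed.

End MarchenkoHalf.

(** * The scalar Marchenko equation for one component *)

Section MarchenkoRow.
Variable R : realType.
Local Notation C := (CC R).

Variables (b : bool) (N : nat) (zs : 'I_N -> C) (ms : 'I_N -> nat) (t gam : 'I_N -> nat -> C).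
Variables (T W : C -> C) (pW : nat -> {poly C}).
Hypothesis zs_in : forall j, udom b (zs j).
Hypothesis zs_neq : forall i j, i != j -> zs i != zs j /\ zs i != - zs j.
Hypothesis ms_gt0 : forall j, (0 < ms j)%N.
Hypothesis T_diff : forall z, udom b z -> ~ pole_set zs z -> exists l, cdiff T z l.
Hypothesis T_cont : cont_on (@cdom R b `\` pole_set zs) T.
Hypothesis T_ord : forall j, pole_bd T (zs j) (ms j) /\ pole_bd T (- zs j) (ms j).
Hypothesis T_part : forall j, ppart T (zs j) (ms j) (t j).
Hypothesis hW : wiener W pW.
Hypothesis W_even : forall w, nm w <= 1 -> W (- w) = W w.
Hypothesis W0 : W 0 != 0.
Hypothesis TW1 : forall z, nm z = 1 -> T z * W (inv_if b z) = 1.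

Variables (n m : int) (phi psi chi Rf gphi gpsi : C -> C) (pphi : nat -> {poly C}) (kap : nat -> C).
Hypothesis nm_lt : n < m.
Hypothesis hgphi : wiener gphi pphi.
Hypothesis pphi_even : forall s, evenp (pphi s).
Hypothesis phiE : forall z, cdom b z -> phi z = z ^ (- (sg b * n)) * gphi (inv_if b z).
Hypothesis hgpsi : wiener gpsi (fun L => \poly_(l < L) kap l).
Hypothesis kap_odd : forall l, odd l -> kap l = 0.
Hypothesis psiE : forall z, cdom b z -> psi z = z ^ (sg b * n) * gpsi (inv_if b z).
Hypothesis Rf_cont : circ_cont Rf.
Hypothesis chi_cont : circ_cont chi.
Hypothesis rel : forall z, nm z = 1 -> T z * phi z = chi z + Rf z * psi z.
Hypothesis dep : forall j k, (k < ms j)%N -> derive1n k phi (zs j) =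
  \sum_(l < k.+1) 'C(k, l)%:R * gam j (k - l)%N * derive1n l psi (zs j).
Hypothesis chi_odd : odd (absz (m - n)) -> circ_int (fun z => chi z * z ^ (sg b * m - 1)) = 0.

Implicit Types z : C.

Let c j u := - (2 * (sg b)%:~R) * \sum_(l < (ms j - u)%N) t j (u + 1 + l)%N * gam j l / (l`!)%:R.

Let omega (k : int) : C := if odd (absz k) then 0 else
  circ_int (fun z => Rf z * z ^ (sg b * k - 1)) +
  \sum_(j < N) \sum_(u < ms j) c j u * ez (zs j) (sg b * k - 1) u.

Lemma udom_cdom z : udom b z -> cdom b z.
Proof. by move=> [z0 z1]; split => //; exact: ltW. Qed.

Lemma circ_cdom z : nm z = 1 -> cdom b z.
Proof. by move=> z1; split; [exact: nm1_neq0|rewrite inv_if_nm1]. Qed.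

Lemma T_circ : circ_cont T.
Proof.
apply: cont_on_circ; apply: cont_on_sub T_cont => z /= z1; split; first exact: circ_cdom.
move=> [j zj]; have [_] := zs_in j.
have : nm (zs j) = 1 by case: zj => e; rewrite -z1 e ?nmN.
by move=> h; rewrite inv_if_nm1// ltxx.
Qed.

Let jphi j i := derive1n i phi (zs j) / i`!%:R.
Let jpsi j i := derive1n i psi (zs j) / i`!%:R.
Let q0 := sg b * m - 1.
Let Phi j k := \sum_(i < k.+1) ez (zs j) q0 (k - i) * jphi j i.
Let Psi j k := \sum_(i < k.+1) ez (zs j) q0 (k - i) * jpsi j i.

(** Division by factorials absorbs the binomial coefficients, and the dependency relations become a
    plain convolution of Taylor coefficients. *)
Lemma jet_dep j k : (k < ms j)%N ->
  jphi j k = \sum_(l < k.+1) (gam j (k - l)%N / (k - l)`!%:R) * jpsi j l.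
Proof.
move=> kM; rewrite /jphi dep// mulr_suml; apply: eq_bigr => l _.
have lk : (l <= k)%N by rewrite -ltnS.
rewrite /jpsi -(bin_fact lk) !natrM.
have h1 := fact_neq0 R l; have h2 := fact_neq0 R (k - l).
have h3 : 'C(k, l)%:R != 0 :> C by rewrite pnatr_eq0 -lt0n bin_gt0.
by field; rewrite h1 h2 h3.
Qed.

Lemma residue_sum : 2 * (sg b)%:~R * \sum_(j < N) \sum_(k < ms j) t j k.+1 * Phi j k =
  - \sum_(j < N) \sum_(u < ms j) c j u * Psi j u.
Proof.
rewrite mulr_sumr -sumrN; apply: eq_bigr => j _.
rewrite (dependency_sum (M := ms j) (t j) (fun k => ez (zs j) q0 k)
  (G := fun l => gam j l / l`!%:R) (x := jpsi j)); last exact: jet_dep.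
rewrite mulr_sumr -sumrN; apply: eq_bigr => u _; rewrite /c /Psi !mulNr opprK mulrA.
by congr (_ * _ * _); apply: eq_bigr => l _; rewrite mulrA.
Qed.

(** [T] is split into its extendable part, whose integral is 0, and its principal parts, whose
    integral is computed on each monomial of the series of [phi] and reassembled into Taylor
    coefficients of [z^q0 phi]. *)
Lemma phi_integral : ~~ odd (absz (m - n)) ->
  circ_int (fun z => T z * phi z * z ^ q0) =
  2 * (sg b)%:~R * \sum_(j < N) \sum_(k < ms j) t j k.+1 * Phi j k.
Proof.
move=> ev; pose PP := PPart zs ms t.
have PPc : circ_cont PP by exact: (PPart_cont ms t zs_in).
have gc : circ_cont (fun z => gphi (inv_if b z)) by apply: circ_cont_inv; exact: wiener_cont hgphi.
have phic : circ_cont (fun z => z ^ (- (sg b * n) + q0) * gphi (inv_if b z)).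
  by apply: circ_contM => //; exact: circ_cont_expz.
have phiq z : nm z = 1 -> phi z * z ^ q0 = z ^ (- (sg b * n) + q0) * gphi (inv_if b z).
  move=> z1; rewrite phiE; last exact: circ_cdom.
  by rewrite (expfzDr (- (sg b * n)) q0 (nm1_neq0 z1)); ring.
rewrite (@eq_circ _ _ (fun z => (T z - PP z) * (z ^ (- (sg b * n) + q0) * gphi (inv_if b z)) +
    PP z * (z ^ (- (sg b * n) + q0) * gphi (inv_if b z)))); last first.
  by move=> z z1; rewrite -phiq//; ring.
have Tc := T_circ.
rewrite circD; [|by apply: circ_contM => //; exact: circ_contB|exact: circ_contM].
(* This is where [n < m] enters: the exponent [sg b * (m - n) - 1] is [sg b - 1] plus a nonnegative
   power [d] of the disc variable, which [transmission_integral] accepts. *)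
have [d md] : exists d : nat, m - n = d.+1%:Z.
  have : 0 < m - n by rewrite subr_gt0.
  by case: (m - n) => [[|d]|d] // _; exists d.
have e0 : - (sg b * n) + q0 = sg b * (m - n) - 1 by rewrite /q0; ring.
have -> : circ_int (fun z => (T z - PP z) * (z ^ (- (sg b * n) + q0) * gphi (inv_if b z))) = 0.
  have gd w : nm w < 1 -> exists l, cdiff (fun w => w ^+ d * gphi w) w l.
    move=> w1; have [l hl] := wiener_cdiff hgphi w1.
    have h := @poly_cdiff R 'X^d w.
    have eX : horner ('X^d : {poly C}) = fun w => w ^+ d by apply/funext => u; rewrite hornerXn.
    by rewrite eX in h; eexists; exact: cdiffM h hl.
  have gct : cont_on [set w | nm w <= 1] (fun w => w ^+ d * gphi w).
    by apply: cont_onM; [apply: cont_onX; exact: cont_on_id|exact: wiener_cont hgphi].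
  have := transmission_integral zs_in zs_neq ms_gt0 T_diff T_cont T_ord T_part hW W_even W0 TW1 gd gct.
  move=> h; rewrite -[RHS]h; apply: eq_circ => z z1; congr (_ * _).
  rewrite inv_if_exp mulrA -(expfzDr _ _ (nm1_neq0 z1)); congr (_ ^ _ * _).
  by rewrite e0 md -addn1 PoszD; ring.
rewrite add0r.
have hc : circ_cont (fun z => PP z * z ^ (- (sg b * n) + q0)).
  by apply: circ_contM => //; exact: circ_cont_expz.
rewrite (@eq_circ _ _ (fun z => PP z * z ^ (- (sg b * n) + q0) * gphi (inv_if b z))); last first.
  by move=> z _; rewrite mulrA.
apply: (slim_uniq (circ_wiener_lim b hc hgphi)).
have ga := wiener_analytic hgphi.
have phiU z : udom b z -> phi z = z ^ (- (sg b * n)) * gphi (inv_if b z).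
  by move=> /udom_cdom; exact: phiE.
pose sz s := size (pphi s).
(* Both sides are limits along the same polynomials [pphi s], so it suffices to compare them for
   each [s]. *)
have L := slimZ (2 * (sg b)%:~R) (slim_big (index_enum 'I_N) (fun j =>
  slim_big (index_enum 'I_(ms j)) (fun k : 'I_(ms j) => slimZ (t j k.+1)
   (jet_mul_lim q0 k ga phiU (zs_in j) (fun s => leqnn (sz s)))))).
apply: eq_slim L => s; rewrite (circ_poly b hc (leqnn _)).
rewrite mulr_sumr.
transitivity (\sum_(l < sz s) (pphi s)`_l * (2 * (sg b)%:~R * \sum_(j < N) \sum_(k < ms j)
   t j k.+1 * ez (zs j) (- (sg b * n) + sg b * l%:Z + q0) k)).
  under [RHS]eq_bigr do rewrite mulrA mulr_sumr.
  rewrite exchange_big /=; apply: eq_bigr => j _.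
  under [RHS]eq_bigr do rewrite mulr_sumr.
  rewrite exchange_big /= mulr_sumr; apply: eq_bigr => k _.
  rewrite mulrA mulr_sumr; apply: eq_bigr => l _; ring.
apply: eq_bigr => l _.
(* Only even [l] survive; as [m - n] is even too, the exponent [sg b * (m - n + l) - 1] is odd, as
   [PPart_monomial] needs. *)
have [lo|le] := boolP (odd l); first by rewrite pphi_even// !mul0r.
congr (_ * _).
have e1 : - (sg b * n) + q0 + sg b * l%:Z = sg b * (m - n + l%:Z) - 1 by rewrite e0; ring.
rewrite (@eq_circ _ _ (fun z => PP z * z ^ (sg b * (m - n + l%:Z) - 1))); last first.
  by move=> z z1; rewrite -mulrA -(expfzDr _ _ (nm1_neq0 z1)) e1.
rewrite (PPart_monomial ms t zs_in).
- by rewrite -e1 addrAC.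
- rewrite /qdom md; case: (b); rewrite /sg.
    by rewrite mulN1r -opprD oppr_lt0 -!PoszD.
  by rewrite mul1r -[d.+1]addn1 PoszD addrAC addrK -PoszD.
- by rewrite odd_abszD odd_sg odd_abszD (negPf ev) /= (negPf le).
Qed.

Lemma kap_size L : (size (\poly_(l < L) kap l) <= L)%N.
Proof. exact: size_poly. Qed.

Lemma psi_residue j u :
  slim (fun L => \sum_(l < L) kap l * ez (zs j) (sg b * (n + l%:Z + m) - 1) u) (Psi j u).
Proof.
have psiU z : udom b z -> psi z = z ^ (sg b * n) * gpsi (inv_if b z).
  by move=> /udom_cdom; exact: psiE.
have := jet_mul_lim q0 u (wiener_analytic hgpsi) psiU (zs_in j) kap_size.
apply: eq_slim => L; apply: eq_bigr => l _; rewrite coef_poly ltn_ord; congr (_ * ez _ _ _).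
by rewrite /q0; ring.
Qed.

Lemma psi_integral :
  slim (fun L => \sum_(l < L) kap l * circ_int (fun z => Rf z * z ^ (sg b * (n + l%:Z + m) - 1)))
    (circ_int (fun z => Rf z * psi z * z ^ q0)).
Proof.
have hc : circ_cont (fun z => Rf z * z ^ (sg b * n + q0)).
  by apply: circ_contM => //; exact: circ_cont_expz.
rewrite (@eq_circ _ _ (fun z => Rf z * z ^ (sg b * n + q0) * gpsi (inv_if b z))); last first.
  move=> z z1; rewrite psiE; last exact: circ_cdom.
  by rewrite (expfzDr (sg b * n) q0 (nm1_neq0 z1)); ring.
apply: eq_slim (circ_wiener_lim b hc hgpsi) => L; rewrite (circ_poly b hc (kap_size L)).
apply: eq_bigr => l _; rewrite coef_poly ltn_ord; congr (_ * _); apply: eq_circ => z z1.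
rewrite -mulrA -(expfzDr _ _ (nm1_neq0 z1)); congr (_ * _ ^ _).
by rewrite /q0; ring.
Qed.

(** The scattering relation integrated against [z^q0], the residues of [T phi] being moved to [psi]
    by the dependency relations. The sum starts at [l = 0], so it still contains the term that later
    becomes the isolated kernel. *)
Theorem marchenko_row :
  slim (fun L => \sum_(l < L) kap l * omega (n + l%:Z + m))
    (- circ_int (fun z => chi z * z ^ (sg b * m - 1))).
Proof.
have par l : odd (absz (n + l%:Z + m)) = odd (absz (m - n)) (+) odd l.
  have -> : n + l%:Z + m = (m - n + l%:Z) + 2 * n by ring.
  by rewrite odd_abszD odd_abszD abszM oddM /= addbF.
(* For odd [m - n] everything vanishes: [kap l] for odd [l], the kernel for even [l], and the
   right-hand side by [chi_odd]. *)
have [od|ev] := boolP (odd (absz (m - n))).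
  rewrite chi_odd// oppr0; apply: eq_slim (slim_cst 0) => L; rewrite big1// => l _.
  rewrite /omega par od; have [lo|le] := boolP (odd l); first by rewrite kap_odd// mul0r.
  by rewrite mulr0.
have Lim := slimD psi_integral (slim_big (index_enum 'I_N) (fun j =>
  slim_big (index_enum 'I_(ms j)) (fun u : 'I_(ms j) => slimZ (c j u) (psi_residue j u)))).
have Tc := T_circ.
have phc : circ_cont phi.
  apply: (@eq_circ_cont _ (fun z => z ^ (- (sg b * n)) * gphi (inv_if b z))).
    by move=> z z1; rewrite phiE//; exact: circ_cdom.
  apply: circ_contM; first exact: circ_cont_expz.
  by apply: circ_cont_inv; exact: wiener_cont hgphi.
have psc : circ_cont psi.
  apply: (@eq_circ_cont _ (fun z => z ^ (sg b * n) * gpsi (inv_if b z))).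
    by move=> z z1; rewrite psiE//; exact: circ_cdom.
  apply: circ_contM; first exact: circ_cont_expz.
  by apply: circ_cont_inv; exact: wiener_cont hgpsi.
have e1 : circ_int (fun z => T z * phi z * z ^ q0) =
    circ_int (fun z => chi z * z ^ q0) + circ_int (fun z => Rf z * psi z * z ^ q0).
  rewrite -circD; do ?[exact: circ_cont_expz | apply: circ_contM => //]; last first.
    by apply: eq_circ => z z1; rewrite rel// mulrDl.
have e2 : circ_int (fun z => Rf z * psi z * z ^ q0) +
    \sum_(j < N) \sum_(u < ms j) c j u * Psi j u = - circ_int (fun z => chi z * z ^ (sg b * m - 1)).
  have := phi_integral ev; rewrite residue_sum e1 -/q0 => /eqP; rewrite -subr_eq0 opprK.
  by rewrite -addrA addr_eq0 => /eqP ->; rewrite opprK.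
rewrite -e2; apply: eq_slim Lim => L.
rewrite [RHS](eq_bigr (fun l : 'I_L => kap l * circ_int (fun z => Rf z * z ^ (sg b * (n + (l : nat)%:Z + m) - 1)) +
  kap l * \sum_(j < N) \sum_(u < ms j) c j u * ez (zs j) (sg b * (n + (l : nat)%:Z + m) - 1) u)); last first.
  move=> l _; rewrite /omega par (negPf ev) /=.
  have [lo|le] := boolP (odd l); first by rewrite kap_odd// !mul0r addr0.
  by rewrite -mulrDr.
rewrite big_split /=; congr (_ + _).
under [RHS]eq_bigr do rewrite mulr_sumr.
rewrite [RHS]exchange_big /=; apply: eq_bigr => j _.
under [RHS]eq_bigr do rewrite mulr_sumr.
rewrite [RHS]exchange_big /=; apply: eq_bigr => u _.
by rewrite mulr_sumr; apply: eq_bigr => l _; rewrite mulrCA.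
Qed.

End MarchenkoRow.

(** * Series expansions of the Jost solutions *)

Section Decay.
Variable R : realType.
Local Notation C := (CC R).

Lemma ev_bounded (u : nat -> R) (M : R) k0 : (forall k, (k0 <= k)%N -> u k <= M) ->
  exists2 K : R, 0 < K & forall k, u k <= K.
Proof.
move=> h; exists (\sum_(i < k0) `|u i| + `|M| + 1).
  by rewrite ltr_wpDl// addr_ge0// sumr_ge0.
move=> k; have s0 : 0 <= \sum_(i < k0) `|u i| by apply: sumr_ge0.
have [kk|kk] := ltnP k k0.
  rewrite (bigD1 (Ordinal kk))//=; have : 0 <= \sum_(i < k0 | i != Ordinal kk) `|u i| by apply: sumr_ge0.
  have := ler_norm (u k); have := normr_ge0 M; lra.
by have := h k kk; have := ler_norm M; lra.
Qed.

(** Quadratic decay is stated with [1 / ((k+1)(k+2))] because this is a difference of consecutive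
    terms [1/(k+1)], the telescoping form that the recursion expects. *)
Lemma decay_bound (f : nat -> C) (g : nat -> nat) k0 :
  slim (fun k => (k%:R : C) ^+ 2 * f k) 0 ->
  (forall k, (k0 <= k)%N -> (k.+2 <= 2 * g k)%N) ->
  exists2 K : R, 0 < K & forall k, (k0 <= k)%N -> nm (f (g k)) <= K / (k.+1%:R * k.+2%:R).
Proof.
move=> lim hg; have [s0 hs] := lim 1 ltr01.
pose u k := if (k0 <= k)%N then nm (f (g k)) * (k.+1%:R * k.+2%:R) else 0.
(* The hypothesis [k + 2 <= 2 g(k)] gives [(k+1)(k+2) <= 4 g(k)^2], hence the 4; [2 * s0] guarantees
   [s0 <= g k]. *)
have [k|K K0 hK] := @ev_bounded u 4 (2 * s0 + k0)%N.
  move=> kk; rewrite /u (leq_trans (leq_addl _ _) kk).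
  have k0k : (k0 <= k)%N by exact: leq_trans (leq_addl _ _) kk.
  have g2 := hg k k0k; have sg0 : (s0 <= g k)%N by lia.
  have := hs (g k) sg0; rewrite sub0r nmN nmM nmX nm_nat => h.
  have e1 : k.+1%:R * k.+2%:R <= 4 * (g k)%:R ^+ 2 :> R.
    by rewrite -natrX -!natrM ler_nat; nia.
  have f0 := nm_ge0 (f (g k)).
  apply: le_trans (ler_wpM2l f0 e1) _; rewrite mulrCA.
  by rewrite -[leRHS]mulr1 ler_pM2l// mulrC.
exists K => // k kk; rewrite ler_pdivlMr ?mulr_gt0//.
by have := hK k; rewrite /u kk.
Qed.

Lemma lim_slim (f : nat -> C) l : f @ \oo --> l -> slim f l.
Proof. by move/cvg_natP. Qed.

Lemma rapid_bound (q : int -> C) (n : int) : rapid_decay q -> exists2 K : R, 0 < K &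
  forall k : nat, nm (q (n + k%:Z)) <= K / (k.+1%:R * k.+2%:R) /\
                  nm (q (n - k%:Z)) <= K / (k.+1%:R * k.+2%:R).
Proof.
move=> /(_ 2%N) [/lim_slim hp /lim_slim hm].
(* From this threshold on, [|n + k|] and [|n - k|] are at least [(k + 2) / 2], and the signs of
   [n + k] and [n - k] are settled. *)
pose k0 := (2 * absz n + 2)%N.
have hp' : slim (fun k => (k%:R : C) ^+ 2 * q k%:Z) 0 by apply: eq_slim hp => k.
have hm' : slim (fun k => (k%:R : C) ^+ 2 * q (- k%:Z)) 0.
  by apply: eq_slim hm => k; rewrite abszN.
have [K1 K10 h1] := @decay_bound _ (fun k => absz (n + k%:Z)) k0 hp' ltac:(rewrite /k0; lia).
have [K2 K20 h2] := @decay_bound _ (fun k => absz (n - k%:Z)) k0 hm' ltac:(rewrite /k0; lia).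
have pos k : 0 < k.+1%:R * k.+2%:R :> R by rewrite mulr_gt0.
pose u k := Num.max (nm (q (n + k%:Z))) (nm (q (n - k%:Z))) * (k.+1%:R * k.+2%:R).
have [k kk|K K0 hK] := @ev_bounded u (Num.max K1 K2) k0.
  rewrite /u -ler_pdivlMr// ge_max; apply/andP; split.
    have := h1 k kk; rewrite (_ : Posz (absz (n + k%:Z)) = n + k%:Z); last by rewrite /k0 in kk; lia.
    by move=> h; apply: le_trans h _; rewrite ler_pM2r ?invr_gt0// le_max lexx.
  have := h2 k kk; rewrite (_ : - Posz (absz (n - k%:Z)) = n - k%:Z); last by rewrite /k0 in kk; lia.
  by move=> h; apply: le_trans h _; rewrite ler_pM2r ?invr_gt0// le_max lexx orbT.
exists K => // k; have := hK k; rewrite /u -ler_pdivlMr// ge_max => /andP[a b]; by split.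
Qed.

End Decay.

(** * The step matrices of (Q) as summable perturbations *)

Section JostSeries.
Variable R : realType.
Local Notation C := (CC R).

Definition mk2 T (x1 x2 x3 x4 : T) (i j : 'I_2) : T :=
  if i == ord0 then (if j == ord0 then x1 else x2) else (if j == ord0 then x3 else x4).

Lemma sum2 (V : nmodType) (F : 'I_2 -> V) : \sum_j F j = F ord0 + F ord_max.
Proof. by rewrite big_ord_recl big_ord1; congr (_ + F _); apply: val_inj. Qed.

Lemma ord2P (i : 'I_2) : i = ord0 \/ i = ord_max.
Proof. by case: i => [[|[|i]] h] //; [left|right]; apply: val_inj. Qed.

Definition Epoly b : {poly C} := (sg b)%:~R *: ('X^2 - 1).
Definition Fpoly b : {poly C} := if b then 1 else 'X^2.

Lemma Epoly_even b : evenp (Epoly b).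
Proof. by move=> [|[|[|l]]] //= lo; rewrite coefZ coefB coefXn coef1 subr0 mulr0. Qed.

Lemma Fpoly_even b : evenp (Fpoly b).
Proof. by case: b => -[|[|[|l]]] //= lo; rewrite /Fpoly ?coefXn ?coef1. Qed.

Lemma Epoly_pn b : pn 1 (Epoly b) <= 2.
Proof.
rewrite /Epoly pnZ//; have -> : nm ((sg b)%:~R : C) = 1.
  by case: b; rewrite /sg ?mulrN1z ?nmN nm1.
rewrite mul1r; apply: le_trans (pnB _ _ ler01) _.
by rewrite pnXn expr1n -polyC1 pnCst nm1.
Qed.

Lemma Fpoly_pn b : pn 1 (Fpoly b) <= 1.
Proof.
by case: b; rewrite /Fpoly ?pnXn ?expr1n// -polyC1 pnCst nm1.
Qed.

Lemma inv_if_mul b (w : C) : w != 0 ->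
  [/\ w * inv_if b w = (Fpoly b).[w], w * (inv_if b w)^-1 = (Fpoly (~~ b)).[w] &
      w * (inv_if b w - (inv_if b w)^-1) = (Epoly b).[w]].
Proof.
move=> w0; rewrite /Epoly hornerZ hornerD hornerN hornerXn -polyC1 hornerC.
case: b; rewrite /inv_if /Fpoly /sg /= ?hornerXn -?polyC1 ?hornerC ?mulrN1z ?invrK;
   split; by field.
Qed.

Variables (b : bool) (q r : int -> C).

(* The component normalised to 1 at infinity: the second one for [psi] and
   [phibar], the first one for [psibar] and [phi]. *)
Definition cpsi : 'I_2 := if b then ord0 else ord_max.
Definition cphi : 'I_2 := if b then ord_max else ord0.
Definition dexp (c i : 'I_2) : nat := if i == c then 0 else 2.

(* With [w = inv_if b z], the vectors [w^(-(n+k)) psi_(n+k)], resp.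
   [w^(n-k) phi_(n-k)], satisfy the recursion with diagonal [w^dexp] and
   perturbation [Mpsi], resp. [Mphi], where [Epoly = w (z - 1/z)] and
   [Fpoly = w z]. *)
Definition Mpsi (n : int) (k : nat) : 'I_2 -> 'I_2 -> {poly C} :=
  let q := q (n + k%:Z) in let r := r (n + k%:Z) in
  mk2 0 (q *: Epoly b) (r *: Fpoly b) ((q * r) *: Epoly b).

Definition Mphi (n : int) (k : nat) : 'I_2 -> 'I_2 -> {poly C} :=
  let q := q (n - k.+1%:Z) in let r := r (n - k.+1%:Z) in
  mk2 ((q * r) *: Epoly b) (- q *: Epoly b) (- r *: Fpoly b) 0.

Lemma dexp_even c i : ~~ odd (dexp c i).
Proof. by rewrite /dexp; case: eqP. Qed.

Lemma evenpZ (x : C) P : evenp P -> evenp (x *: P).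
Proof. by move=> h l lo; rewrite coefZ h// mulr0. Qed.

Lemma evenp0 : evenp (0 : {poly C}).
Proof. by move=> l _; rewrite coef0. Qed.

Lemma Mpsi_even n k i j : evenp (Mpsi n k i j).
Proof.
have [->|->] := ord2P i; have [->|->] := ord2P j; rewrite /Mpsi /mk2 /=;
  by [exact: evenp0|apply: evenpZ; exact: Epoly_even|apply: evenpZ; exact: Fpoly_even].
Qed.

Lemma Mphi_even n k i j : evenp (Mphi n k i j).
Proof.
have [->|->] := ord2P i; have [->|->] := ord2P j; rewrite /Mphi /mk2 /=;
  by [exact: evenp0|apply: evenpZ; exact: Epoly_even|apply: evenpZ; exact: Fpoly_even].
Qed.

Hypothesis hq : rapid_decay q.
Hypothesis hr : rapid_decay r.

Lemma tail_diff (K : R) k : K / k.+1%:R - K / k.+2%:R = K / (k.+1%:R * k.+2%:R).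
Proof. by field; rewrite -!natr1; have := ler0n R k; lra. Qed.

Lemma tail_lim (K : R) : 0 < K -> forall e, 0 < e ->
  exists k0, forall k, (k0 <= k)%N -> K / k.+1%:R <= e.
Proof.
move=> K0 e e0; exists (Num.trunc (K / e)).+1 => k kk.
rewrite ler_pdivrMr// mulrC -ler_pdivrMr//; apply: ltW.
apply: lt_trans (truncnS_gt _) _; rewrite ltr_nat; exact: leq_trans kk _.
Qed.

(** The product of the two entries decays like [D^2], and one factor [D] is given away because
    [D <= 1]. *)
Lemma entries_bound (x y : C) (D K K' : R) : 0 < K' -> nm x <= K * D -> nm y <= K' * D -> 0 <= D -> D <= 1 ->
  0 <= K ->
  2 * nm x + nm y + 2 * (nm x * nm y) <= (2 * K + K' + 2 * (K * K')) * D.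
Proof.
move=> K'0 hx hy D0 D1 K0.
have y1 : nm y <= K' by nra.
have : nm x * nm y <= K * D * K' by apply: ler_pM; rewrite ?nm_ge0.
by nra.
Qed.

Lemma psi_tail n : exists2 K : R, 0 < K & forall k,
  \sum_i \sum_j pn 1 (Mpsi n k i j) <= K / k.+1%:R - K / k.+2%:R.
Proof.
have [K1 K10 h1] := rapid_bound n hq; have [K2 K20 h2] := rapid_bound n hr.
exists (2 * K1 + K2 + 2 * (K1 * K2)).
  by rewrite addr_gt0// ?addr_gt0// !mulr_gt0.
move=> k; rewrite tail_diff.
have [a _] := h1 k; have [c _] := h2 k.
have D0 : 0 <= (k.+1%:R * k.+2%:R)^-1 :> R by rewrite invr_ge0 mulr_ge0.
have D1 : (k.+1%:R * k.+2%:R)^-1 <= 1 :> R.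
  by rewrite invf_le1 ?mulr_gt0// -natrM ler1n.
apply: le_trans (entries_bound K20 a c D0 D1 (ltW K10)).
rewrite sum2 !sum2 /Mpsi /mk2 /= pn0 add0r; move: (Epoly b) (Fpoly b) (Epoly_pn b) (Fpoly_pn b) => P Q e1 e2.
rewrite !pnZ// nmM.
have n1 := nm_ge0 (q (n + k%:Z)); have n2 := nm_ge0 (r (n + k%:Z)).
have n3 := mulr_ge0 n1 n2.
have := ler_wpM2l n1 e1; have := ler_wpM2l n2 e2; have := ler_wpM2l n3 e1; lra.
Qed.

Lemma phi_tail n : exists2 K : R, 0 < K & forall k,
  \sum_i \sum_j pn 1 (Mphi n k i j) <= K / k.+1%:R - K / k.+2%:R.
Proof.
(* The base site is [n - 1] because level [k] of [Mphi] involves the potentials at [n - (k + 1)]. *)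
have [K1 K10 h1] := rapid_bound (n - 1) hq; have [K2 K20 h2] := rapid_bound (n - 1) hr.
exists (2 * K1 + K2 + 2 * (K1 * K2)).
  by rewrite addr_gt0// ?addr_gt0// !mulr_gt0.
move=> k; rewrite tail_diff.
have en : n - 1 - k%:Z = n - k.+1%:Z by rewrite -addn1 PoszD; ring.
have [_ a] := h1 k; have [_ c] := h2 k; rewrite en in a c.
have D0 : 0 <= (k.+1%:R * k.+2%:R)^-1 :> R by rewrite invr_ge0 mulr_ge0.
have D1 : (k.+1%:R * k.+2%:R)^-1 <= 1 :> R.
  by rewrite invf_le1 ?mulr_gt0// -natrM ler1n.
apply: le_trans (entries_bound K20 a c D0 D1 (ltW K10)).
rewrite sum2 !sum2 /Mphi /mk2 /= pn0 addr0; move: (Epoly b) (Fpoly b) (Epoly_pn b) (Fpoly_pn b) => P Q e1 e2.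
rewrite !pnZ// !nmN nmM.
have n1 := nm_ge0 (q (n - k.+1%:Z)); have n2 := nm_ge0 (r (n - k.+1%:Z)).
have n3 := mulr_ge0 n1 n2.
have := ler_wpM2l n1 e1; have := ler_wpM2l n2 e2; have := ler_wpM2l n3 e1; lra.
Qed.

End JostSeries.

(** * Jost solutions as power series *)

Section JostExpansion.
Variable R : realType.
Local Notation C := (CC R).

Lemma udom_inv b (w : C) : 0 < nm w < 1 -> udom b (inv_if b w).
Proof.
by move=> /andP[w0 w1]; split; [rewrite inv_if_neq0 -nm_gt0|rewrite inv_ifK].
Qed.

Lemma cdom_inv b (w : C) : 0 < nm w <= 1 -> cdom b (inv_if b w).
Proof.
by move=> /andP[w0 w1]; split; [rewrite inv_if_neq0 -nm_gt0|rewrite inv_ifK].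
Qed.

Lemma exprz_cont (D : set C) (p : int) : (forall z, D z -> z != 0) -> cont_on D (fun z => z ^ p).
Proof. by move=> D0; apply: cdiff_ccont => z /D0 z0; eexists; exact: exprz_cdiff. Qed.

Lemma inv_if_cont_on b (D : set C) : (forall z, D z -> z != 0) -> cont_on D (inv_if b).
Proof. by move=> D0; apply: cdiff_ccont => z /D0 z0; eexists; exact: inv_if_cdiff. Qed.

(* The power series solution agrees with [F] on the circle by uniqueness for the
   recursion, hence on the punctured disc by [circle_unique]. *)
Lemma jost_core b (c : 'I_2) (d : 'I_2 -> nat) (M : nat -> 'I_2 -> 'I_2 -> {poly C}) (K : R)
    (F : nat -> 'I_2 -> C -> C) (e : nat -> int) :
  d c = 0%N -> (forall i, ~~ odd (d i)) -> (forall k i j, evenp (M k i j)) -> 0 < K ->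
  (forall k, \sum_i \sum_j pn 1 (M k i j) <= K / k.+1%:R - K / k.+2%:R) ->
  (forall k i z, udom b z -> exists l, cdiff (F k i) z l) ->
  (forall k i, cont_on (@cdom R b) (F k i)) ->
  (forall z, nm z = 1 -> forall k i, z ^ (- e k) * F k i z =
     zstep d M k (inv_if b z) (fun j => z ^ (- e k.+1) * F k.+1 j z) i) ->
  (forall z, nm z = 1 -> forall i, slim (fun k => z ^ (- e k) * F k i z) (i == c)%:R) ->
  exists g : nat -> 'I_2 -> C -> C,
  [/\ forall k i, exists2 p, wiener (g k i) p & forall s, evenp (p s),
      forall k i, g k i 0 = zstep d M k 0 (fun j => g k.+1 j 0) i,
      forall i, slim (fun k => g k i 0) (i == c)%:R &
      forall k i z, cdom b z -> F k i z = z ^ (e k) * g k i (inv_if b z)].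
Proof.
move=> dc dev Mev K0 hM Fd Fc Frec Flim.
have tau0 k : 0 <= K / k.+1%:R by rewrite divr_ge0// ltW.
have taul := tail_lim K0.
pose g := jsol dc tau0 taul hM; exists g; split.
- move=> k i; exists (fun s => jpoly c d M k s i); first exact: jsol_wiener.
  by move=> s; exact: jpoly_even.
- by move=> k i; apply: jsol_rec; rewrite nm0.
- by move=> i; apply: jsol_lim; rewrite nm0.
move=> k i z [z0 z1].
pose h w := inv_if b w ^ (- e k) * F k i (inv_if b w) - g k i w.
suff h0 : h (inv_if b z) = 0.
  move: h0; rewrite /h inv_ifK => /eqP; rewrite subr_eq0 => /eqP <-.
  by rewrite mulrA -expfzDr// subrr expr0z mul1r.
have pos (w : C) : 0 < nm w -> w != 0 by rewrite nm_gt0.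
apply: circle_unique; last by rewrite nm_gt0 inv_if_neq0 z0.
- move=> w w01; have /andP[/pos w0 w1] := w01.
  have iw := inv_if_cdiff b w0; have u := udom_inv b w01.
  have [l1 h1] := Fd k i _ u; have [l2 h2] := wiener_cdiff (jsol_wiener dc tau0 taul hM k i) w1.
  have iw0 : inv_if b w != 0 by rewrite inv_if_neq0.
  by eexists; exact: cdiffB (cdiffM (cdiff_comp iw (exprz_cdiff (- e k) iw0)) (cdiff_comp iw h1)) h2.
- have D0 (w : C) : 0 < nm w <= 1 -> w != 0 by case/andP => /pos.
  apply: cont_onB; last first.
    by apply: cont_on_sub (wiener_cont (jsol_wiener dc tau0 taul hM k i)) => w /andP[].
  apply: cont_onM.
    apply: (@cont_on_comp _ _ [set z | z != 0] (fun z => z ^ (- e k)) (inv_if b)); last exact: exprz_cont.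
      by move=> w /D0 /=; rewrite inv_if_neq0.
    exact: (inv_if_cont_on b D0).
  apply: (cont_on_comp _ _ (Fc k i)); last exact: (inv_if_cont_on b D0).
  by move=> w; exact: cdom_inv.
move=> w w1; apply/eqP; rewrite subr_eq0; apply/eqP.
have iw1 : nm (inv_if b w) = 1 by exact: inv_if_nm1.
apply: (jsol_unique dc tau0 taul hM (v := fun k i => inv_if b w ^ (- e k) * F k i (inv_if b w))).
- by rewrite w1.
- by move=> k' i'; rewrite Frec// inv_ifK.
- by move=> i'; exact: Flim.
Qed.

Lemma slim_site (u : int -> C) l n : slim (fun k => u k%:Z) l -> slim (fun k => u (n + k%:Z)) l.
Proof.
move=> h e /h[s0 hs]; exists (s0 + absz n)%N => s hs0.
by rewrite (_ : n + s%:Z = (absz (n + s%:Z))%:Z) ?hs//; lia.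
Qed.

Lemma slim_siteN (u : int -> C) l n : slim (fun k => u (- k%:Z)) l -> slim (fun k => u (n - k%:Z)) l.
Proof.
move=> h; have := @slim_site (fun k => u (- k)) l (- n) h.
by apply: eq_slim => k; rewrite opprD opprK.
Qed.

Lemma slim_unimod (u v : nat -> C) : (forall k, nm (v k) = 1) -> slim u 0 -> slim (fun k => v k * u k) 0.
Proof.
move=> hv h e /h[s0 hs]; exists s0 => s /hs.
by rewrite !sub0r !nmN nmM hv mul1r.
Qed.

Lemma nm_expz (z : C) (p : int) : nm z = 1 -> nm (z ^ p) = 1.
Proof.
move=> z1; case: p => p; first by rewrite -exprnP nmX z1 expr1n.
by rewrite NegzE -exprnN nmV nmX z1 expr1n invr1.
Qed.

Lemma dexp_psi b (w : C) : w ^+ dexp (cpsi b) ord0 = (Fpoly R b).[w] /\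
  w ^+ dexp (cpsi b) ord_max = (Fpoly R (~~ b)).[w].
Proof. by case: b; rewrite /dexp /cpsi /Fpoly /= ?hornerXn -?polyC1 ?hornerC ?expr0. Qed.

Lemma dexp_phi b (w : C) : w ^+ dexp (cphi b) ord0 = (Fpoly R (~~ b)).[w] /\
  w ^+ dexp (cphi b) ord_max = (Fpoly R b).[w].
Proof. by case: b; rewrite /dexp /cphi /Fpoly /= ?hornerXn -?polyC1 ?hornerC ?expr0. Qed.

Lemma expz_sg b (z : C) : z ^ (sg b) = inv_if b z.
Proof. by rewrite -[sg b]mulr1 -inv_if_exp expr1. Qed.

Lemma psi_step b (q r : int -> C) n k (a : 'I_2 -> int -> C) z i : z != 0 ->
  solQ q r z (a ord0) (a ord_max) ->
  z ^ (- (sg b * (n + k%:Z))) * a i (n + k%:Z) = zstep (dexp (cpsi b)) (Mpsi b q r n) k (inv_if b z)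
    (fun j => z ^ (- (sg b * (n + k.+1%:Z))) * a j (n + k.+1%:Z)) i.
Proof.
move=> z0 sol.
have e1 : n + k.+1%:Z = n + k%:Z + 1 by rewrite -addn1 PoszD addrA.
have [s1 s2] := sol (n + k%:Z); rewrite -e1 in s1 s2.
set Z := z ^ (- (sg b * (n + k.+1%:Z))).
have -> : z ^ (- (sg b * (n + k%:Z))) = Z * inv_if b z.
  by rewrite -expz_sg -expfzDr//; congr (_ ^ _); rewrite e1; ring.
have w0 : inv_if b z != 0 by rewrite inv_if_neq0.
have := inv_if_mul b w0; have := dexp_psi b (inv_if b z); rewrite inv_ifK.
rewrite /zstep sum2 /Mpsi /mk2 /=.
have [->|->] := ord2P i; rewrite /=;
  move: (inv_if b z) w0 (a ord0 (n + k.+1%:Z)) (a ord_max (n + k.+1%:Z)) s1 s2 (Epoly R b)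
    (Fpoly R b) (Fpoly R (~~ b)) => w w0 x y s1 s2 PE PF PF' [d1 d2] [m1 m2 m3];
  by rewrite ?d1 ?d2 ?s1 ?s2 !hornerZ ?horner0 -?m1 -?m2 -?m3; field.
Qed.

Variables (b : bool) (q r : int -> C).
Hypothesis hq : rapid_decay q.
Hypothesis hr : rapid_decay r.
Variable f : 'I_2 -> int -> C -> C.
Hypothesis f_sol : forall z, cdom b z -> solQ q r z (fun n => f ord0 n z) (fun n => f ord_max n z).
Hypothesis f_diff : forall i n z, udom b z -> exists l, cdiff (f i n) z l.
Hypothesis f_cont : forall i n, cont_on (@cdom R b) (f i n).

Lemma psi_series (n : int) :
  (forall z, nm z = 1 -> forall i,
    slim (fun k => z ^ (- (sg b * (n + k%:Z))) * f i (n + k%:Z) z) (i == cpsi b)%:R) ->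
  exists g : nat -> 'I_2 -> C -> C,
  [/\ forall k i, exists2 p, wiener (g k i) p & forall s, evenp (p s),
      forall k i, g k i 0 = zstep (dexp (cpsi b)) (Mpsi b q r n) k 0 (fun j => g k.+1 j 0) i,
      forall i, slim (fun k => g k i 0) (i == cpsi b)%:R &
      forall k i z, cdom b z -> f i (n + k%:Z) z = z ^ (sg b * (n + k%:Z)) * g k i (inv_if b z)].
Proof.
move=> lim; have [K K0 hK] := psi_tail b hq hr n.
apply: (jost_core (K := K) (F := fun k i => f i (n + k%:Z))) => //.
- by rewrite /dexp eqxx.
- exact: dexp_even.
- exact: Mpsi_even.
- by move=> k i z; exact: f_diff.
move=> z z1 k i; apply: (@psi_step b q r n k (fun i n => f i n z)); first exact: nm1_neq0.
by apply: f_sol; split; [exact: nm1_neq0|rewrite inv_if_nm1].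
Qed.

Lemma phi_series (n : int) :
  (forall z, nm z = 1 -> forall i,
    slim (fun k => z ^ (sg b * (n - k%:Z)) * f i (n - k%:Z) z) (i == cphi b)%:R) ->
  exists g : nat -> 'I_2 -> C -> C,
  [/\ forall k i, exists2 p, wiener (g k i) p & forall s, evenp (p s),
      forall k i, g k i 0 = zstep (dexp (cphi b)) (Mphi b q r n) k 0 (fun j => g k.+1 j 0) i,
      forall i, slim (fun k => g k i 0) (i == cphi b)%:R &
      forall k i z, cdom b z -> f i (n - k%:Z) z = z ^ (- (sg b * (n - k%:Z))) * g k i (inv_if b z)].
Proof.
move=> lim; have [K K0 hK] := phi_tail b hq hr n.
apply: (jost_core (K := K) (F := fun k i => f i (n - k%:Z)) (e := fun k => - (sg b * (n - k%:Z)))) => //.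
- by rewrite /dexp eqxx.
- exact: dexp_even.
- exact: Mphi_even.
- by move=> k i z; exact: f_diff.
- move=> z z1 k i; have z0 := nm1_neq0 z1.
  have cz : cdom b z by split => //; rewrite inv_if_nm1.
  have e1 : n - k.+1%:Z + 1 = n - k%:Z by rewrite -addn1 PoszD; ring.
  (* The step matrix of (Q) has determinant 1, so its inverse, which [Mphi] encodes, has polynomial
     entries in the same quantities. Substituting (Q) into the right-hand side checks it. *)
  have [s1 s2] := f_sol cz (n - k.+1%:Z); rewrite e1 in s1 s2.
  rewrite !opprK; set Z := z ^ (sg b * (n - k.+1%:Z)).
  have -> : z ^ (sg b * (n - k%:Z)) = Z * inv_if b z.
    by rewrite -expz_sg -expfzDr//; congr (_ ^ _); rewrite -e1; ring.
  have w0 : inv_if b z != 0 by rewrite inv_if_neq0.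
  have := inv_if_mul b w0; have := dexp_phi b (inv_if b z); rewrite inv_ifK.
  rewrite /zstep sum2 /Mphi /mk2 /=.
  have [->|->] := ord2P i; rewrite /= s1 s2;
    move: (inv_if b z) w0 (f ord0 (n - k%:Z) z) (f ord_max (n - k%:Z) z) (Epoly R b)
    (Fpoly R b) (Fpoly R (~~ b)) => w w0 x y PE PF PF' [d1 d2] [m1 m2 m3];
    by rewrite ?d1 ?d2 !hornerZ ?horner0 -?m1 -?m2 -?m3; field.
by move=> z z1 i; apply: eq_slim (lim z z1 i) => k; rewrite opprK.
Qed.

End JostExpansion.

(** * Parity and values at the origin *)

Section Expansions.
Variable R : realType.
Local Notation C := (CC R).

Lemma evenp_opp (P : {poly C}) z : evenp P -> P.[- z] = P.[z].
Proof.
move=> hP; rewrite !horner_coef; apply: eq_bigr => l _.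
have [lo|lo] := boolP (odd l); first by rewrite (hP l lo) mul0r mul0r.
by rewrite exprNn -signr_odd (negPf lo) mul1r.
Qed.

Lemma wiener_even (f : C -> C) p z : wiener f p -> (forall s, evenp (p s)) -> nm z <= 1 -> f (- z) = f z.
Proof.
move=> [_ h] hp z1; apply: slim_uniq (h _ _) _; first by rewrite nmN.
by apply: eq_slim (h _ z1) => s; rewrite evenp_opp.
Qed.

(** A zero at one level would propagate to all higher levels, since the factors do not vanish, and
    force the limit to be 0. *)
Lemma backward_neq0 (a u : nat -> C) l : (forall k, u k = a k * u k.+1) -> (forall k, a k != 0) ->
  slim u l -> l != 0 -> forall k, u k != 0.
Proof.
move=> rec a0 lim l0 k; apply/negP => /eqP uk.
have h s : u (s + k)%N = 0.
  elim: s => [|s IH] //; move/eqP: IH; rewrite rec mulf_eq0 (negPf (a0 _)) /= => /eqP.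
  by rewrite addSn.
have := slim_shift k lim; move=> /(eq_slim h) /(slim_uniq (slim_cst 0)) e.
by rewrite -e eqxx in l0.
Qed.

Lemma Epoly0 b : (Epoly R b).[0] = - (sg b)%:~R.
Proof.
by rewrite /Epoly hornerZ hornerD hornerN hornerXn -polyC1 hornerC expr2 mul0r sub0r mulrN1.
Qed.

Lemma Fpoly0 b : (Fpoly R b).[0] = b%:R.
Proof. by case: b; rewrite /Fpoly ?hornerXn -?polyC1 ?hornerC// expr2 mul0r. Qed.

Definition pairf (f1 f2 : int -> C -> C) (i : 'I_2) := if i == ord0 then f1 else f2.

Definition sol_b (q r : int -> C) b (f : 'I_2 -> int -> C -> C) :=
  [/\ forall z, cdom b z -> solQ q r z (fun n => f ord0 n z) (fun n => f ord_max n z),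
      forall i n z, udom b z -> exists l, cdiff (f i n) z l &
      forall i n, cont_on (@cdom R b) (f i n)].

Definition lim_p b (f : 'I_2 -> int -> C -> C) := forall z, nm z = 1 -> forall i n,
  slim (fun k => z ^ (- (sg b * (n + k%:Z))) * f i (n + k%:Z) z) (i == cpsi b)%:R.

Definition lim_m b (f : 'I_2 -> int -> C -> C) := forall z, nm z = 1 -> forall i n,
  slim (fun k => z ^ (sg b * (n - k%:Z)) * f i (n - k%:Z) z) (i == cphi b)%:R.

Variables (q r : int -> C).
Hypothesis hq : rapid_decay q.
Hypothesis hr : rapid_decay r.
Hypothesis hqr : forall n, 1 - q n * r n != 0.
Hypothesis hqr1 : forall n, 1 + q n * r (n + 1) != 0.

(** At [w = 0] the recursion for the normalised component becomes scalar, with factor [1 - q r] for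
    [b = false] and [1 + q r(+1)] for [b = true]. The nonvanishing hypotheses enter here, through
    [backward_neq0]. *)
Lemma psi_expansion b f n : sol_b q r b f -> lim_p b f ->
  exists (g : 'I_2 -> C -> C) (kap : 'I_2 -> nat -> C),
  [/\ forall i, wiener (g i) (fun L => \poly_(l < L) kap i l),
      forall i l, odd l -> kap i l = 0,
      forall i z, cdom b z -> f i n z = z ^ (sg b * n) * g i (inv_if b z) &
      exists2 x, x != 0 & g ord0 0 = (if b then 1 else - q n) * x /\
                          g ord_max 0 = (if b then r n else 1 - q n * r n) * x].
Proof.
move=> [fs fd fc] lim.
have [g [hw rec gl rep]] := psi_series hq hr fs fd fc (fun z z1 i => lim z z1 i n).
have hk i : exists k : nat -> C, wiener (g 0%N i) (fun L => \poly_(l < L) k l) /\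
    forall l, odd l -> k l = 0.
  have [p hp ev] := hw 0%N i; have [k [k1 k2]] := wiener_coef hp.
  exists k; split => // l lo; apply: slim_uniq (k1 l) _.
  by apply: eq_slim (slim_cst 0) => s; rewrite (ev s).
have [k0 [w0 o0]] := hk ord0; have [k1 [w1 o1]] := hk ord_max.
exists (g 0%N), (fun i => if i == ord0 then k0 else k1); split.
- by move=> i; have [->|->] := ord2P i.
- by move=> i l lo; have [->|->] := ord2P i => /=; rewrite ?o0 ?o1.
- by move=> i z hz; have := rep 0%N i z hz; rewrite addr0.
have r0 k := rec k ord0; have r1 k := rec k ord_max.
move: r0 r1 gl; rewrite /zstep /Mpsi /mk2 /dexp /cpsi.
move: (Epoly R b) (Fpoly R b) (Epoly0 b) (Fpoly0 b) => P Q.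
case: b {fs fd fc lim rep rec}; rewrite /sg => /= P0 Q0 r0 r1 gl.
- have {}r1 k : g k ord_max 0 = r (n + k%:Z) * g k ord0 0.
    rewrite r1 r0 !sum2 /= !hornerZ !horner0 P0 Q0; ring.
  have {}r0 k : g k ord0 0 = (1 + q (n + k%:Z) * r (n + k%:Z + 1)) * g k.+1 ord0 0.
    rewrite r0 !sum2 /= !hornerZ !horner0 P0 r1 (_ : n + k.+1%:Z = n + k%:Z + 1); first by ring.
    by rewrite -addn1 PoszD addrA.
  exists (g 0%N ord0 0); last by rewrite r1 addr0 mul1r.
  by apply: (backward_neq0 r0 _ (gl ord0)) => //; rewrite eqxx oner_neq0.
have {}r0 k : g k ord0 0 = - q (n + k%:Z) * g k.+1 ord_max 0.
  rewrite r0 !sum2 /= !hornerZ !horner0 P0; ring.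
have {}r1 k : g k ord_max 0 = (1 - q (n + k%:Z) * r (n + k%:Z)) * g k.+1 ord_max 0.
  rewrite r1 !sum2 /= !hornerZ P0 Q0; ring.
exists (g 1%N ord_max 0); last by rewrite (r0 0%N) (r1 0%N) addr0.
by apply: (backward_neq0 r1 _ (gl ord_max)) => //; rewrite eqxx oner_neq0.
Qed.

(** The same mechanism towards minus infinity, with the factors taken at sites to the left of
    [n]. *)
Lemma phi_expansion b f n : sol_b q r b f -> lim_m b f ->
  exists (g : 'I_2 -> C -> C),
  [/\ forall i, exists2 p, wiener (g i) p & forall s, evenp (p s),
      forall i z, cdom b z -> f i n z = z ^ (- (sg b * n)) * g i (inv_if b z) &
      exists2 x, x != 0 & g ord0 0 = (if b then - q (n - 1) else 1) * x /\
                          g ord_max 0 = (if b then 1 else 0) * x].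
Proof.
move=> [fs fd fc] lim.
have [g [hw rec gl rep]] := phi_series hq hr fs fd fc (fun z z1 i => lim z z1 i n).
exists (g 0%N); split => //.
  by move=> i z hz; have := rep 0%N i z hz; rewrite subr0.
have r0 k := rec k ord0; have r1 k := rec k ord_max.
move: r0 r1 gl; rewrite /zstep /Mphi /mk2 /dexp /cphi.
move: (Epoly R b) (Fpoly R b) (Epoly0 b) (Fpoly0 b) => P Q.
case: b {fs fd fc lim rep rec}; rewrite /sg => /= P0 Q0 r0 r1 gl.
- have {}r0 k : g k ord0 0 = - q (n - k.+1%:Z) * g k ord_max 0.
    rewrite r0 r1 !sum2 /= !hornerZ !horner0 P0 Q0; ring.
  have {}r1 k : g k ord_max 0 = (1 + q (n - k.+2%:Z) * r (n - k.+2%:Z + 1)) * g k.+1 ord_max 0.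
    have -> : n - k.+2%:Z + 1 = n - k.+1%:Z by rewrite -(addn1 k.+1) PoszD; ring.
    rewrite r1 !sum2 /= !hornerZ !horner0 Q0 r0; ring.
  exists (g 0%N ord_max 0); last by rewrite r0 mul1r.
  by apply: (backward_neq0 r1 _ (gl ord_max)) => //; rewrite eqxx oner_neq0.
have {}r1 k : g k ord_max 0 = 0.
  rewrite r1 !sum2 /= !hornerZ horner0 Q0; ring.
have {}r0 k : g k ord0 0 = (1 - q (n - k.+1%:Z) * r (n - k.+1%:Z)) * g k.+1 ord0 0.
  rewrite r0 !sum2 /= !hornerZ P0 r1; ring.
exists (g 0%N ord0 0); last by rewrite r1 mul1r mul0r.
by apply: (backward_neq0 r0 _ (gl ord0)) => //; rewrite eqxx oner_neq0.
Qed.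

End Expansions.

(** * Scattering relation *)

Section Coefficients.
Variable R : realType.
Local Notation C := (CC R).

Lemma circ_expz (p : int) : circ_int (fun z : C => z ^ (p - 1)) = (p == 0)%:R.
Proof.
have dX k (z : C) : exists l, cdiff (fun y => y ^+ k) z l.
  have := poly_cdiff ('X^k) z; rewrite (_ : horner 'X^k = (fun y => y ^+ k)); first by eexists; eauto.
  by apply/funext => y; rewrite hornerXn.
have cX (k : nat) : cont_on [set z : C | nm z <= 1] (fun y => y ^+ k).
  by apply: cdiff_ccont => z _; exact: dX.
have e (z : C) : nm z = 1 -> z ^ (p - 1) * z = z ^ p.
  by move=> /nm1_neq0 z0; rewrite mulrC expz_pred.
case: p e => k e.
  rewrite (circ_disc (F := fun z => z ^+ k)) ?expr0n//; by move=> z _; exact: dX.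
rewrite (circ_discN (F := fun z => z ^+ k.+1)) ?expr0n//.
by move=> z /e ->; rewrite NegzE -exprnN exprVn.
Qed.

Definition Kcf b (f : 'I_2 -> int -> C -> C) i (n m : int) :=
  circ_int (fun z => f i n z * z ^ (- (sg b * m) - 1)).

(** Orthogonality of the powers of [z] on the circle identifies the series coefficients with the
    contour integrals that define [K]. *)
Lemma coef_int b f i n g (kap : nat -> C) (l : nat) : wiener g (fun L => \poly_(l < L) kap l) ->
  (forall z, cdom b z -> f i n z = z ^ (sg b * n) * g (inv_if b z)) ->
  Kcf b f i n (n + l%:Z) = kap l.
Proof.
move=> hg rep.
have -> : Kcf b f i n (n + l%:Z) =
    circ_int (fun z => z ^ (- (sg b * l%:Z) - 1) * g (inv_if b z)).
  apply: eq_circ => z z1; have z0 := nm1_neq0 z1.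
  rewrite rep; last by split => //; rewrite inv_if_nm1.
  rewrite mulrAC -expfzDr//; congr (_ ^ _ * _); ring.
have hh := @circ_cont_expz R (- (sg b * l%:Z) - 1).
apply: slim_uniq (circ_wiener_lim b hh hg) _ => e e0; exists l.+1 => s sl.
rewrite (circ_poly b hh (size_poly _ _)) (bigD1 (Ordinal sl))//= big1 => [|j jl].
  rewrite coef_poly sl addr0 (@eq_circ _ _ (fun z => z ^ (0 - 1))).
    by rewrite circ_expz eqxx mulr1 subrr nm0 ltW.
  by move=> z /nm1_neq0 z0; rewrite -expfzDr//; congr (_ ^ _); ring.
rewrite (@eq_circ _ _ (fun z => z ^ (sg b * (j%:Z - l%:Z) - 1))); last first.
  by move=> z /nm1_neq0 z0; rewrite -expfzDr//; congr (_ ^ _); ring.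
rewrite circ_expz mulf_eq0 subr_eq0 eqz_nat (_ : sg b == 0 = false); last by case: b {rep hh}.
by rewrite (_ : (j : nat) == l = false) ?mulr0//; apply: contra_neqF jl => /eqP h; apply: val_inj.
Qed.

End Coefficients.

Section Rows.
Variable R : realType.
Local Notation C := (CC R).

Lemma slim_phase (z : C) (p p' : nat -> int) u : nm z = 1 ->
  slim (fun k => z ^ p k * u k) 0 -> slim (fun k => z ^ p' k * u k) 0.
Proof.
move=> z1 h; have := @slim_unimod _ _ (fun k => z ^ (p' k - p k)) (fun k => nm_expz _ z1) h.
by apply: eq_slim => k; rewrite mulrA -expfzDr ?nm1_neq0// subrK.
Qed.

Lemma zstepD d M k (w : C) x y i :
  zstep d M k w (fun j => x j + y j) i = zstep d M k w x i + zstep d M k w y i.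
Proof.
rewrite /zstep mulrDr addrACA -big_split; congr (_ + _).
by apply: eq_bigr => j _; rewrite mulrDr.
Qed.

Variables (q r : int -> C).
Hypothesis hq : rapid_decay q.
Hypothesis hr : rapid_decay r.

(** A solution on the circle that vanishes at plus infinity in one normalisation is zero, by
    uniqueness for the one-sided recursion. *)
Lemma sol_zero (b : bool) (z : C) (a : 'I_2 -> int -> C) n i : nm z = 1 ->
  solQ q r z (a ord0) (a ord_max) ->
  (forall j, slim (fun k => z ^ (- (sg b * (n + k%:Z))) * a j (n + k%:Z)) 0) -> a i n = 0.
Proof.
move=> z1 sol lim; have z0 := nm1_neq0 z1; have [K K0 hK] := psi_tail b hq hr n.
have dc : dexp (cpsi b) (cpsi b) = 0%N by rewrite /dexp eqxx.
have tau0 k : 0 <= K / k.+1%:R by rewrite divr_ge0// ltW.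
have w1 : nm (inv_if b z) <= 1 by rewrite inv_if_nm1.
pose J := jsol dc tau0 (tail_lim K0) hK.
(* [jsol_unique] wants the unit vector as limit, so [a] is added to the Jost solution: the sum has
   the same limit and must coincide with it. *)
pose v k i := J k i (inv_if b z) + z ^ (- (sg b * (n + k%:Z))) * a i (n + k%:Z).
have : v 0%N i = J 0%N i (inv_if b z).
  apply: (jsol_unique dc tau0 (tail_lim K0) hK (v := v) w1) => [k j|j].
    by rewrite /v (psi_step b n k j z0 sol) [J _ _ _]jsol_rec// -zstepD.
  by rewrite -[X in slim _ X]addr0; apply: slimD; [exact: jsol_lim|exact: lim].
rewrite /v -[RHS]addr0 => /addrI /eqP; rewrite addr0 mulf_eq0 => /orP[|/eqP//].
by rewrite expfz_eq0 (negPf z0) andbF.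
Qed.

Definition dt b (u v : 'I_2 -> C) := u (cphi b) * v (cpsi b) - u (cpsi b) * v (cphi b).

(** The step matrix has determinant 1, so the Wronskian does not depend on the site. *)
Lemma dt_sol b (z : C) (u v : 'I_2 -> int -> C) n k : z != 0 ->
  solQ q r z (u ord0) (u ord_max) -> solQ q r z (v ord0) (v ord_max) ->
  dt b (u^~ n) (v^~ n) = dt b (u^~ (n + k%:Z)) (v^~ (n + k%:Z)).
Proof.
move=> z0 su sv; elim: k => [|k ->]; first by rewrite addr0.
have -> : n + k.+1%:Z = n + k%:Z + 1 by rewrite -addn1 PoszD addrA.
have [u0 u1] := su (n + k%:Z); have [v0 v1] := sv (n + k%:Z).
rewrite /dt /cphi /cpsi; case: b; rewrite u0 u1 v0 v1; by field.
Qed.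

Hypothesis hqr : forall n, 1 - q n * r n != 0.
Hypothesis hqr1 : forall n, 1 + q n * r (n + 1) != 0.
Variables (b : bool) (fp fpo fm : 'I_2 -> int -> C -> C) (T Rf : C -> C).
Hypothesis fp_sol : sol_b q r b fp.
Hypothesis fp_lim : lim_p b fp.
Hypothesis fpo_sol : sol_b q r (~~ b) fpo.
Hypothesis fpo_lim : lim_p (~~ b) fpo.
Hypothesis fm_sol : sol_b q r b fm.
Hypothesis fm_lim : lim_m b fm.
Hypothesis T_lim : forall z n, nm z = 1 -> [/\ T z != 0,
  slim (fun k => z ^ (sg b * (n + k%:Z)) * fm (cphi b) (n + k%:Z) z) (T z)^-1 &
  slim (fun k => z ^ (- (sg b * (n + k%:Z))) * fm (cpsi b) (n + k%:Z) z) (Rf z / T z)].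

Lemma cpsiN c : cpsi (~~ c) = cphi c. Proof. by case: c. Qed.
Lemma cpsi_phi c : (cpsi c == cphi c) = false. Proof. by case: c. Qed.
Lemma sgN c : sg (~~ c) = - sg c. Proof. by case: c. Qed.

Lemma circ_cdomP c (z : C) : nm z = 1 -> cdom c z.
Proof. by move=> z1; split; [exact: nm1_neq0|rewrite inv_if_nm1]. Qed.

Lemma fp_limE z n : nm z = 1 ->
  slim (fun k => z ^ (- (sg b * (n + k%:Z))) * fp (cpsi b) (n + k%:Z) z) 1 /\
  slim (fun k => z ^ (- (sg b * (n + k%:Z))) * fp (cphi b) (n + k%:Z) z) 0.
Proof.
move=> z1; have := fp_lim z1 (cpsi b) n; have := fp_lim z1 (cphi b) n.
by rewrite eqxx eq_sym cpsi_phi.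
Qed.

Lemma fpo_limE z n : nm z = 1 ->
  slim (fun k => z ^ (sg b * (n + k%:Z)) * fpo (cphi b) (n + k%:Z) z) 1 /\
  slim (fun k => z ^ (sg b * (n + k%:Z)) * fpo (cpsi b) (n + k%:Z) z) 0.
Proof.
move=> z1; have := fpo_lim z1 (cpsi b) n; have := fpo_lim z1 (cphi b) n.
rewrite cpsiN eqxx cpsi_phi sgN => h1 h2.
by split; [apply: eq_slim h1 => k|apply: eq_slim h2 => k]; rewrite mulNr opprK.
Qed.

Lemma wronskian_psi z n : nm z = 1 -> dt b (fun i => fpo i n z) (fun i => fp i n z) = 1.
Proof.
move=> z1; have z0 := nm1_neq0 z1.
have [p1 p0] := fp_limE n z1; have [y1 y0] := fpo_limE n z1.
have [[so _ _] [sp _ _]] := (fpo_sol, fp_sol).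
apply: slim_uniq (slim_cst _) _; rewrite -[X in slim _ X]subr0 -[1]mulr1 -[X in slim _ (_ - X)](mulr0 0).
apply: eq_slim (slimB (slimM y1 p1) (slimM y0 p0)) => k.
rewrite (dt_sol b n k (u := fun i n => fpo i n z) (v := fun i n => fp i n z) z0 (so z (circ_cdomP _ z1)) (sp z (circ_cdomP _ z1))) /dt.
have e : z ^ (sg b * (n + k%:Z)) * z ^ (- (sg b * (n + k%:Z))) = 1 by rewrite -expfzDr// subrr expr0z.
by rewrite mulrACA e mul1r [X in _ - X]mulrACA e mul1r.
Qed.

(** The difference of the two sides solves (Q), and the coefficients [1/T] and [Rf/T] make both its
    components vanish at plus infinity. *)
Lemma scattering z n i : nm z = 1 -> T z * fm i n z = fpo i n z + Rf z * fp i n z.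
Proof.
move=> z1; have z0 := nm1_neq0 z1.
have [p1 p0] := fp_limE n z1; have [y1 y0] := fpo_limE n z1; have [T0 t1 t0] := T_lim n z1.
have [[so _ _] [sp _ _] [sm _ _]] := And3 fpo_sol fp_sol fm_sol.
have {}so := so z (circ_cdomP _ z1); have {}sp := sp z (circ_cdomP _ z1); have {}sm := sm z (circ_cdomP _ z1).
apply/eqP; rewrite -subr_eq0 opprD addrA; apply/eqP.
pose a i n := T z * fm i n z - fpo i n z - Rf z * fp i n z.
apply: (@sol_zero b z a n i z1) => [k|j].
  have [y0' y1'] := so k; have [p0' p1'] := sp k; have [m0 m1] := sm k.
  by rewrite /a y0' y1' p0' p1' m0 m1; split; ring.
have split3 (x y w u : C) : u * (T z * x - y - Rf z * w) = T z * (u * x) - u * y - Rf z * (u * w) by ring.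
have [->|->] : j = cpsi b \/ j = cphi b.
- by have [->|->] := ord2P j; rewrite /cpsi /cphi; case: b; [left|right|right|left].
- apply: (@eq_slim _ (fun k => T z * (z ^ (- (sg b * (n + k%:Z))) * fm (cpsi b) (n + k%:Z) z)
    - z ^ (- (sg b * (n + k%:Z))) * fpo (cpsi b) (n + k%:Z) z
    - Rf z * (z ^ (- (sg b * (n + k%:Z))) * fp (cpsi b) (n + k%:Z) z))).
    by move=> k; rewrite /a split3.
  have -> : 0 = T z * (Rf z / T z) - 0 - Rf z * 1 by rewrite subr0 mulr1 mulrCA mulfV// mulr1 subrr.
  apply: slimB; last exact: slimZ.
  by apply: slimB; [exact: slimZ|exact: slim_phase z1 y0].
apply: (@slim_phase z (fun k => sg b * (n + k%:Z)) (fun k => - (sg b * (n + k%:Z)))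
  (fun k => a (cphi b) (n + k%:Z)) z1).
apply: (@eq_slim _ (fun k => T z * (z ^ (sg b * (n + k%:Z)) * fm (cphi b) (n + k%:Z) z)
    - z ^ (sg b * (n + k%:Z)) * fpo (cphi b) (n + k%:Z) z
    - Rf z * (z ^ (sg b * (n + k%:Z)) * fp (cphi b) (n + k%:Z) z))).
  by move=> k; rewrite /a split3.
have -> : 0 = T z * (T z)^-1 - 1 - Rf z * 0 by rewrite mulr0 subr0 mulfV// subrr.
apply: slimB; last by apply: slimZ; exact: slim_phase z1 p0.
by apply: slimB; first exact: slimZ.
Qed.

Lemma evenp_poly (k : nat -> C) L : (forall l, odd l -> k l = 0) -> evenp (\poly_(l < L) k l).
Proof. by move=> h l lo; rewrite coef_poly h// if_same. Qed.

(** The Wronskian is taken at site 0, where the power prefactors are 1 and it is directly a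
    polynomial expression in the series. On the circle, multiplying by [T] and inserting the
    scattering relation leaves the Wronskian of the two solutions normalised at plus infinity. *)
Lemma transmission_inverse : exists W pW, [/\ wiener W pW,
  forall w, nm w <= 1 -> W (- w) = W w, W 0 != 0 &
  forall z, nm z = 1 -> T z * W (inv_if b z) = 1].
Proof.
have [g [hg gE [x x0 [gx0 gx1]]]] := phi_expansion hq hr hqr hqr1 0 fm_sol fm_lim.
have [h [kap [hh kapo hE [y y0 [hy0 hy1]]]]] := psi_expansion hq hr hqr hqr1 0 fp_sol fp_lim.
have [[p0 w0 e0] [p1 w1 e1]] := (hg (cphi b), hg (cpsi b)).
exists (fun w => dt b (g^~ w) (h^~ w)); eexists; split.
- exact: wienerB (wienerM w0 (hh _)) (wienerM w1 (hh _)).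
- move=> w w1'; rewrite /dt.
  have he i : h i (- w) = h i w by apply: wiener_even (hh i) _ w1' => s; exact: evenp_poly (kapo i).
  by rewrite !he (wiener_even w0 e0 w1') (wiener_even w1 e1 w1').
- move: gx0 gx1 hy0 hy1; rewrite /dt /cphi /cpsi; case: (b) => -> -> -> ->.
    have -> : 1 * x * (1 * y) - - q (0 - 1) * x * (r 0 * y) = (1 + q (0 - 1) * r (0 - 1 + 1)) * (x * y).
      by rewrite subrK; ring.
    by rewrite !mulf_neq0.
  have -> : 1 * x * ((1 - q 0 * r 0) * y) - 0 * x * (- q 0 * y) = (1 - q 0 * r 0) * (x * y) by ring.
  by rewrite !mulf_neq0.
move=> z z1; have cz := circ_cdomP b z1; rewrite -(wronskian_psi 0 z1) /dt.
have gz i : g i (inv_if b z) = fm i 0 z by rewrite gE// mulr0 oppr0 expr0z mul1r.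
have hz i : h i (inv_if b z) = fp i 0 z by rewrite hE// mulr0 expr0z mul1r.
rewrite !gz !hz mulrBr !mulrA !scattering//; ring.
Qed.

Variables (N : nat) (zs : 'I_N -> C) (ms : 'I_N -> nat) (t gam : 'I_N -> nat -> C).
Hypothesis zs_in : forall j, udom b (zs j).
Hypothesis zs_neq : forall i j, i != j -> zs i != zs j /\ zs i != - zs j.
Hypothesis ms_gt0 : forall j, (0 < ms j)%N.
Hypothesis T_diff : forall z, udom b z -> ~ pole_set zs z -> exists l, cdiff T z l.
Hypothesis T_cont : cont_on (@cdom R b `\` pole_set zs) T.
Hypothesis T_ord : forall j, pole_bd T (zs j) (ms j) /\ pole_bd T (- zs j) (ms j).
Hypothesis T_part : forall j, ppart T (zs j) (ms j) (t j).
Hypothesis dep : forall i j k n, (k < ms j)%N -> derive1n k (fm i n) (zs j) =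
  \sum_(l < k.+1) 'C(k, l)%:R * gam j (k - l)%N * derive1n l (fp i n) (zs j).

Let c j u := - (2 * (sg b)%:~R) * \sum_(l < (ms j - u)%N) t j (u + 1 + l)%N * gam j l / (l`!)%:R.

Let omega (k : int) : C := if odd (absz k) then 0 else
  circ_int (fun z => Rf z * z ^ (sg b * k - 1)) +
  \sum_(j < N) \sum_(u < ms j) c j u * ez (zs j) (sg b * k - 1) u.

Lemma sol_circ_cont d f i n : sol_b q r d f -> circ_cont (f i n).
Proof.
move=> [_ _ h]; apply: cont_on_circ; apply: cont_on_sub (h i n) => z; exact: circ_cdomP.
Qed.

(** [Rf] is only given by limits; continuity comes from expressing it as the Wronskian of [fpo] with
    [T fm]. *)
Lemma reflection_cont : circ_cont Rf.
Proof.
pose dT (u v : 'I_2 -> int -> C -> C) (z : C) : C := u (cphi b) 0 z * (T z * v (cpsi b) 0 z) - u (cpsi b) 0 z * (T z * v (cphi b) 0 z).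
apply: (@eq_circ_cont _ (dT fpo fm)).
  move=> z z1; rewrite /dT !scattering// -[RHS]mulr1 -(wronskian_psi 0 z1) /dt; ring.
have Tc := T_circ zs_in T_cont.
by apply: circ_contB; apply: circ_contM; rewrite -?/(circ_cont _);
  do ?[exact: sol_circ_cont fpo_sol|apply: circ_contM => //; exact: sol_circ_cont fm_sol].
Qed.

Lemma coefficient_row i n m : n < m ->
  slim (fun L => \sum_(l < L) Kcf b fp i n (n + l%:Z) * omega (n + l%:Z + m))
    (- Kcf (~~ b) fpo i n m).
Proof.
move=> nm_lt.
have [W [pW [hW We W0 TW]]] := transmission_inverse.
have [g [hg gE _]] := phi_expansion hq hr hqr hqr1 n fm_sol fm_lim.
have [h [kap [hh kapo hE _]]] := psi_expansion hq hr hqr hqr1 n fp_sol fp_lim.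
have [h' [kap' [hh' kapo' hE' _]]] := psi_expansion hq hr hqr hqr1 n fpo_sol fpo_lim.
have [p hp pe] := hg i.
have Ke : Kcf (~~ b) fpo i n m = circ_int (fun z => fpo i n z * z ^ (sg b * m - 1)).
  by rewrite /Kcf sgN; congr circ_int; apply/funext => z; rewrite mulNr opprK.
rewrite Ke.
apply: (@eq_slim _ (fun L => \sum_(l < L) kap i l * omega (n + l%:Z + m))).
  by move=> L; apply: eq_bigr => l _; rewrite (coef_int l (hh i) (hE i)).
apply: (marchenko_row zs_in zs_neq ms_gt0 T_diff T_cont T_ord T_part hW We W0 TW nm_lt hp pe
  (gE i) (hh i) (kapo i) (hE i) reflection_cont (sol_circ_cont i n fpo_sol)).
- by move=> z; exact: scattering.
- by move=> j k; exact: dep.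
- move=> mn; rewrite -Ke (_ : m = n + (absz (m - n))%:Z); last by lia.
  by rewrite (coef_int _ (hh' i) (hE' i)) kapo'.
Qed.

End Rows.

Lemma mx_cvg (T : topologicalType) m n (G : nat -> 'M[T]_(m, n)) (A : 'M[T]_(m, n)) :
  (forall i j, (fun k => G k i j) @ \oo --> A i j) -> G @ \oo --> A.
Proof.
move=> h S [P hP sub].
have near : \forall k \near \oo, forall i j, P i j (G k i j).
  apply: (@filter_forall _ _ (fun i k => forall j, P i j (G k i j)) \oo) => i.
  apply: (@filter_forall _ _ (fun j k => P i j (G k i j)) \oo) => j.
  by have := h i j (P i j) (hP i j).
by apply: filterS near => k; exact: sub.
Qed.

(** * The matrix equation *)

Section Translation.
Variable R : realType.
Local Notation C := (CC R).

Lemma unit_circleE (z : C) : unit_circle z <-> nm z = 1.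
Proof.
rewrite /unit_circle /= nmE; split=> [|->]; last by rewrite rc1.
by move=> h; apply: rc_inj; rewrite h rc1.
Qed.

Definition Db b : set C := if b then @Dout R else @Din R.
Definition Dcb b : set C := if b then @Doutc R else @Dinc R.

Lemma nmV_lt (z : C) : z != 0 -> (nm z^-1 < 1) = (1 < nm z).
Proof. by move=> z0; rewrite nmV invf_lt1// nm_gt0. Qed.

Lemma nmV_le (z : C) : z != 0 -> (nm z^-1 <= 1) = (1 <= nm z).
Proof. by move=> z0; rewrite nmV invf_le1// nm_gt0. Qed.

Lemma DbE b z : Db b z <-> udom b z.
Proof.
case: b; rewrite /Db /udom /inv_if /=.
  rewrite /Dout /= -[1 < `|z|]/(1 < `|z|) nmE -rc1 rc_lt; split=> [h|[z0]].
    have z0 : z != 0 by rewrite -nm_gt0; exact: lt_trans h.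
    by rewrite nmV_lt.
  by rewrite nmV_lt.
rewrite /Din /= normr_gt0 nmE -[X in _ < X]rc1 rc_lt.
by split=> [/andP[]|[-> ->]].
Qed.

Lemma DcbE b z : Dcb b z <-> cdom b z.
Proof.
case: b; rewrite /Dcb /cdom /inv_if /=.
  rewrite /Doutc /= nmE -rc1 rc_le; split=> [h|[z0]].
    have z0 : z != 0 by rewrite -nm_gt0; exact: lt_le_trans h.
    by rewrite nmV_le.
  by rewrite nmV_le.
rewrite /Dinc /= normr_gt0 nmE -[X in _ <= X]rc1 rc_le.
by split=> [/andP[]|[-> ->]].
Qed.

Lemma sol_onP q r b f1 f2 : sol_on q r (Db b) (Dcb b) f1 f2 -> sol_b q r b (@pairf R f1 f2).
Proof.
move=> [hs hf]; split.
- by move=> z /DcbE; exact: hs.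
- move=> i n z /DbE hz; have [h1 [h2 _]] := hf n.
  by have [->|->] := ord2P i; [exact: holo_cdiff h1 z hz|exact: holo_cdiff h2 z hz].
- move=> i n; have [_ [_ [h1 h2]]] := hf n.
  have sub : @cdom R b `<=` Dcb b by move=> z /DcbE.
  by have [->|->] := ord2P i; rewrite /pairf /=; apply: (cont_on_sub sub);
    [exact: within_cont_on h1|exact: within_cont_on h2].
Qed.

Lemma lim_pP b f1 f2 :
  (forall z, nm z = 1 -> forall i, slim (fun k => z ^ (- (sg b * k%:Z)) * pairf f1 f2 i k%:Z z) (i == cpsi b)%:R) ->
  lim_p b (@pairf R f1 f2).
Proof. by move=> h z z1 i n; exact: (slim_site (u := fun m => z ^ (- (sg b * m)) * pairf f1 f2 i m z)) (h z z1 i). Qed.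

Lemma lim_mP b f1 f2 :
  (forall z, nm z = 1 -> forall i, slim (fun k => z ^ (sg b * - k%:Z) * pairf f1 f2 i (- k%:Z) z) (i == cphi b)%:R) ->
  lim_m b (@pairf R f1 f2).
Proof. by move=> h z z1 i n; exact: (slim_siteN (u := fun m => z ^ (sg b * m) * pairf f1 f2 i m z)) (h z z1 i). Qed.

Lemma jost_psiP q r f1 f2 : jost_psi q r f1 f2 ->
  sol_b q r false (@pairf R f1 f2) /\ lim_p false (pairf f1 f2).
Proof.
move=> [hs lim]; split; first exact: sol_onP.
apply: lim_pP => z z1 i; have [/lim_slim l1 /lim_slim l2] := lim z ((unit_circleE z).2 z1).
have [->|->] := ord2P i.
  by apply: slim_unimod l1 => k; exact: nm_expz.
by apply: eq_slim l2 => k; rewrite mul1r.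
Qed.

Lemma jost_psibP q r f1 f2 : jost_psib q r f1 f2 ->
  sol_b q r true (@pairf R f1 f2) /\ lim_p true (pairf f1 f2).
Proof.
move=> [hs lim]; split; first exact: sol_onP.
apply: lim_pP => z z1 i; have [/lim_slim l1 /lim_slim l2] := lim z ((unit_circleE z).2 z1).
have [->|->] := ord2P i.
  by apply: eq_slim l1 => k; rewrite mulN1r opprK.
by apply: slim_unimod l2 => k; exact: nm_expz.
Qed.

Lemma jost_phiP q r f1 f2 : jost_phi q r f1 f2 ->
  sol_b q r false (@pairf R f1 f2) /\ lim_m false (pairf f1 f2).
Proof.
move=> [hs lim]; split; first exact: sol_onP.
apply: lim_mP => z z1 i; have [/lim_slim l1 /lim_slim l2] := lim z ((unit_circleE z).2 z1).
have [->|->] := ord2P i.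
  by apply: eq_slim l1 => k; rewrite mul1r.
by apply: slim_unimod l2 => k; exact: nm_expz.
Qed.

Lemma jost_phibP q r f1 f2 : jost_phib q r f1 f2 ->
  sol_b q r true (@pairf R f1 f2) /\ lim_m true (pairf f1 f2).
Proof.
move=> [hs lim]; split; first exact: sol_onP.
apply: lim_mP => z z1 i; have [/lim_slim l1 /lim_slim l2] := lim z ((unit_circleE z).2 z1).
have [->|->] := ord2P i.
  by apply: slim_unimod l1 => k; exact: nm_expz.
by apply: eq_slim l2 => k; rewrite mulN1r.
Qed.

Lemma coefs_TP f1 f2 T Rf : @coefs_T R f1 f2 T Rf -> forall z n, nm z = 1 -> [/\ T z != 0,
  slim (fun k => z ^ (sg false * (n + k%:Z)) * pairf f1 f2 (cphi false) (n + k%:Z) z) (T z)^-1 &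
  slim (fun k => z ^ (- (sg false * (n + k%:Z))) * pairf f1 f2 (cpsi false) (n + k%:Z) z) (Rf z / T z)].
Proof.
move=> h z n /unit_circleE z1; have [T0 [/lim_slim l1 /lim_slim l2]] := h z z1; split => //.
  apply: eq_slim (slim_site (u := fun m => z ^ m * f1 m z) n l1) => k; by rewrite mul1r.
apply: eq_slim (slim_site (u := fun m => z ^ (- m) * f2 m z) n l2) => k; by rewrite mul1r.
Qed.

Lemma coefs_TbP f1 f2 T Rf : @coefs_Tb R f1 f2 T Rf -> forall z n, nm z = 1 -> [/\ T z != 0,
  slim (fun k => z ^ (sg true * (n + k%:Z)) * pairf f1 f2 (cphi true) (n + k%:Z) z) (T z)^-1 &
  slim (fun k => z ^ (- (sg true * (n + k%:Z))) * pairf f1 f2 (cpsi true) (n + k%:Z) z) (Rf z / T z)].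
Proof.
move=> h z n /unit_circleE z1; have [T0 [/lim_slim l1 /lim_slim l2]] := h z z1; split => //.
  apply: eq_slim (slim_site (u := fun m => z ^ (- m) * f2 m z) n l2) => k; by rewrite mulN1r.
apply: eq_slim (slim_site (u := fun m => z ^ m * f1 m z) n l1) => k; by rewrite mulN1r opprK.
Qed.

Lemma mero_polesP b T N (zs : 'I_N -> C) ms : mero_poles (Db b) (Dcb b) T zs ms ->
  [/\ forall j, udom b (zs j), forall i j, i != j -> zs i != zs j /\ zs i != - zs j,
      forall j, (0 < ms j)%N, forall z, udom b z -> ~ pole_set zs z -> exists l, cdiff T z l &
      cont_on (@cdom R b `\` pole_set zs) T /\
      forall j, pole_bd T (zs j) (ms j) /\ pole_bd T (- zs j) (ms j)].
Proof.
move=> [h1 [h2 [h3 [h4 [h5 h6]]]]]; split => //.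
- by move=> j; apply/DbE; exact: h1.
- by move=> z /DbE hz nz; exact: (holo_cdiff h4 (conj hz nz)).
split; first by apply: cont_on_sub (within_cont_on h5) => z [/DcbE].
by move=> j; have [a c] := h6 j; split; exact: pole_of_order_bd.
Qed.

(** Brings both kernels to one shape: [- (2 * sg b)] is -2 for the plain problem and 2 for the
    barred one. *)
Lemma OmegaE b Rf N (zs : 'I_N -> C) ms t gam k : (forall j, zs j != 0) ->
  (if b then Omegab Rf zs ms (norming 2 ms t gam) k else Omega Rf zs ms (norming (-2) ms t gam) k) =
  if odd (absz k) then 0 else circ_int (fun z => Rf z * z ^ (sg b * k - 1)) +
    \sum_(j < N) \sum_(u < ms j) (- (2 * (sg b)%:~R) * \sum_(l < (ms j - u)%N)
      t j (u + 1 + l)%N * gam j l / (l`!)%:R) * ez (zs j) (sg b * k - 1) u.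
Proof.
move=> z0; rewrite /Omega /Omegab !triplet_pow// /Rhat /Rbhat /norming /sg.
by case: b; case: (odd _) => //; rewrite ?mulN1r ?mul1r ?mulrN1z ?mulr1z ?mulrN1 ?mulr1 ?opprK.
Qed.

Lemma KmatE psi1 psi2 psib1 psib2 n m i (j : 'I_2) : Kmat psi1 psi2 psib1 psib2 n m i j =
  if j == ord0 then Kcf true (@pairf R psib1 psib2) i n m else Kcf false (@pairf R psi1 psi2) i n m.
Proof.
rewrite mxE /Kbc /Kc /Kcf /sg -[0]/ord0 !mulN1r !opprK !mul1r.
by case: ifP => _; have [->|->] := ord2P i.
Qed.

End Translation.

Lemma det2 (K : comRingType) (A : 'M[K]_2) :
  \det A = A ord0 ord0 * A ord_max ord_max - A ord0 ord_max * A ord_max ord0.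
Proof.
rewrite (expand_det_row _ ord0) sum2 /cofactor !det_mx11 !mxE.
have e (i j : 'I_2) (k : 'I_1) : i != j -> lift i k = j.
  by case: i j k => [[|[|i]] hi] [[|[|j]] hj] [[|k] hk] //= _; apply: val_inj.
by rewrite !(e ord0 ord_max)// (e ord_max ord0)// !expr0 expr1 mul1r mulN1r mulrN.
Qed.

Lemma wiener_coef0 (R : realType) (g : CC R -> CC R) kap :
  wiener g (fun L => \poly_(l < L) kap l) -> g 0 = kap 0%N.
Proof.
move=> [_ h]; apply: slim_uniq (slim_shift 1 (h 0 _)) _; first by rewrite nm0.
by apply: eq_slim (slim_cst _) => L; rewrite horner_coef0 coef_poly addn1.
Qed.

Theorem theorem6p1 (R : realType) (q r : int -> CC R)
  (hq : rapid_decay q) (hr : rapid_decay r)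
  (hqr : forall n, 1 - q n * r n != 0)
  (hqr1 : forall n, 1 + q n * r (n + 1) != 0)
  (psi1 psi2 psib1 psib2 phi1 phi2 phib1 phib2 : int -> CC R -> CC R)
  (hpsi : jost_psi q r psi1 psi2) (hpsib : jost_psib q r psib1 psib2)
  (hphi : jost_phi q r phi1 phi2) (hphib : jost_phib q r phib1 phib2)
  (T Tb Rf Rbf : CC R -> CC R)
  (hT : coefs_T phi1 phi2 T Rf) (hTb : coefs_Tb phib1 phib2 Tb Rbf)
  (N : nat) (zs : 'I_N -> CC R) (ms : 'I_N -> nat)
  (hpoles : mero_poles (@Din R) (@Dinc R) T zs ms)
  (t : 'I_N -> nat -> CC R) (ht : forall j, principal_part T (zs j) (ms j) (t j))
  (gam : 'I_N -> nat -> CC R) (hgam : dependency phi1 phi2 psi1 psi2 zs ms gam)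
  (Nb : nat) (zbs : 'I_Nb -> CC R) (mbs : 'I_Nb -> nat)
  (hpolesb : mero_poles (@Dout R) (@Doutc R) Tb zbs mbs)
  (tb : 'I_Nb -> nat -> CC R) (htb : forall j, principal_part Tb (zbs j) (mbs j) (tb j))
  (gamb : 'I_Nb -> nat -> CC R) (hgamb : dependency phib1 phib2 psib1 psib2 zbs mbs gamb) :
  let c := norming (-2) ms t gam in
  let cb := norming 2 mbs tb gamb in
  let Om := Omega Rf zs ms c in
  let Omb := Omegab Rbf zbs mbs cb in
  let M := Mmat psi1 psi2 psib1 psib2 in
  forall n m : int, n < m ->
    (fun L : nat => \sum_(i < L) M n (n + (i.+1)%:Z) *m Omat Om Omb (n + (i.+1)%:Z + m))
      @ \oo --> - (M n m + Omat Om Omb (n + m)).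
Proof.
have [psi_s psi_l] := jost_psiP hpsi; have [psib_s psib_l] := jost_psibP hpsib.
have [phi_s phi_l] := jost_phiP hphi; have [phib_s phib_l] := jost_phibP hphib.
have [zs_in zs_neq ms_gt0 T_diff [T_cont T_ord]] := mero_polesP (b := false) hpoles.
have [zbs_in zbs_neq mbs_gt0 Tb_diff [Tb_cont Tb_ord]] := mero_polesP (b := true) hpolesb.
have zs0 j : zs j != 0 by case: (zs_in j).
have zbs0 j : zbs j != 0 by case: (zbs_in j).
have dep i j k n : (k < ms j)%N -> derive1n k (pairf phi1 phi2 i n) (zs j) =
    \sum_(l < k.+1) 'C(k, l)%:R * gam j (k - l)%N * derive1n l (pairf psi1 psi2 i n) (zs j).
  by move=> km; have [h1 h2] := hgam j k n km; have [->|->] := ord2P i.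
have depb i j k n : (k < mbs j)%N -> derive1n k (pairf phib1 phib2 i n) (zbs j) =
    \sum_(l < k.+1) 'C(k, l)%:R * gamb j (k - l)%N * derive1n l (pairf psib1 psib2 i n) (zbs j).
  by move=> km; have [h1 h2] := hgamb j k n km; have [->|->] := ord2P i.
move=> c cb Om Omb M n m nm_lt.
have row i := coefficient_row hq hr hqr hqr1 psi_s psi_l psib_s psib_l phi_s phi_l (coefs_TP hT)
  zs_in zs_neq ms_gt0 T_diff T_cont T_ord (fun j => principal_part_ppart (ht j)) dep i nm_lt.
have rowb i := coefficient_row hq hr hqr hqr1 psib_s psib_l psi_s psi_l phib_s phib_l (coefs_TbP hTb)
  zbs_in zbs_neq mbs_gt0 Tb_diff Tb_cont Tb_ord (fun j => principal_part_ppart (htb j)) depb i nm_lt.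
pose K := Kmat psi1 psi2 psib1 psib2.
(* The entries of [K n n] are the series values at the origin; the products with [q n * r n] cancel
   in the determinant and only [y * x] remains. *)
have Ku : K n n \in unitmx.
  have [h [kap [hh _ hE [x x0 [hx0 hx1]]]]] := psi_expansion hq hr hqr hqr1 n psi_s psi_l.
  have [g [kab [hg _ gE [y y0 [gy0 gy1]]]]] := psi_expansion hq hr hqr hqr1 n psib_s psib_l.
  have Ki i : Kcf false (pairf psi1 psi2) i n n = h i 0.
    by rewrite (wiener_coef0 (hh i)) -(coef_int 0 (hh i) (hE i)) addr0.
  have Kbi i : Kcf true (pairf psib1 psib2) i n n = g i 0.
    by rewrite (wiener_coef0 (hg i)) -(coef_int 0 (hg i) (gE i)) addr0.
  rewrite unitmxE unitfE det2 !KmatE /= !Ki !Kbi hx0 hx1 gy0 gy1.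
  have -> : 1 * y * ((1 - q n * r n) * x) - - q n * x * (r n * y) = y * x by ring.
  by rewrite mulf_neq0.
have Ome k : Om k = _ := OmegaE false Rf ms t gam k zs0.
have Ombe k : Omb k = _ := OmegaE true Rbf mbs tb gamb k zbs0.
pose S L := \sum_(l < L) K n (n + l%:Z) *m Omat Om Omb (n + l%:Z + m).
have SE L i j : S L i j = \sum_(l < L) if j == ord0 then Kcf false (pairf psi1 psi2) i n (n + l%:Z) * Om (n + l%:Z + m)
    else Kcf true (pairf psib1 psib2) i n (n + l%:Z) * Omb (n + l%:Z + m).
  rewrite summxE; apply: eq_bigr => l _; rewrite mxE sum2 !KmatE !mxE /=.
  by have [->|->] := ord2P j; rewrite /= ?mulr0 ?add0r ?addr0.
(* The off-diagonal kernel exchanges the columns: the first column pairs [psi] with [Om] and tends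
   to minus the barred coefficients, the second does the reverse. *)
have Slim i j : slim (fun L => S L i j) (- K n m i j).
  rewrite KmatE; have [->|->] := ord2P j => /=.
    by apply: eq_slim (row i) => L; rewrite SE /=; apply: eq_bigr => l _; rewrite Ome.
  by apply: eq_slim (rowb i) => L; rewrite SE /=; apply: eq_bigr => l _; rewrite Ombe.
apply: mx_cvg => i j; apply/cvg_natP.
(* Multiplication by the inverse of [K n n] turns the term [l = 0] into the kernel at [n + m], which
   is subtracted; the shift [L + 1] accounts for it, as the sum of the statement starts at
   [n + 1]. *)
have lim : slim (fun L => \sum_k invmx (K n n) i k * S (L + 1)%N k j - Omat Om Omb (n + m) i j)
    ((- (M n m + Omat Om Omb (n + m))) i j).
  rewrite opprD !mxE -sumrN; apply: slimB; last exact: slim_cst.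
  by apply: slim_big => k; rewrite -mulrN; apply: slimZ; exact: (slim_shift (u := fun L => S L k j) 1 (Slim k j)).
apply: eq_slim lim => L.
have -> : \sum_k invmx (K n n) i k * S (L + 1)%N k j = (invmx (K n n) *m S (L + 1)%N) i j by rewrite mxE.
rewrite addn1 /S big_ord_recl addr0 mulmxDr mulKmx//.
have mxD (A B : 'M[CC R]_2) : (A + B) i j - A i j = B i j by rewrite mxE addrC addKr.
rewrite mxD mulmx_sumr.
by congr (fun_of_matrix _ i j); apply: eq_bigr => l _; rewrite mulmxA.
Qed.
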